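(* Let $M^3$ be a nondegenerate positive definite affine hypersurface of $\mathbb R^4$ which admits a pointwise $SO(2)$-symmetry or a pointwise $\mathbb Z_3$-symmetry, and with the globally defined functions satisfying $a=-\eta^2+\mu_1^2$ and $\eta=\mu_1$ on $M^3$. Then $M^3$ is affinely equivalent to $$F:I\times N^2\to\mathbb R^4,\qquad (t,u,v)\mapsto(u,\ v,\ f(u,v)+\gamma_2(t),\ \gamma_1(t)),$$ where $\psi:N^2\to\mathbb R^3$, $(u,v)\mapsto(u,v,f(u,v))$, is an improper affine sphere with affine normal $(0,0,1)$ and $\gamma=(\gamma_1,\gamma_2):I\to\mathbb R^2$ is an affine curve. Moreover, if $M^3$ admits a pointwise $SO(2)$-symmetry, then $N^2$ is an elliptic paraboloid.
   Context: Blaschke structure: for a nondegenerate immersed hypersurface $F:M^n\to\mathbb R^{n+1}$, with $D$ the standard flat connection and $\det$ the standard volume form, the affine (Blaschke) normal $\xi$ is the transversal field, unique up to sign, such that $D_XY=\nabla_XY+h(X,Y)\xi$, $D_X\xi=-SX$ (tangential), and $|\det(X_1,\dots,X_n,\xi)|=|\det(h(X_i,X_j))|^{1/2}$. $\nabla$ is the induced connection, $h$ the affine metric, $S$ the affine shape operator; $\hat\nabla$ is the Levi-Civita connection of $h$, and $K(X,Y)=K_XY=\nabla_XY-\hat\nabla_XY$ is the difference tensor. $h(K(X,Y),Z)$ is totally symmetric and $\operatorname{trace}K_X=0$. $M$ is positive definite if $h$ is (for suitable sign of $\xi$). Symmetry: $M^3$ admits a pointwise $\mathbb Z_3$-symmetry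 (resp. $SO(2)$-symmetry) if at every $p\in M$ the group of orientation-preserving linear maps of $T_pM$ preserving $h$, $S$ and $K$ is isomorphic to $\mathbb Z_3$ (resp. $SO(2)$). Functions: for such $M^3$ there is near every point a smooth $h$-orthonormal frame $e_1,e_2,e_3$ with $K_{e_1}e_1=2\mu_1e_1$, $K_{e_1}e_2=-\mu_1e_2$, $K_{e_1}e_3=-\mu_1e_3$, $K_{e_2}e_2=-\mu_1e_1+\mu_2e_2$, $K_{e_2}e_3=-\mu_2e_3$, $K_{e_3}e_3=-\mu_1e_1-\mu_2e_2$, $Se_1=\lambda e_1$, $Se_2=ae_2$, $Se_3=ae_3$. Here $\mu_1\neq0$ everywhere, and $\mu_2$ vanishes exactly in the $SO(2)$ case. The field $e_1$ is determined up to sign and may be taken globally defined; $\eta$ is the function with $\hat\nabla_Xe_1=\eta X$ for all $X\perp e_1$. Changing the sign of $e_1$ changes the sign of both $\mu_1$ and $\eta$. An improper affine sphere is a nondegenerate hypersurface whose affine normal is constant (equivalently $S=0$). An affine curve in $\mathbb R^2$ is a smooth nondegenerate curve, $\gamma_1'\gamma_2''-\gamma_1''\gamma_2'\ne0$; $I$ is an open interval. Affinely equivalent means equal up to an affine transformation of $\mathbb R^4$ (and reparametrization).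
   Formalization: The product form I×N is asserted near every point, with one affine map per connected component of M, and N is an open part of an elliptic paraboloid when SO(2) holds; a global product fails, e.g. for a ball-shaped piece of an example or a disconnected M. *)

(* Defs.v *)
From HB Require Import structures.
From mathcomp Require Export all_boot all_order all_algebra.
From mathcomp Require Export all_classical all_reals all_analysis.

Set Implicit Arguments.
Unset Strict Implicit.
Unset Printing Implicit Defensive.

Import Order.TTheory GRing.Theory Num.Theory.
Export numFieldNormedType.Exports.

Local Open Scope classical_set_scope.
Local Open Scope ring_scope.

Fixpoint Ck_on (R : realType) (V W : normedModType R) (k : nat)
    (U : set V) (f : V -> W) : Prop :=
  match k with
  | 0 => forall p, U p -> {for p, continuous f}
  | k'.+1 => (forall p, U p -> differentiable f p) /\
             (forall v, Ck_on k' U (fun p => 'D_v f p))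
  end.

(* Only used for open [U]; the values of [f] outside [U] are irrelevant. *)
Definition smooth_on (R : realType) (V W : normedModType R)
    (U : set V) (f : V -> W) : Prop :=
  forall k, Ck_on k U f.

Definition smooth_at (R : realType) (V W : normedModType R)
    (p : V) (f : V -> W) : Prop :=
  exists U, [/\ open U, U p & smooth_on U f].

Definition vec (R : realType) n (s : seq R) : 'rV[R]_n := \row_(i < n) s`_i.
Arguments vec {R} n s.

(* The total functions [cto] and [cinv] are only meaningful on [cdom] and
   [cimg] respectively. *)
Record chart (R : realType) (n : nat) (M : topologicalType) := Chart {
  cdom : set M;
  cimg : set 'rV[R]_n;
  cto : M -> 'rV[R]_n;
  cinv : 'rV[R]_n -> M;
  cdom_open : open cdom;
  cimg_open : open cimg;
  cto_img : forall p, cdom p -> cimg (cto p);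
  cinv_dom : forall q, cimg q -> cdom (cinv q);
  ctoK : forall p, cdom p -> cinv (cto p) = p;
  cinvK : forall q, cimg q -> cto (cinv q) = q;
  cto_continuous : forall p, cdom p -> {for p, continuous cto};
  cinv_continuous : forall q, cimg q -> {for q, continuous cinv}
}.

Definition transition_dom (R : realType) n (M : topologicalType)
    (c d : chart R n M) : set 'rV[R]_n :=
  cimg c `&` cinv c @^-1` cdom d.

Definition compatible (R : realType) n (M : topologicalType)
    (c d : chart R n M) : Prop :=
  smooth_on (transition_dom c d) (cto d \o cinv c) /\
  smooth_on (transition_dom d c) (cto c \o cinv d).

Definition smooth_manifold (R : realType) n (M : topologicalType)
    (A : set (chart R n M)) : Prop :=
  [/\ hausdorff_space M, @second_countable M,
      forall p, exists2 c, A c & cdom c p &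
      forall c d, A c -> A d -> compatible c d].

(* Membership in the maximal atlas containing [A]; such a [c] is the same thing
   as a diffeomorphism from an open subset of [M] onto an open subset of
   R^n. *)
Definition admissible (R : realType) n (M : topologicalType)
    (A : set (chart R n M)) (c : chart R n M) : Prop :=
  forall d, A d -> compatible c d.

(* A smooth vector field on [M], given by its components in all charts. *)
Definition vector_field (R : realType) n (M : topologicalType)
    (A : set (chart R n M)) (X : chart R n M -> 'rV[R]_n -> 'rV[R]_n) : Prop :=
  (forall c, A c -> smooth_on (cimg c) (X c)) /\
  (forall c d q, A c -> A d -> transition_dom c d q ->
     X d (cto d (cinv c q)) = 'D_(X c q) (cto d \o cinv c) q).

Definition bil (R : realType) n (B : 'M[R]_n) (v w : 'rV[R]_n) : R :=
  (v *m B *m w^T) 0 0.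

(* [nabla p v Y] is the covariant derivative at [p] of the vector field [Y] in
   the direction of the tangent vector [v]. *)
Definition connection (R : realType) n :=
  'rV[R]_n -> 'rV[R]_n -> ('rV[R]_n -> 'rV[R]_n) -> 'rV[R]_n.

(* [x : U -> R^(n+1)] is a nondegenerate immersed hypersurface in parametrized
   form, [xi] is its affine normal, [h] its affine metric, [S] its affine shape
   operator and [nabla] its induced connection.  Tangent vectors are coordinate
   rows: v stands for the vector 'D_v x p of R^(n+1), and the endomorphism with
   matrix [S p] is v |-> v *m S p.  The row [xi p] is put first in the
   determinant, which only affects its sign. *)
Record blaschke (R : realType) n (U : set 'rV[R]_n)
    (x xi : 'rV[R]_n -> 'rV[R]_n.+1) (h S : 'rV[R]_n -> 'M[R]_n)
    (nabla : connection R n) : Prop := Blaschke {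
  bl_smooth : smooth_on U x;
  bl_immersion : forall p v, U p -> 'D_v x p = 0 -> v = 0;
  bl_normal_smooth : smooth_on U xi;
  bl_transversal : forall p v, U p -> xi p <> 'D_v x p;
  bl_gauss : forall p v Y, U p -> smooth_at p Y ->
    'D_v (fun q => 'D_(Y q) x q) p =
      'D_(nabla p v Y) x p + bil (h p) v (Y p) *: xi p;
  bl_weingarten : forall p v, U p -> 'D_v xi p = - 'D_(v *m S p) x p;
  bl_nondegenerate : forall p, U p -> \det (h p) != 0;
  bl_volume : forall p (X : 'I_n -> 'rV[R]_n), U p ->
    `| \det (col_mx (xi p) (\matrix_(i < n) 'D_(X i) x p) : 'M[R]_n.+1) | =
      Num.sqrt `| \det (\matrix_(i < n, j < n) bil (h p) (X i) (X j)) |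
}.

Definition positive_definite (R : realType) n (B : 'M[R]_n) : Prop :=
  forall v, v != 0 -> 0 < bil B v v.

Definition lie_bracket (R : realType) n (X Y : 'rV[R]_n -> 'rV[R]_n)
    (p : 'rV[R]_n) : 'rV[R]_n :=
  'D_(X p) Y p - 'D_(Y p) X p.

Definition levi_civita (R : realType) n (U : set 'rV[R]_n)
    (h : 'rV[R]_n -> 'M[R]_n) (nabla : connection R n) : Prop :=
  (forall p X Y, U p -> smooth_at p X -> smooth_at p Y ->
     nabla p (X p) Y - nabla p (Y p) X = lie_bracket X Y p) /\
  (forall p v Y Z, U p -> smooth_at p Y -> smooth_at p Z ->
     'D_v (fun q => bil (h q) (Y q) (Z q)) p =
       bil (h p) (nabla p v Y) (Z p) + bil (h p) (Y p) (nabla p v Z)).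

(* The difference is tensorial, so it may be evaluated on the constant
   extension of [w]. *)
Definition difference_tensor (R : realType) n (nabla hnabla : connection R n)
    (p v w : 'rV[R]_n) : 'rV[R]_n :=
  nabla p v (cst w) - hnabla p v (cst w).

(* Orientation-preserving linear maps v |-> v *m T preserving [h], [S], [K]. *)
Definition symmetry_group (R : realType) n (h S : 'M[R]_n)
    (K : 'rV[R]_n -> 'rV[R]_n -> 'rV[R]_n) : set 'M[R]_n :=
  [set T | [/\ 0 < \det T,
      forall v w, bil h (v *m T) (w *m T) = bil h v w,
      forall v : 'rV[R]_n, (v *m T) *m S = (v *m S) *m T &
      forall v w, K (v *m T) (w *m T) = K v w *m T]].

Definition group_isomorphic (T1 T2 : Type) (G1 : set T1) (op1 : T1 -> T1 -> T1)
    (G2 : set T2) (op2 : T2 -> T2 -> T2) : Prop :=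
  exists2 phi : T1 -> T2, set_bij G1 G2 phi &
    forall x y, G1 x -> G1 y -> phi (op1 x y) = op2 (phi x) (phi y).

Definition SO (R : realType) n : set 'M[R]_n :=
  [set Q | Q *m Q^T = 1%:M /\ \det Q = 1].

Definition is_Z3 (R : realType) n (G : set 'M[R]_n) : Prop :=
  group_isomorphic G mulmx [set: 'Z_3] (fun i j => i + j).

Definition is_SO2 (R : realType) n (G : set 'M[R]_n) : Prop :=
  group_isomorphic G mulmx (@SO R 2) mulmx.

Definition pointwise_symmetry (R : realType) n (M : topologicalType)
    (A : set (chart R n M)) (h S : chart R n M -> 'rV[R]_n -> 'M[R]_n)
    (nabla hnabla : chart R n M -> connection R n)
    (is_group : set 'M[R]_n -> Prop) : Prop :=
  forall c q, A c -> cimg c q ->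
    is_group (symmetry_group (h c q) (S c q)
                             (difference_tensor (nabla c) (hnabla c) q)).

Record adapted_frame_at (R : realType) (h S : 'M[R]_3)
    (K : 'rV[R]_3 -> 'rV[R]_3 -> 'rV[R]_3) (e1 e2 e3 : 'rV[R]_3)
    (mu1 mu2 lambda a : R) : Prop := AdaptedFrameAt {
  af_orthonormal :
    [/\ bil h e1 e1 = 1, bil h e2 e2 = 1 & bil h e3 e3 = 1] /\
    [/\ bil h e1 e2 = 0, bil h e1 e3 = 0 & bil h e2 e3 = 0];
  af_K11 : K e1 e1 = (2 * mu1) *: e1;
  af_K12 : K e1 e2 = - mu1 *: e2;
  af_K13 : K e1 e3 = - mu1 *: e3;
  af_K22 : K e2 e2 = - mu1 *: e1 + mu2 *: e2;
  af_K23 : K e2 e3 = - mu2 *: e3;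
  af_K33 : K e3 e3 = - mu1 *: e1 - mu2 *: e2;
  af_S1 : e1 *m S = lambda *: e1;
  af_S2 : e2 *m S = a *: e2;
  af_S3 : e3 *m S = a *: e3
}.

(* [e1] is a global unit field which near every point extends to a smooth
   adapted frame; [mu1], [a] and [eta] are the associated global functions.
   The fields [e2], [e3] (hence [mu2]) are not canonical and are kept local. *)
Definition symmetry_functions (R : realType) (M : topologicalType)
    (A : set (chart R 3 M)) (h S : chart R 3 M -> 'rV[R]_3 -> 'M[R]_3)
    (nabla hnabla : chart R 3 M -> connection R 3)
    (e1 : chart R 3 M -> 'rV[R]_3 -> 'rV[R]_3) (mu1 a eta : M -> R) : Prop :=
  [/\ vector_field A e1,
      (forall c q, A c -> cimg c q ->
         exists (W : set 'rV[R]_3) (e2 e3 : 'rV[R]_3 -> 'rV[R]_3)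
                (mu2 lambda : 'rV[R]_3 -> R),
         [/\ open W, W q, W `<=` cimg c,
             smooth_on W e2 /\ smooth_on W e3 &
             forall r, W r ->
               adapted_frame_at (h c r) (S c r)
                 (difference_tensor (nabla c) (hnabla c) r)
                 (e1 c r) (e2 r) (e3 r)
                 (mu1 (cinv c r)) (mu2 r) (lambda r) (a (cinv c r))]) &
      (forall c q v, A c -> cimg c q -> bil (h c q) v (e1 c q) = 0 ->
         hnabla c q v (e1 c) = eta (cinv c q) *: v)].

Definition improper_affine_sphere (R : realType) n (U : set 'rV[R]_n)
    (x : 'rV[R]_n -> 'rV[R]_n.+1) (xi : 'rV[R]_n.+1) : Prop :=
  exists h S nabla, blaschke U x (cst xi) h S nabla.

Definition graph (R : realType) (f : 'rV[R]_2 -> R) (y : 'rV[R]_2) :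
    'rV[R]_3 :=
  vec 3 [:: y 0 0; y 0 1; f y].

Definition affine_curve (R : realType) (I : set R) (g1 g2 : R -> R) : Prop :=
  [/\ smooth_on I g1, smooth_on I g2 &
      forall t, I t ->
        derive1 g1 t * derive1n 2 g2 t - derive1n 2 g1 t * derive1 g2 t != 0].

(* The affine images of the surface z = x^2 + y^2. *)
Definition elliptic_paraboloid (R : realType) (E : set 'rV[R]_3) : Prop :=
  exists (P : 'M[R]_3) (b : 'rV[R]_3), P \in unitmx /\
    E = [set z *m P + b | z in range (graph
           (fun y : 'rV[R]_2 => y 0 0 ^+ 2 + y 0 1 ^+ 2))].

(* Main.v *)
(** Put [E = dF(e1)] and [N = xi - 2 mu1 E].  When [a = 0] and [eta = mu1], the
    Gauss and Codazzi equations give, with [tau = h(_, e1)],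
      [dN = - 2 mu1 tau N]  and  [dE = tau (4 mu1 E + N)].
    So [N] spans a fixed line, [E] is constant along the leaves of [ker tau] and
    stays in a fixed plane containing that line, and the tangent planes of the
    leaves lie in the kernel of a fixed covector.  In affine coordinates adapted
    to these data [F] is a graph over (u, v, t) whose height has no mixed
    derivatives between t and (u, v), since [E] does not vary along the leaves;
    hence it splits as [f (u, v) + gamma2 t].  The Gauss equation identifies
    [Hess f] with a multiple of [h] on the leaf, and the volume condition turns
    into [|det Hess f| = 1].  In the SO(2) case [mu2 = 0] makes [Hess f] constant.
    Being adapted is an open and closed condition, so one choice of affine
    coordinates serves the whole connected component. *)

Require Import Defs.
From mathcomp Require Import all_boot all_order all_algebra.
From mathcomp Require Import all_classical all_reals all_analysis.
From mathcomp Require Import ring lra.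

Set Implicit Arguments.
Unset Strict Implicit.
Unset Printing Implicit Defensive.

Import Order.TTheory GRing.Theory Num.Theory.
Import numFieldNormedType.Exports.

Local Open Scope classical_set_scope.
Local Open Scope ring_scope.

(** * Smooth maps between normed modules *)

(** The rates of change fix every normalisation. In adapted coordinates [N] scales with rate
    [- 2 mu1 tau], the last coordinate [E3] of [E] with rate [4 mu1 tau], the covector annihilating
    the leaves with rate [- 4 mu1 tau]. So, with [N2] the third coordinate of [N], the product
    [E3 * N2 ^ 2] is constant; the choice of [L] puts it equal to 1, and the volume condition then
    gives [|det Hess f| = (E3 * N2 ^ 2) ^ 2 = 1].

    The symmetry hypothesis is an abstract isomorphism of groups, while a frame gives concrete
    candidates for symmetries. Three facts link them: both groups are abelian, the rotation by a
    third of a turn about [e1] is always a symmetry, and SO(2) contains an involution. They yield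
    [mu1 != 0] and, in the SO(2) case, [mu2 = 0].

    Connections are bare functions of a point, a direction and a field, and [h] and [mu1] come
    without regularity. Linearity, the Leibniz rule and smoothness are recovered from the Gauss
    formula, from torsion-freeness and from the smooth orthonormal frame. *)

Lemma is_diff_eps (R : realType) (V W : normedModType R) (f : V -> W) (x : V)
    (L : {linear V -> W}) : continuous L ->
  (forall e, 0 < e -> \forall h \near (0 : V),
     `|f (h + x) - f x - L h| <= e * `|h|) ->
  differentiable f x /\ 'd f x = L :> (V -> W).
Proof.
move=> Lc fL.
have fE : f \o shift x = cst (f x) + L +o_ (0 : V) id.
  apply/eqaddoP => e e0; apply: filterS (fL e e0) => h /=.
  by rewrite opprD addrA.
have dE := diff_unique Lc fE.
by split=> //; apply/diff_locallyP; rewrite dE.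
Qed.

Lemma differentiable_eps (R : realType) (V W : normedModType R) (f : V -> W)
    (x : V) : differentiable f x ->
  forall e, 0 < e -> \forall h \near (0 : V),
     `|f (h + x) - f x - 'd f x h| <= e * `|h|.
Proof.
move=> /diff_locallyP[_ /eqaddoP fE] e e0.
apply: filterS (fE e e0) => h /=.
by rewrite opprD addrA.
Qed.

Lemma near_eq_differentiable (R : realType) (V W : normedModType R)
    (f g : V -> W) (x : V) :
  (\forall y \near x, f y = g y) -> differentiable f x -> differentiable g x.
Proof.
move=> fg df.
suff [] : differentiable g x /\ 'd g x = 'd f x :> (V -> W) by [].
apply: is_diff_eps => [|e e0]; first exact: diff_continuous.
have fgx := nbhs_singleton fg.
have fg0 : \forall h \near (0 : V), f (h + x) = g (h + x).
  by move: fg; rewrite (near_shift (0 : V)); apply: filterS => h /=; rewrite subr0.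
by near do rewrite -fgx -(near fg0 _)//; exact: differentiable_eps.
Unshelve. all: by end_near. Qed.

(** Openness of [U] makes values off [U] invisible to derivatives. The closure properties below use
    this to replace ['D_v] of a compound by the formula of a derivative rule that is only valid on
    [U]. *)
Lemma Ck_ext (R : realType) (V W : normedModType R) k (U : set V)
    (f g : V -> W) : open U -> (forall p, U p -> f p = g p) ->
  Ck_on k U f -> Ck_on k U g.
Proof.
move=> oU; elim: k f g => [|k IH] f g fg /=.
  move=> cf p Up; have Unear : \forall q \near p, f q = g q.
    by apply: filterS fg _; exact: open_nbhs_nbhs.
  rewrite /prop_for /continuous_at -(fg _ Up).
  exact/(cvg_trans _ (cf p Up))/near_eq_cvg.
have Unear p : U p -> \forall q \near p, f q = g q.
  by move=> Up; apply: filterS fg _; exact: open_nbhs_nbhs.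
case=> df Df; split=> [p Up|v].
  exact: near_eq_differentiable (Unear p Up) (df p Up).
apply: IH (Df v) => p Up; exact: near_eq_derive (Unear p Up).
Qed.

Lemma Ck_sub (R : realType) (V W : normedModType R) k (U U' : set V)
    (f : V -> W) : U' `<=` U -> Ck_on k U f -> Ck_on k U' f.
Proof.
move=> sU; elim: k f => [|k IH] f /=; first by move=> cf p /sU; exact: cf.
by case=> df Df; split=> [p /sU|v]; [exact: df|exact/IH].
Qed.

Lemma CkS (R : realType) (V W : normedModType R) k (U : set V)
    (f : V -> W) : Ck_on k.+1 U f -> Ck_on k U f.
Proof.
elim: k f => [|k IH] f.
  by case=> df _ p Up; exact/differentiable_continuous/df.
by case=> df Df; split=> // v; exact/IH.
Qed.

Lemma Ck_cst (R : realType) (V W : normedModType R) k (U : set V) (a : W) :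
  Ck_on k U (fun _ : V => a).
Proof.
elim: k a => [|k IH] a /=; first by move=> p _; exact: cst_continuous.
split=> [p _|v]; first exact: differentiable_cst.
have -> : (fun p : V => 'D_v (fun=> a) p) = fun=> 0; last exact: IH.
by apply/funext => p; exact: derive_cst.
Qed.

Lemma Ck_linear (R : realType) (V W : normedModType R) k (U : set V)
    (f : {linear V -> W}) : continuous f -> Ck_on k U f.
Proof.
move=> cf; case: k => [|k] /=; first by move=> p _; exact: cf.
split=> [p _|v]; first exact: linear_differentiable.
have -> : (fun p : V => 'D_v f p) = fun=> f v; last exact: Ck_cst.
apply/funext => p; rewrite deriveE; last exact: linear_differentiable.
by rewrite diff_lin.
Qed.

Lemma CkD (R : realType) (V W : normedModType R) k (U : set V)
    (f g : V -> W) : open U ->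
  Ck_on k U f -> Ck_on k U g -> Ck_on k U (fun p => f p + g p).
Proof.
move=> oU; elim: k f g => [|k IH] f g /=.
  by move=> cf cg p Up; apply: continuousD; [exact: cf|exact: cg].
move=> [df Df] [dg Dg]; split=> [p Up|v].
  by apply: differentiableD; [exact: df|exact: dg].
apply: Ck_ext (IH _ _ (Df v) (Dg v)) => // p Up.
by rewrite -deriveD//; apply: diff_derivable; [exact: df|exact: dg].
Qed.

Lemma CkN (R : realType) (V W : normedModType R) k (U : set V)
    (f : V -> W) : open U -> Ck_on k U f -> Ck_on k U (fun p => - f p).
Proof.
move=> oU; elim: k f => [|k IH] f /=.
  by move=> cf p Up; apply: continuousN; exact: cf.
move=> [df Df]; split=> [p Up|v].
  by apply: differentiableN; exact: df.
apply: Ck_ext (IH _ (Df v)) => // p Up.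
by rewrite -deriveN//; apply: diff_derivable; exact: df.
Qed.

Lemma CkM (R : realType) (V : normedModType R) k (U : set V)
    (f g : V -> R) : open U ->
  Ck_on k U f -> Ck_on k U g -> Ck_on k U (fun p => f p * g p).
Proof.
move=> oU; elim: k f g => [|k IH] f g.
  by move=> cf cg p Up; apply: continuousM; [exact: cf|exact: cg].
move=> Cf Cg; have [df Df] := Cf; have [dg Dg] := Cg; split=> [p Up|v].
  by apply: differentiableM; [exact: df|exact: dg].
(* The product rule multiplies each factor by a derivative of the other, so the undifferentiated
   factors are first lowered by one order. *)
have C1 := CkD oU (IH _ _ (CkS Cf) (Dg v)) (IH _ _ (CkS Cg) (Df v)).
apply: Ck_ext C1 => // p Up.
by apply/esym/deriveM; apply: diff_derivable; [exact: df|exact: dg].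
Qed.

(** The derivative [- f^-1 * f^-1 * 'D_v f] involves [f^-1] only to the previous order, so the
    induction is on [k] alone, with [f] fixed. *)
Lemma CkV (R : realType) (V : normedModType R) k (U : set V)
    (f : V -> R) : open U -> (forall p, U p -> f p != 0) ->
  Ck_on k U f -> Ck_on k U (fun p => (f p)^-1).
Proof.
move=> oU f0; elim: k => [|k IH].
  by move=> cf p Up; apply: continuousV; [exact: f0|exact: cf].
move=> Cf; have [df Df] := Cf; split=> [p Up|v].
  by apply: differentiableV; [exact: df|exact: f0].
have CV := IH (CkS Cf).
have C1 := CkN oU (CkM oU (CkM oU CV CV) (Df v)).
apply: Ck_ext C1 => // p Up.
rewrite deriveV ?f0//; last by apply: diff_derivable; exact: df.
rewrite expr2 invfM; exact/esym/mulNr.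
Qed.

Lemma Ck_sum (R : realType) (V W : normedModType R) k (U : set V)
    (I : Type) (r : seq I) (P : pred I) (f : I -> V -> W) : open U ->
  (forall i, P i -> Ck_on k U (f i)) ->
  Ck_on k U (fun p => \sum_(i <- r | P i) f i p).
Proof.
move=> oU Cf; elim: r => [|i r IH].
  by apply: Ck_ext (Ck_cst k U (0 : W)) => // p _; rewrite big_nil.
have [Pi|Pi] := boolP (P i).
  by apply: Ck_ext (CkD oU (Cf i Pi) IH) => // p _; rewrite big_cons Pi.
by apply: Ck_ext IH => // p _; rewrite big_cons (negbTE Pi).
Qed.

Lemma Ck_prod (R : realType) (V : normedModType R) k (U : set V)
    (I : Type) (r : seq I) (P : pred I) (f : I -> V -> R) : open U ->
  (forall i, P i -> Ck_on k U (f i)) ->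
  Ck_on k U (fun p => \prod_(i <- r | P i) f i p).
Proof.
move=> oU Cf; elim: r => [|i r IH].
  by apply: Ck_ext (Ck_cst k U (1 : R)) => // p _; rewrite big_nil.
have [Pi|Pi] := boolP (P i).
  by apply: Ck_ext (CkM oU (Cf i Pi) IH) => // p _; rewrite big_cons Pi.
by apply: Ck_ext IH => // p _; rewrite big_cons (negbTE Pi).
Qed.

Lemma differentiable_mxP (R : realType) (V : normedModType R) m n
    (f : V -> 'M[R]_(m, n)) x :
  differentiable f x <-> forall i j, differentiable (fun p => f p i j : R) x.
Proof.
split=> [df i j|df].
  exact: differentiable_comp df (differentiable_coord _ _ _).
have -> : f = \sum_(i < m) \sum_(j < n) fun p => f p i j *: delta_mx i j.
  apply/funext => p; rewrite {1}[f p]matrix_sum_delta fct_sumE.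
  by apply: eq_bigr => i _; rewrite fct_sumE.
apply: differentiable_sum => i; apply: differentiable_sum => j.
exact: differentiableZl.
Qed.

Lemma derive_entry (R : realType) (V : normedModType R) m n
    (f : V -> 'M[R]_(m, n)) x v i j :
  differentiable f x -> 'D_v f x i j = 'D_v (fun p => f p i j) x.
Proof. by move=> df; rewrite derive_mx ?mxE//; exact: diff_derivable. Qed.

Lemma Ck_mxP (R : realType) (V : normedModType R) k (U : set V) m n
    (f : V -> 'M[R]_(m, n)) : open U ->
  Ck_on k U f <-> forall i j, Ck_on k U (fun p => f p i j : R).
Proof.
move=> oU; elim: k f => [|k IH] f; split.
- move=> cf i j p Up.
  by have := continuous_comp (cf p Up) (@coord_continuous _ _ _ i j (f p)).
- move=> cf p Up; rewrite /prop_for /continuous_at.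
  apply/cvgrPdist_le => /= e e0.
  near=> x.
  rewrite /Num.Def.normr/= mx_normrE (bigmax_le _ (ltW e0))//= => i _.
  rewrite !mxE/=.
  move: i; near: x; apply: filter_forall => /= i.
  exact: ((cvgrPdist_le _ _).1 (cf i.1 i.2 p Up)).
- move=> [df Df] i j; split=> [p Up|v]; first exact: (differentiable_mxP f p).1
  (df p Up) i j.
  have := (IH _).1 (Df v) i j; apply: Ck_ext => // p Up.
  by rewrite derive_entry//; exact: df.
- move=> Cf; have df p : U p -> differentiable f p.
    by move=> Up; apply/differentiable_mxP => i j; have [+ _] := Cf i j; exact.
  split=> // v; apply/IH => i j; have [_ /(_ v)] := Cf i j.
  by apply: Ck_ext => // p Up; rewrite derive_entry//; exact: df.
Unshelve. all: by end_near. Qed.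

Lemma derive_comp_row (R : realType) (V W : normedModType R) m
    (f : V -> 'rV[R]_m) (g : 'rV[R]_m -> W) p v :
  differentiable f p -> differentiable g (f p) ->
  'D_v (g \o f) p = 'D_('D_v f p) g (f p).
Proof.
move=> df dg; rewrite !deriveE//; last exact: differentiable_comp.
by rewrite diff_comp.
Qed.

Lemma derive_row (R : realType) (W : normedModType R) m
    (g : 'rV[R]_m -> W) p v : differentiable g p ->
  'D_v g p = \sum_i v 0 i *: 'D_(delta_mx 0 i) g p.
Proof.
move=> dg; rewrite deriveE// [in LHS](row_sum_delta v) linear_sum.
by apply: eq_bigr => i _; rewrite linearZ/= deriveE.
Qed.

(** With rows as the source of [g], the chain rule is a finite sum of products of an entry of
    ['D_v f] with a partial derivative of [g] composed with [f]; the induction on [k] therefore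
    generalises over [g]. *)
Lemma Ck_comp (R : realType) (V : normedModType R) m k (U : set V)
    (U' : set 'rV[R]_m) (f : V -> 'rV[R]_m) (g : 'rV[R]_m -> R) :
  open U -> open U' -> (forall p, U p -> U' (f p)) ->
  Ck_on k U f -> Ck_on k U' g -> Ck_on k U (g \o f).
Proof.
move=> oU oU' fU; elim: k g => [|k IH] g.
  by move=> cf cg p Up; apply: continuous_comp; [exact: cf|exact/cg/fU].
move=> Cf [dg Dg]; have [df Df] := Cf; split=> [p Up|v].
  by apply: differentiable_comp; [exact: df|exact/dg/fU].
pose D p := \sum_i 'D_v f p 0 i * ('D_(delta_mx 0 i) g \o f) p.
have : Ck_on k U D.
  apply: Ck_sum => // i _; apply: CkM => //; last exact: IH (CkS Cf) (Dg _).
  exact: (Ck_mxP k _ oU).1 (Df v) 0 i.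
apply: Ck_ext => // p Up.
by rewrite derive_comp_row ?derive_row//; [exact/dg/fU|exact: df|exact/dg/fU].
Qed.

Lemma Ck_coord (R : realType) m n k (U : set 'M[R]_(m, n)) i j :
  Ck_on k U (fun M : 'M[R]_(m, n) => M i j : R).
Proof.
case: k => [|k] /=; first by move=> p _; exact: coord_continuous.
split=> [p _|v]; first exact: differentiable_coord.
have -> : (fun p => 'D_v (fun M : 'M[R]_(m, n) => M i j : R) p) = fun=> v i j.
  apply/funext => p; rewrite -(@derive_entry _ _ _ _ id)//.
  by rewrite derive_id.
exact: Ck_cst.
Qed.

Lemma Ck_id (R : realType) m n k (U : set 'M[R]_(m, n)) : open U ->
  Ck_on k U (@id 'M[R]_(m, n)).
Proof. by move=> oU; apply/Ck_mxP => // i j; exact: Ck_coord. Qed.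

Lemma Ck_mulmx (R : realType) (V : normedModType R) k (U : set V) m n q
    (f : V -> 'M[R]_(m, n)) (g : V -> 'M[R]_(n, q)) : open U ->
  Ck_on k U f -> Ck_on k U g -> Ck_on k U (fun p => f p *m g p).
Proof.
move=> oU /Ck_mxP Cf /Ck_mxP Cg; apply/Ck_mxP => // i j.
have := @Ck_sum R V R k U _ (index_enum 'I_n) xpredT
  (fun l p => f p i l * g p l j) oU.
move=> /(_ _)/(Ck_ext oU); apply=> [p _|l _]; first by rewrite mxE.
by apply: CkM => //; [exact: Cf|exact: Cg].
Qed.

Lemma Ck_scale (R : realType) (V : normedModType R) k (U : set V) m n
    (a : V -> R) (f : V -> 'M[R]_(m, n)) : open U ->
  Ck_on k U a -> Ck_on k U f -> Ck_on k U (fun p => a p *: f p).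
Proof.
move=> oU Ca /Ck_mxP Cf; apply/Ck_mxP => // i j.
by apply: Ck_ext (CkM oU Ca (Cf oU i j)) => // p _; rewrite mxE.
Qed.

Lemma Ck_tr (R : realType) (V : normedModType R) k (U : set V) m n
    (f : V -> 'M[R]_(m, n)) : open U ->
  Ck_on k U f -> Ck_on k U (fun p => (f p)^T).
Proof.
move=> oU /Ck_mxP Cf; apply/Ck_mxP => // i j.
by apply: Ck_ext (Cf oU j i) => // p _; rewrite mxE.
Qed.

Lemma Ck_compmx (R : realType) (V : normedModType R) m k (U : set V) n1 n2
    (U' : set 'rV[R]_m) (f : V -> 'rV[R]_m) (g : 'rV[R]_m -> 'M[R]_(n1, n2)) :
  open U -> open U' -> (forall p, U p -> U' (f p)) ->
  Ck_on k U f -> Ck_on k U' g -> Ck_on k U (g \o f).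
Proof.
move=> oU oU' fU Cf /(Ck_mxP _ _ oU') Cg; apply/Ck_mxP => // i j.
exact: Ck_comp oU oU' fU Cf (Cg i j).
Qed.

Lemma Ck_det (R : realType) (V : normedModType R) k (U : set V) n
    (f : V -> 'M[R]_n) : open U ->
  Ck_on k U f -> Ck_on k U (fun p => \det (f p)).
Proof.
move=> oU /Ck_mxP Cf; apply: Ck_sum => // s _; apply: CkM => //.
  exact: Ck_cst.
by apply: Ck_prod => // i _; exact: Cf.
Qed.

(** Cramer's rule: the inverse is the adjugate divided by the determinant, and both are polynomial
    in the entries. *)
Lemma Ck_invmx (R : realType) (V : normedModType R) k (U : set V) n
    (f : V -> 'M[R]_n) : open U -> (forall p, U p -> f p \in unitmx) ->
  Ck_on k U f -> Ck_on k U (fun p => invmx (f p)).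
Proof.
move=> oU fu Cf.
have C1 : Ck_on k U (fun p => (\det (f p))^-1 *: \adj (f p)).
  apply: Ck_scale => //.
    by apply: CkV => //; [move=> p /fu; rewrite unitmxE unitfE|exact: Ck_det].
  apply/Ck_mxP => // i j.
  have C2 : Ck_on k U (fun p => cofactor (f p) j i).
    apply: CkM => //; first exact: Ck_cst.
    apply: Ck_det => //; apply/Ck_mxP => // i' j'.
    have := (Ck_mxP k f oU).1 Cf (lift j i') (lift i j').
    by apply: Ck_ext => // p _; rewrite !mxE.
  by apply: Ck_ext C2 => // p _; rewrite mxE.
by apply: Ck_ext C1 => // p Up; rewrite /invmx fu.
Qed.

Lemma smooth_diff (R : realType) (V W : normedModType R) (U : set V)
    (f : V -> W) p : smooth_on U f -> U p -> differentiable f p.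
Proof. by move=> /(_ 1)[+ _]; exact. Qed.

Lemma smooth_derive (R : realType) (V W : normedModType R) (U : set V)
    (f : V -> W) v : smooth_on U f -> smooth_on U (fun p => 'D_v f p).
Proof. by move=> sf k; have [_ +] := sf k.+1; exact. Qed.

Lemma smooth_ext (R : realType) (V W : normedModType R) (U : set V)
    (f g : V -> W) : open U -> (forall p, U p -> f p = g p) ->
  smooth_on U f -> smooth_on U g.
Proof. by move=> oU fg sf k; exact: Ck_ext oU fg (sf k). Qed.

Lemma smooth_sub (R : realType) (V W : normedModType R) (U U' : set V)
    (f : V -> W) : U' `<=` U -> smooth_on U f -> smooth_on U' f.
Proof. by move=> sU sf k; exact: Ck_sub sU (sf k). Qed.

Lemma smooth_row_derive (R : realType) n m1 m2
  (U : set 'rV[R]_n) (Y : 'rV[R]_n -> 'rV[R]_n) (x : 'rV[R]_n -> 'M[R]_(m1, m2)) :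
  open U -> smooth_on U Y -> smooth_on U x ->
  smooth_on U (fun q => 'D_(Y q) x q).
Proof.
move=> oU sY sx k.
have C1 : Ck_on k U (fun q => \sum_i Y q 0 i *: 'D_(delta_mx 0 i) x q).
  apply: Ck_sum => // i _; apply: Ck_scale => //.
    exact: (Ck_mxP k Y oU).1 (sY k) 0 i.
  exact: smooth_derive.
by apply: Ck_ext C1 => // p Up; rewrite [RHS]derive_row//; exact: smooth_diff Up.
Qed.

Lemma differentiableMx (R : realType) (V : normedModType R) m n q
    (f : V -> 'M[R]_(m, n)) (g : V -> 'M[R]_(n, q)) x :
  differentiable f x -> differentiable g x ->
  differentiable (fun p => f p *m g p) x.
Proof.
move=> df dg; apply/differentiable_mxP => i j.
have -> : (fun p => (f p *m g p) i j : R) =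
    \sum_l (fun p => f p i l * g p l j).
  by apply/funext => p; rewrite mxE fct_sumE.
apply: differentiable_sum => l; apply: differentiableM.
  exact: (differentiable_mxP f x).1.
exact: (differentiable_mxP g x).1.
Qed.

Lemma deriveMx (R : realType) (V : normedModType R) m n q
    (f : V -> 'M[R]_(m, n)) (g : V -> 'M[R]_(n, q)) x v :
  differentiable f x -> differentiable g x ->
  'D_v (fun p => f p *m g p) x = 'D_v f x *m g x + f x *m 'D_v g x.
Proof.
move=> df dg.
have dfg := differentiableMx df dg.
apply/matrixP => i j; rewrite derive_entry// !mxE.
have -> : (fun p => (f p *m g p) i j : R) =
    \sum_l (fun p => f p i l * g p l j).
  by apply/funext => p; rewrite mxE fct_sumE.
rewrite derive_sum => [|l]; last first.
  apply/diff_derivable/differentiableM.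
    exact: (differentiable_mxP f x).1.
  exact: (differentiable_mxP g x).1.
rewrite -big_split; apply: eq_bigr => l _ /=.
rewrite !derive_entry//.
rewrite [LHS]deriveM; last 2 first.
- exact/diff_derivable/(differentiable_mxP f x).1.
- exact/diff_derivable/(differentiable_mxP g x).1.
by rewrite addrC; congr (_ + _); rewrite [LHS]mulrC.
Qed.

Lemma derive_lincomb (R : realType) (V W : normedModType R) (f : V -> W) x
    (a : R) v w : differentiable f x ->
  'D_(a *: v + w) f x = a *: 'D_v f x + 'D_w f x.
Proof. by move=> df; rewrite !deriveE// linearP. Qed.

Lemma deriveDv (R : realType) (V W : normedModType R) (f : V -> W) x v w :
  differentiable f x -> 'D_(v + w) f x = 'D_v f x + 'D_w f x.
Proof. by move=> df; rewrite !deriveE// linearD. Qed.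

Lemma deriveZv (R : realType) (V W : normedModType R) (f : V -> W) x a v :
  differentiable f x -> 'D_(a *: v) f x = a *: 'D_v f x.
Proof. by move=> df; rewrite !deriveE// linearZ. Qed.

Lemma deriveNv (R : realType) (V W : normedModType R) (f : V -> W) x v :
  differentiable f x -> 'D_(- v) f x = - 'D_v f x.
Proof. by move=> df; rewrite !deriveE// linearN. Qed.

Lemma line_is_derive (R : realType) (V : normedModType R) (g : V -> R)
    p v (s : R) : differentiable g (p + s *: v) ->
  is_derive s 1 (fun s : R => g (p + s *: v)) ('D_v g (p + s *: v)).
Proof.
move=> dg.
have dl : is_diff s (fun s : R => p + s *: v) (fun s => s *: v).
  by apply: is_diff_eq; rewrite add0r.
have dgl : is_diff s (g \o (fun s : R => p + s *: v))
    ('d g (p + s *: v) \o (fun s => s *: v)).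
  by apply: is_diff_comp; exact: differentiableP.
apply: DeriveDef; first by apply/derivable1_diffP; case: dgl.
by rewrite [LHS]deriveE; [rewrite diff_val/= scale1r -deriveE|case: dgl].
Qed.

Lemma line_MVT (R : realType) (V : normedModType R) (g : V -> R) p v :
  (forall s : R, 0 <= s <= 1 -> differentiable g (p + s *: v)) ->
  exists2 s : R, 0 < s < 1 & g (p + v) - g p = 'D_v g (p + s *: v).
Proof.
move=> dg; pose f s : R := g (p + s *: v).
have fd (s : R) : 0 <= s <= 1 -> is_derive s (1 : R) f ('D_v g (p + s *: v)).
  by move=> s01; exact/line_is_derive/dg.
have [||c] := @MVT R f (fun s => 'D_v g (p + s *: v)) 0 1 ltr01.
- by move=> s /[!in_itv]/= /andP[s0 s1]; apply: fd; rewrite !ltW.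
- apply: derivable_within_continuous => s; rewrite in_itv/= => s01.
  by have [] := fd s s01.
rewrite in_itv/= => c01 E; exists c => //.
by move: E; rewrite /f scale1r scale0r addr0 subr0 mulr1.
Qed.

Lemma ball_segment (R : realType) (V : normedModType R) (q a b : V) (r s : R) :
  ball q r a -> ball q r b -> 0 <= s <= 1 -> ball q r (a + s *: (b - a)).
Proof.
rewrite -!ball_normE /= => qa qb /andP[s0 s1].
have -> : q - (a + s *: (b - a)) = (1 - s) *: (q - a) + s *: (q - b).
  rewrite scalerBl scale1r -addrA [- (_ *: _) + _]addrC -scalerBr opprB.
  by rewrite [q - b + _]addrC subrKA -[a - b]opprB scalerN opprD addrA.
apply: le_lt_trans (ler_normD _ _) _.
rewrite !normrZ ger0_norm ?subr_ge0// (ger0_norm s0).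
(* The strict inequality is taken from the second term, which requires [s > 0]; at [s = 0] the point
   is the endpoint [a]. *)
have [s00|s00] := eqVneq s 0.
  by rewrite s00 subr0 mul1r mul0r addr0.
have sp : 0 < s by rewrite lt_neqAle eq_sym s00.
apply: (@lt_le_trans _ _ ((1 - s) * r + s * r)); last by lra.
by apply: ler_ltD; [rewrite ler_wpM2l ?subr_ge0// ltW|rewrite ltr_pM2l].
Qed.

(** Balls are convex, so the mean value theorem along one segment suffices. For this reason the
    constancy arguments below are all made on balls. *)
Lemma ball_derive0_const (R : realType) (V : normedModType R) (g : V -> R)
    q r : (forall p, ball q r p -> differentiable g p) ->
  (forall p v, ball q r p -> 'D_v g p = 0) ->
  forall a b, ball q r a -> ball q r b -> g a = g b.
Proof.
move=> dg Dg a b qa qb; have [s s01|s s01] := @line_MVT R V g a (b - a).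
  exact/dg/ball_segment.
have s01' : 0 <= s <= 1 by case/andP: s01 => ? ?; rewrite !ltW.
by rewrite Dg ?subrKC; [move/subr0_eq|exact: ball_segment].
Qed.

Lemma derive_shiftr (R : realType) (V W : normedModType R) (g : V -> W) c p v :
  'D_v (fun q => g (q + c)) p = 'D_v g (p + c).
Proof. by rewrite /derive/=; under eq_fun do rewrite -addrA. Qed.

Lemma differentiable_shiftr (R : realType) (V W : normedModType R) (g : V -> W)
    c p : differentiable g (p + c) -> differentiable (fun q => g (q + c)) p.
Proof.
move=> dg; have : differentiable (g \o (fun q : V => q + c)) p => //.
by apply: differentiable_comp.
Qed.

(** * Symmetry of second derivatives *)

(** The mean value theorem is applied twice: in direction [v] to the increment [g (q + w) - g q],
    then in direction [w] to ['D_v g]. *)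
Lemma second_difference (R : realType) (V : normedModType R) (U : set V)
    (g : V -> R) p v w : smooth_on U g ->
  (forall s t : R, 0 <= s <= 1 -> 0 <= t <= 1 -> U (p + s *: v + t *: w)) ->
  exists s t : R, [/\ 0 <= s <= 1, 0 <= t <= 1 &
    g (p + v + w) - g (p + v) - (g (p + w) - g p) =
    'D_w (fun q => 'D_v g q) (p + s *: v + t *: w)].
Proof.
move=> sg Upvw.
have dU (s t : R) : 0 <= s <= 1 -> 0 <= t <= 1 ->
    differentiable g (p + s *: v + t *: w).
  by move=> s01 t01; exact/(smooth_diff sg)/Upvw.
have dU0 (s : R) : 0 <= s <= 1 -> differentiable g (p + s *: v).
  by move=> s01; have := dU s 0 s01; rewrite lexx ler01 scale0r addr0; exact.
have dU1 (s : R) : 0 <= s <= 1 -> differentiable g (p + s *: v + w).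
  by move=> s01; have := dU s 1 s01; rewrite lexx ler01 scale1r; exact.
have [s s01|s /andP[s0 s1]] := @line_MVT R V (fun q => g (q + w) - g q) p v.
  by apply: differentiableB; [exact/differentiable_shiftr/dU1|exact: dU0].
have s01 : 0 <= s <= 1 by rewrite !ltW.
have [t t01|t /andP[t0 t1]] := @line_MVT R V (fun q => 'D_v g q) (p + s *: v) w.
  exact/(smooth_diff (smooth_derive v sg))/Upvw.
have t01 : 0 <= t <= 1 by rewrite !ltW.
move=> E2 E1; exists s, t; split=> //; rewrite -E2 -(derive_shiftr g w).
apply: etrans E1 _; apply: deriveB; apply: diff_derivable.
  exact/differentiable_shiftr/dU1.
exact: dU0.
Qed.

(** The second difference over a small parallelogram is symmetric in [v] and [w], and it equals a
    mixed derivative, in either order, at some point of the parallelogram. Continuity of both mixed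
    derivatives then bounds their difference at [p] by any [e]. *)
Lemma schwarz (R : realType) (V : normedModType R) (U : set V)
    (g : V -> R) p v w : open U -> smooth_on U g -> U p ->
  'D_w (fun q => 'D_v g q) p = 'D_v (fun q => 'D_w g q) p.
Proof.
move=> oU sg Up.
pose A : V -> R := fun q => 'D_w (fun q => 'D_v g q) q.
pose B : V -> R := fun q => 'D_v (fun q => 'D_w g q) q.
have cA : {for p, continuous A}.
  have sA := smooth_derive w (smooth_derive v sg).
  exact: differentiable_continuous (smooth_diff sA Up).
have cB : {for p, continuous B}.
  have sB := smooth_derive v (smooth_derive w sg).
  exact: differentiable_continuous (smooth_diff sB Up).
apply/eqP; rewrite -subr_eq0 -normr_le0; apply/ler_addgt0Pl => e e0.
rewrite addr0.
have e20 : 0 < e / 2 by rewrite divr_gt0.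
have /nbhs_ballP[r r0 Ur] : \forall q \near p,
    [/\ U q, `|A p - A q| < e / 2 & `|B p - B q| < e / 2].
  have nU : \forall q \near p, U q by exact: open_nbhs_nbhs.
  have nA : \forall q \near p, `|A p - A q| < e / 2.
    exact: (cvgrPdist_lt _ _).1 cA _ e20.
  have nB : \forall q \near p, `|B p - B q| < e / 2.
    exact: (cvgrPdist_lt _ _).1 cB _ e20.
  by apply: filterS3 nU nA nB => q ? ? ?; split.
have [h h0 hvw] : exists2 h : R, 0 < h & h * (`|v| + `|w|) < r.
  (* The summand 1 keeps the denominator positive when both vectors vanish. *)
  have vw0 : 0 < `|v| + `|w| + 1 by rewrite ltr_pwDr// addr_ge0.
  have r0' : 0 < r := r0.
  exists (r / (`|v| + `|w| + 1)); first by rewrite divr_gt0.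
  by rewrite mulrAC -mulrA gtr_pMr// ltr_pdivrMr// mul1r ltrDl.
have pvw (s t : R) : 0 <= s <= 1 -> 0 <= t <= 1 ->
    ball p r (p + s *: (h *: v) + t *: (h *: w)).
  move=> /andP[s0 s1] /andP[t0 t1]; rewrite -ball_normE /= -addrA opprD addrA.
  rewrite subrr sub0r normrN (le_lt_trans (ler_normD _ _))//.
  rewrite !normrZ !ger0_norm// ?(ltW h0)//.
  apply: le_lt_trans hvw; rewrite mulrDr.
  by rewrite lerD// ler_piMl// mulr_ge0// ltW.
(* Shrinking the parallelogram by [h] multiplies both mixed derivatives by the same [h * h], which
   is cancelled at the end. *)
have scaled a b q : U q ->
    'D_(h *: b) (fun q => 'D_(h *: a) g q) q = h * (h * 'D_b (fun q => 'D_a g q) q).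
  move=> Uq; have dDa := smooth_diff (smooth_derive a sg) Uq.
  have -> : 'D_(h *: b) (fun q => 'D_(h *: a) g q) q =
            'D_(h *: b) (h \*: (fun q => 'D_a g q)) q.
    apply: near_eq_derive; near=> x; rewrite deriveZv//.
    by apply: smooth_diff sg _; near: x; exact: open_nbhs_nbhs.
  rewrite deriveZv; last exact: differentiableZ.
  have -> := deriveZ h (diff_derivable dDa).
  by [].
have [s1 [t1 [s01 t01 E1]]] := @second_difference R V U g p (h *: v) (h *: w) sg
  (fun s t s01 t01 => let: And3 a _ _ := Ur _ (pvw s t s01 t01) in a).
have pwv (s t : R) : 0 <= s <= 1 -> 0 <= t <= 1 ->
    ball p r (p + s *: (h *: w) + t *: (h *: v)).
  by move=> ? ?; rewrite addrAC; exact: pvw.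
have [s2 [t2 [s01' t01' E2]]] := @second_difference R V U g p (h *: w) (h *: v)
  sg (fun s t s01 t01 => let: And3 a _ _ := Ur _ (pwv s t s01 t01) in a).
have [Uq1 q1A _] := Ur _ (pvw s1 t1 s01 t01).
have [Uq2 _ q2B] := Ur _ (pwv s2 t2 s01' t01').
have : A (p + s1 *: (h *: v) + t1 *: (h *: w)) =
       B (p + s2 *: (h *: w) + t2 *: (h *: v)).
  apply: (@mulfI _ h); first by rewrite gt_eqF.
  apply: (@mulfI _ h); first by rewrite gt_eqF.
  apply: etrans (etrans (esym (scaled v w _ Uq1)) _) (scaled w v _ Uq2).
  apply: etrans (esym E1) (etrans _ E2).
  rewrite [p + h *: w + h *: v]addrAC.
  move: (g _) (g (p + h *: v)) (g (p + h *: w)) (g p) => x1 x2 x3 x4.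
  by ring.
rewrite -/(A p) -/(B p); move: q1A q2B.
move: (A _) (A _) (B _) (B _) => a' a b' b aa' bb' a'b'.
have -> : a - b = (a - a') - (b - b') by rewrite a'b' opprB addrA subrK.
by rewrite (le_trans (ler_normB _ _))// (splitr e) lerD// ltW.
Unshelve. all: by end_near. Qed.

Lemma derive_derive_entry (R : realType) (V : normedModType R) (U : set V) m n
    (f : V -> 'M[R]_(m, n)) p v w i j : open U -> smooth_on U f -> U p ->
  'D_w (fun q => 'D_v f q) p i j = 'D_w (fun q => 'D_v (fun x => f x i j) q) p.
Proof.
move=> oU sf Up; have sD := smooth_derive v sf.
rewrite derive_entry; last exact: smooth_diff Up.
apply: near_eq_derive; near=> x; rewrite derive_entry//.
by apply: smooth_diff sf _; near: x; exact: open_nbhs_nbhs.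
Unshelve. all: by end_near. Qed.

Opaque derive.

Lemma schwarz_mx (R : realType) (V : normedModType R) (U : set V) m n
    (f : V -> 'M[R]_(m, n)) p v w : open U -> smooth_on U f -> U p ->
  'D_w (fun q => 'D_v f q) p = 'D_v (fun q => 'D_w f q) p.
Proof.
move=> oU sf Up; apply/matrixP => i j.
have sfij : smooth_on U (fun q => f q i j : R).
  by move=> k; exact: (Ck_mxP k f oU).1 (sf k) i j.
have Ev := derive_derive_entry v w i j oU sf Up.
have Ew := derive_derive_entry w v i j oU sf Up.
exact: etrans Ev (etrans (schwarz v w oU sfij Up) (esym Ew)).
Qed.

Lemma smooth_jacobian (R : realType) n m (U : set 'rV[R]_n)
    (x : 'rV[R]_n -> 'rV[R]_m) : open U -> smooth_on U x ->
  smooth_on U (jacobian x).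
Proof.
move=> oU sx k; apply/Ck_mxP => // i j.
have := (Ck_mxP k _ oU).1 (smooth_derive (delta_mx 0 i) sx k) 0 j.
apply: Ck_ext => // p Up.
by rewrite deriveEjacobian -?rowE ?mxE//; exact: smooth_diff Up.
Qed.

(** Written as [Y q *m jacobian x q], the inner derivative is a matrix product, and its Leibniz rule
    separates the term differentiating [Y] from the one differentiating [x]. *)
Lemma derive_field (R : realType) n m (U : set 'rV[R]_n)
    (Y : 'rV[R]_n -> 'rV[R]_n) (x : 'rV[R]_n -> 'rV[R]_m) p v :
  open U -> smooth_on U x -> U p -> differentiable Y p ->
  'D_v (fun q => 'D_(Y q) x q) p =
  'D_('D_v Y p) x p + 'D_v (fun q => 'D_(Y p) x q) p.
Proof.
move=> oU sx Up dY.
have E (Z : 'rV[R]_n -> 'rV[R]_n) : 'D_v (fun q => 'D_(Z q) x q) p =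
    'D_v (fun q => Z q *m jacobian x q) p.
  apply: near_eq_derive; near=> q; rewrite deriveEjacobian//.
  by apply: smooth_diff sx _; near: q; exact: open_nbhs_nbhs.
have dJ := smooth_diff (smooth_jacobian oU sx) Up.
rewrite E (E (fun=> Y p)) !deriveMx//.
rewrite (_ : 'D_v (fun=> Y p) p = 0) ?mul0mx ?add0r; last exact: derive_cst.
by rewrite -deriveEjacobian//; exact: smooth_diff sx Up.
Unshelve. all: by end_near. Qed.

(** This is how flatness of the ambient connection enters: the second derivatives of [x] cancel by
    Schwarz's theorem and only the bracket of the fields survives. *)
Lemma derive_commutator (R : realType) n m (U : set 'rV[R]_n)
    (X Y : 'rV[R]_n -> 'rV[R]_n) (x : 'rV[R]_n -> 'rV[R]_m) p :
  open U -> smooth_on U x -> U p -> differentiable X p -> differentiable Y p ->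
  'D_(X p) (fun q => 'D_(Y q) x q) p - 'D_(Y p) (fun q => 'D_(X q) x q) p =
  'D_(lie_bracket X Y p) x p.
Proof.
move=> oU sx Up dX dY; have dx := smooth_diff sx Up.
have aux (a b c d s t : 'rV[R]_m) :
    a = c + s -> b = d + t -> s = t -> a - b = c - d.
  by move=> -> -> ->; rewrite opprD addrACA subrr addr0.
apply: etrans (aux _ _ _ _ _ _ (derive_field (X p) oU sx Up dY)
  (derive_field (Y p) oU sx Up dX) (schwarz_mx (Y p) (X p) oU sx Up)) _.
apply: esym; apply: etrans (deriveDv _ _ dx) _; congr (_ + _).
exact: deriveNv.
Qed.

(** * The inverse function theorem *)

Lemma mx_entry_le_norm (R : realType) m n (x : 'M[R]_(m, n)) i j :
  `|x i j| <= `|x|.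
Proof.
rewrite [leRHS]/Num.Def.normr/= mx_normrE.
exact: (@le_bigmax _ _ _ 0 (fun ij : 'I_m * 'I_n => `|x ij.1 ij.2|) (i, j)).
Qed.

Lemma mx_norm_le (R : realType) m n (x : 'M[R]_(m, n)) (e : R) : 0 <= e ->
  (forall i j, `|x i j| <= e) -> `|x| <= e.
Proof.
move=> e0 xe; rewrite [leLHS]/Num.Def.normr/= mx_normrE.
by apply: bigmax_le => // -[i j] _; exact: xe.
Qed.

Lemma mulmx_norm_le (R : realType) n m (A : 'M[R]_(n, m)) :
  exists2 C : R, 0 < C & forall v : 'rV[R]_n, `|v *m A| <= C * `|v|.
Proof.
(* The summand 1 keeps the constant positive when [A = 0], since it is divided by later. *)
exists (1 + \sum_i \sum_j `|A i j|).
  by rewrite ltr_pwDl// sumr_ge0// => i _; rewrite sumr_ge0.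
move=> v; have S0 : 0 <= \sum_i \sum_j `|A i j|.
  by rewrite sumr_ge0// => i _; rewrite sumr_ge0.
apply: mx_norm_le => [|k j]; first by rewrite mulr_ge0// addr_ge0.
rewrite mxE (le_trans (ler_norm_sum _ _ _))//.
apply: (@le_trans _ _ ((\sum_i \sum_j `|A i j|) * `|v|)); last first.
  by rewrite mulrDl mul1r lerDr.
rewrite mulr_suml ler_sum// => i _; rewrite normrM mulrC ler_pM//.
  by rewrite (bigD1 j)//= lerDl sumr_ge0.
exact: mx_entry_le_norm.
Qed.

Lemma C1_contraction (R : realType) n (U : set 'rV[R]_n)
    (H : 'rV[R]_n -> 'rV[R]_n) q : open U -> U q -> smooth_on U H ->
  (forall v, 'D_v H q = 0) ->
  exists r : R, [/\ 0 < r, ball q r `<=` U &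
    forall a b, ball q r a -> ball q r b -> `|H b - H a| <= 2^-1 * `|b - a|].
Proof.
(* An increment of an entry is a sum of [n] partial derivatives times increments, so the bound [e]
   on each partial gives [n * e <= 1 / 2]; [n.+1] avoids a zero denominator for [n = 0]. *)
move=> oU Uq sH DH0; pose e : R := (2 * n.+1%:R)^-1.
have e0 : 0 < e by rewrite invr_gt0 mulr_gt0.
have sHj j : smooth_on U (fun p => H p 0 j : R).
  by move=> k; exact: (Ck_mxP k H oU).1 (sH k) 0 j.
have near1 (ij : 'I_n * 'I_n) : \forall p \near q,
    `|'D_(delta_mx 0 ij.1) (fun p => H p 0 ij.2 : R) p| < e.
  have cD : {for q, continuous (fun p => 'D_(delta_mx 0 ij.1) (fun p => H p 0
    ij.2 : R) p)}.
    have sD := smooth_derive (delta_mx 0 ij.1) (sHj ij.2).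
    exact: differentiable_continuous (smooth_diff sD Uq).
  have D0 : 'D_(delta_mx 0 ij.1) (fun p => H p 0 ij.2 : R) q = 0.
    have := derive_entry (delta_mx 0 ij.1) 0 ij.2 (smooth_diff sH Uq).
    by move=> /esym E; apply: etrans E _; rewrite DH0 mxE.
  have : \forall p \near q, `|'D_(delta_mx 0 ij.1) (fun p => H p 0 ij.2 : R) q -
      'D_(delta_mx 0 ij.1) (fun p => H p 0 ij.2 : R) p| < e.
    exact: (cvgrPdist_lt _ _).1 cD _ e0.
  by apply: filterS => p; rewrite D0 sub0r normrN.
have near2 : \forall p \near q, forall ij : 'I_n * 'I_n,
    `|'D_(delta_mx 0 ij.1) (fun p => H p 0 ij.2 : R) p| < e.
  exact: (@filter_forall _ _ _ (nbhs q) _ near1).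
have nearU : \forall p \near q, U p by exact: open_nbhs_nbhs.
have /nbhs_ballP[r r0 rU] : \forall p \near q, U p /\ forall ij : 'I_n * 'I_n,
    `|'D_(delta_mx 0 ij.1) (fun p => H p 0 ij.2 : R) p| < e.
  by apply: filterS2 nearU near2.
exists r; split=> // [p /rU[]//|a b qa qb].
apply: mx_norm_le => [|k j]; first by rewrite mulr_ge0.
have Useg (s : R) : 0 <= s <= 1 -> ball q r (a + s *: (b - a)).
  by move=> s01; exact: ball_segment.
have [s s01|s /andP[s0 s1]] := @line_MVT R _ (fun p => H p 0 j : R) a (b - a).
  by apply: smooth_diff (sHj j) _; case: (rU _ (Useg _ s01)).
have s01 : 0 <= s <= 1 by rewrite !ltW.
have [Us Hs] := rU _ (Useg _ s01).
rewrite subrKC !mxE (ord1 k) => ->.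
have -> := derive_row (b - a) (smooth_diff (sHj j) Us).
rewrite (le_trans (ler_norm_sum _ _ _))//.
apply: (@le_trans _ _ (\sum_(i < n) `|b - a| * e)).
  apply: ler_sum => i _; rewrite [`|_|]normrM ler_pM//.
    exact: mx_entry_le_norm.
  exact: ltW (Hs (i, j)).
rewrite sumr_const card_ord -mulrnAr mulrC ler_wpM2r// -mulr_natl /e invfM.
by rewrite mulrCA ler_piMr ?invr_ge0// ler_pdivrMr// mul1r ler_nat.
Qed.

(** Surjectivity comes from minimisation instead of iteration: the residual [|p - H p - y|] attains
    a minimum on the closed ball of radius [r / 2], the minimiser is interior, and there a step
    against a nonzero residual would decrease it. *)
Lemma perturbed_identity_surj (R : realType) n (H : 'rV[R]_n -> 'rV[R]_n) q
    (r : R) : 0 < r ->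
  (forall a b, ball q r a -> ball q r b -> `|H b - H a| <= 2^-1 * `|b - a|) ->
  (forall p, ball q r p -> {for p, continuous H}) ->
  forall y, `|y - (q - H q)| < r / 8 ->
  exists2 p, `|p - q| < r / 2 & p - H p = y.
Proof.
move=> r0 Hlip Hc y yq; pose K p := p - H p.
have r20 : 0 < r / 2 by rewrite divr_gt0.
pose A := [set p : 'rV[R]_n | `|q - p| <= r / 2].
have Ar p : A p -> ball q r p.
  rewrite /A/= -ball_normE/= => /le_lt_trans; apply.
  by rewrite ltr_pdivrMr// ltr_pMr// ltr1n.
have AE : A = closed_ball q (r / 2) by rewrite closed_ballE.
have Acomp : compact A.
  apply: bounded_closed_compact; last by rewrite AE; exact: closed_ball_closed.
  exists (`|q| + r / 2); split=> [|M qM p Ap /=]; first exact: num_real.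
  apply: le_trans (ltW qM); have := ler_normB q (q - p); rewrite subKr.
  by move=> /le_trans; apply; rewrite lerD2l.
have Aq : A q by rewrite /A/= subrr normr0 ltW.
have Kc : {within A, continuous (fun p => `|K p - y|)}.
  apply: continuous_in_subspaceT => p /[!inE] Ap.
  apply: (@continuous_comp _ _ _ (fun p => K p - y) (fun z => `|z|)); last first.
    exact: norm_continuous.
  apply: continuousB; last exact: cst_continuous.
  by apply: continuousB; [exact: cvg_id|exact/Hc/Ar].
have [c /[!inE] Ac cmin] := @EVT_min_rV R n _ A (ex_intro _ q Aq) Acomp Kc.
have Kmin p : A p -> `|K c - y| <= `|K p - y|.
  by move=> Ap; apply: cmin; rewrite inE.
have Klow a b : A a -> A b -> 2^-1 * `|b - a| <= `|K b - K a|.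
  move=> Aa Ab; have := Hlip _ _ (Ar _ Aa) (Ar _ Ab).
  have -> : K b - K a = (b - a) - (H b - H a).
    by apply/matrixP => i j; rewrite /K !mxE; ring.
  have := lerB_dist (b - a) (H b - H a).
  move: `|b - a| `|H b - H a| `|_ - _| => x1 x2 x3; lra.
(* At the minimiser [|c - q| / 2 <= |K c - K q| <= 2 |K q - y| < r / 4], which is the origin of the
   radius [r / 8]. *)
have cq : `|c - q| < r / 2.
  have := Klow _ _ Aq Ac; have := Kmin _ Aq.
  have := ler_distD y (K c) (K q).
  have : `|y - K q| < r / 8 by [].
  rewrite [`|y - K q|]distrC.
  move: `|c - q| `|K c - K q| `|K c - y| `|K q - y| => x1 x2 x3 x4; lra.
exists c => //; apply/eqP; rewrite -subr_eq0 -normr_le0 leNgt.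
apply/negP => Kcy0; rewrite -/(K c) in Kcy0.
(* The step length is short enough to stay in [A] and at most 1, so the new residual is at most
   [(1 - s) + s / 2] times the old one, contradicting minimality. *)
pose s : R := Num.min 1 ((r / 2 - `|c - q|) / `|K c - y|).
have s0 : 0 < s by rewrite lt_min ltr01 divr_gt0// subr_gt0.
have s1 : s <= 1 by rewrite ge_min lexx.
have sK : s * `|K c - y| <= r / 2 - `|c - q|.
  by rewrite -ler_pdivlMr// ge_min lexx orbT.
pose p := c - s *: (K c - y).
have Ap : A p.
  rewrite /A/= distrC /p addrAC (le_trans (ler_normB _ _))// normrZ gtr0_norm//.
  by move: sK; rewrite lerBrDl.
have pc : p - c = - (s *: (K c - y)) by rewrite /p addrAC subrr add0r.
have := Hlip _ _ (Ar _ Ac) (Ar _ Ap); rewrite pc normrN normrZ gtr0_norm//.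
have := Kmin _ Ap.
have -> : K p - y = (1 - s) *: (K c - y) - (H p - H c).
  by apply/matrixP => i j; rewrite /p /K !mxE; ring.
have := ler_normB ((1 - s) *: (K c - y)) (H p - H c).
rewrite normrZ ger0_norm ?subr_ge0//.
move: Kcy0 s0; move: `|K c - y| `|H p - H c| `|_ - _| => x1 x2 x3.
nra.
Qed.

Lemma mulmxr_continuous (R : realType) k n m (A : 'M[R]_(n, m)) :
  continuous (fun z : 'M[R]_(k, n) => z *m A).
Proof.
have : Ck_on 0 setT (fun z : 'M[R]_(k, n) => z *m A).
  apply: Ck_mulmx; first exact: openT.
    by apply: Ck_id; exact: openT.
  exact: Ck_cst.
by move=> + z; exact.
Qed.

(** Composing [G] with the inverse of its Jacobian at [q] gives a perturbation [p - H p] of the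
    identity with ['D_v H q = 0], so the two preceding lemmas apply. Invertibility of the Jacobian
    on all of [U] lets the formula for the derivative of [Ginv] hold on the whole image. *)
Lemma inverse_function (R : realType) n (U : set 'rV[R]_n)
    (G : 'rV[R]_n -> 'rV[R]_n) q : open U -> U q -> smooth_on U G ->
  (forall p, U p -> jacobian G p \in unitmx) ->
  exists (V : set 'rV[R]_n) (Ginv : 'rV[R]_n -> 'rV[R]_n),
    [/\ open V /\ V q, V `<=` U, open (G @` V),
        forall p, V p -> Ginv (G p) = p & smooth_on (G @` V) Ginv].
Proof.
move=> oU Uq sG uJ; pose B := invmx (jacobian G q); pose H p := p - G p *m B.
have uB : B \in unitmx by rewrite unitmx_inv uJ.
have sH : smooth_on U H.
  move=> k; apply: CkD => //; first exact: Ck_id.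
  by apply: CkN => //; apply: Ck_mulmx => //; exact: Ck_cst.
have DH0 v : 'D_v H q = 0.
  have dG := smooth_diff sG Uq.
  have dGB : differentiable (fun p => G p *m B) q.
    have sGB : smooth_on U (fun p => G p *m B).
      by move=> k; apply: Ck_mulmx => //; exact: Ck_cst.
    exact: smooth_diff sGB Uq.
  have E1 := deriveB (@derivable_id _ _ q v) (diff_derivable (v := v) dGB).
  have E2 := deriveMx v dG (differentiable_cst B q).
  apply: etrans E1 _; rewrite derive_id; apply/eqP; rewrite subr_eq0; apply/eqP.
  apply/esym; apply: etrans E2 _.
  have -> : 'D_v (cst B) q = 0 by exact: derive_cst.
  by rewrite mulmx0 addr0 deriveEjacobian// mulmxK ?uJ.
have [r [r0 rU Hlip]] := C1_contraction oU Uq sH DH0.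
have KE p : p - H p = G p *m B by rewrite subKr.
have Hc p : ball q r p -> {for p, continuous H}.
  by move=> /rU Up; exact: differentiable_continuous (smooth_diff sH Up).
have surj := perturbed_identity_surj r0 Hlip Hc.
(* [V] is cut out by the condition [W (G p)], so that its image is exactly the open set [W]. *)
pose W := [set z : 'rV[R]_n | `|z *m B - G q *m B| < r / 8].
pose V := [set p : 'rV[R]_n | `|p - q| < r / 2 /\ W (G p)].
have r20 : 0 < r / 2 by rewrite divr_gt0.
have r80 : 0 < r / 8 by rewrite divr_gt0.
have Vr p : V p -> ball q r p.
  move=> [pq _]; rewrite -ball_normE/= distrC (lt_trans pq)//.
  by rewrite ltr_pdivrMr// ltr_pMr// ltr1n.
have VU : V `<=` U by move=> p /Vr /rU.
have oW : open W.
  rewrite openE => z Wz.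
  have e0 : 0 < r / 8 - `|z *m B - G q *m B| by rewrite subr_gt0.
  have : \forall z' \near z, `|z *m B - z' *m B| < r / 8 - `|z *m B - G q *m B|.
    exact: (cvgrPdist_lt _ _).1 (@mulmxr_continuous R 1 n n B z) _ e0.
  apply: filterS => z'; rewrite /W/= => zz'.
  have -> : z' *m B - G q *m B = (z *m B - G q *m B) - (z *m B - z' *m B).
    by apply/matrixP => i j; rewrite !mxE; ring.
  by rewrite (le_lt_trans (ler_normB _ _))// -ltrBrDl.
have oV : open V.
  rewrite openE => p Vp; have cG := differentiable_continuous (smooth_diff sG (VU _ Vp)).
  have n1 : \forall x \near p, `|x - q| < r / 2.
    have : \forall x \near p, ball q (r / 2) x.
      apply: open_nbhs_nbhs; split; first exact: ball_open.
      by rewrite -ball_normE/= distrC; case: Vp.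
    by apply: filterS => x; rewrite -ball_normE/= distrC.
  have n2 : \forall x \near p, W (G x).
    by apply: cG; apply: open_nbhs_nbhs; split=> //; case: Vp.
  by apply: filterS2 n1 n2.
have Vq : V q by split; rewrite /W/= subrr normr0.
have GVW : G @` V = W.
  apply/seteqP; split=> [z [p [_ Wp] <-]//|z Wz].
  have [|p pq pz] := surj (z *m B); first by rewrite KE.
  have Gpz : G p = z.
    by apply: (can_inj (mulmxK uB)); rewrite -KE.
  by exists p => //; split=> //; rewrite Gpz.
have Klow a b : V a -> V b -> `|b - a| <= 2 * `|(G b - G a) *m B|.
  move=> Va Vb; have := Hlip _ _ (Vr _ Va) (Vr _ Vb).
  have -> : (G b - G a) *m B = (b - a) - (H b - H a).
    by rewrite mulmxBl -!KE; apply/matrixP => i j; rewrite !mxE; ring.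
  have := lerB_dist (b - a) (H b - H a).
  move: `|b - a| `|H b - H a| `|_ - _| => x1 x2 x3; lra.
have Ginj a b : V a -> V b -> G a = G b -> a = b.
  move=> Va Vb ab; have := Klow _ _ Va Vb.
  by rewrite ab subrr mul0mx normr0 mulr0 normr_le0 subr_eq0 => /eqP.
(* The default value [q] is only taken off the image [W]. *)
pose Ginv z := xget q [set p | V p /\ G p = z].
have GinvP z : W z -> V (Ginv z) /\ G (Ginv z) = z.
  rewrite -GVW => -[p Vp Gp].
  have : exists x, [set p | V p /\ G p = z] x by exists p.
  by move=> /(xgetPex q).
have WG p : V p -> W (G p) by case.
have GK p : V p -> Ginv (G p) = p.
  by move=> Vp; have [Vg Gg] := GinvP _ (WG _ Vp); exact: Ginj.
have [C C0 CB] := mulmx_norm_le B.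
have Glip z1 z2 : W z1 -> W z2 -> `|Ginv z2 - Ginv z1| <= 2 * C * `|z2 - z1|.
  move=> /GinvP[V1 E1] /GinvP[V2 E2]; apply: le_trans (Klow _ _ V1 V2) _.
  by rewrite E1 E2 -mulrA ler_pM2l.
(* The Lipschitz bound on [Ginv] turns the error [o(|p' - p|)] in the expansion of [G] into an error
   [o(|w|)] for [Ginv]. *)
have dGinv z : W z -> differentiable Ginv z /\
    'd Ginv z = mulmxr (invmx (jacobian G (Ginv z))) :> (_ -> _).
  move=> Wz; have [Vp Gp] := GinvP _ Wz; set p := Ginv z in Vp Gp *.
  have uA := uJ _ (VU _ Vp); set A := invmx _.
  apply: is_diff_eps => [|e e0]; first exact: mulmxr_continuous.
  have [C' C'0 C'A] := mulmx_norm_le A.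
  have e'0 : 0 < e / (C' * (2 * C)) by rewrite divr_gt0// mulr_gt0// mulr_gt0.
  have dGp := smooth_diff sG (VU _ Vp).
  have /nbhs_ballP[d d0 dG] := differentiable_eps dGp e'0.
  have nW : \forall w \near (0 : 'rV[R]_n), W (w + z).
    have : \forall x \near z, W x by exact: open_nbhs_nbhs.
    by rewrite (near_shift (0 : 'rV[R]_n)); apply: filterS => h /=; rewrite subr0.
  have nd : \forall w \near (0 : 'rV[R]_n), `|w| < d / (2 * C).
    apply/nbhs_ballP; exists (d / (2 * C)) => /=.
      by rewrite divr_gt0// mulr_gt0.
    by move=> w; rewrite -ball_normE/= sub0r normrN.
  apply: filterS2 nW nd => w Ww wd.
  have [Vp' Gp'] := GinvP _ Ww; set p' := Ginv (w + z) in Vp' Gp' *.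
  have kw : `|p' - p| <= 2 * C * `|w| by have := Glip _ _ Wz Ww; rewrite addrK.
  have kd : ball 0 d (p' - p).
    rewrite -ball_normE/= sub0r normrN (le_lt_trans kw)// mulrC.
    by rewrite -ltr_pdivlMr// mulr_gt0.
  have := dG _ kd; rewrite subrK Gp' Gp addrK.
  have -> : 'd G p (p' - p) = (p' - p) *m jacobian G p.
    by rewrite /jacobian mul_rV_lin1.
  move=> wk /=.
  have -> : p' - p - w *m A = - ((w - (p' - p) *m jacobian G p) *m A).
    by rewrite mulmxBl (mulmxK uA) opprB.
  rewrite normrN (le_trans (C'A _))//.
  rewrite -ler_pdivlMl// (le_trans wk)//.
  apply: (@le_trans _ _ (e / (C' * (2 * C)) * (2 * C * `|w|))).
    by rewrite ler_wpM2l// ltW.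
  have C'n : C' != 0 by rewrite gt_eqF.
  have Cn : C != 0 by rewrite gt_eqF.
  rewrite le_eqVlt; apply/orP; left; apply/eqP; field.
  by rewrite C'n Cn.
exists V, Ginv; split=> //; rewrite GVW// => k.
(* Bootstrapping: the derivative of [Ginv] is the inverse Jacobian composed with [Ginv], hence as
   regular as [Ginv] is already known to be. *)
elim: k => [|k IH].
  by move=> z Wz; have [dz _] := dGinv _ Wz; exact: differentiable_continuous.
split=> [z Wz|v]; first by have [] := dGinv _ Wz.
have Cinv : Ck_on k W ((fun p => invmx (jacobian G p)) \o Ginv).
  apply: (Ck_compmx oW oU _ IH) => [z /GinvP[/VU]//|].
  by apply: Ck_invmx => //; exact: (smooth_jacobian oU sG k).
have := Ck_mulmx oW (Ck_cst k W v) Cinv.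
apply: Ck_ext => // z Wz; have [dz dE] := dGinv _ Wz.
by rewrite deriveE// dE.
Qed.

(** * Blaschke hypersurfaces *)

Lemma bilDl (R : realType) n (B : 'M[R]_n) u v w :
  bil B (u + v) w = bil B u w + bil B v w.
Proof. by rewrite /bil !mulmxDl mxE. Qed.

Lemma bilDr (R : realType) n (B : 'M[R]_n) u v w :
  bil B u (v + w) = bil B u v + bil B u w.
Proof. by rewrite /bil linearD mulmxDr mxE. Qed.

Lemma bilZl (R : realType) n (B : 'M[R]_n) a u v :
  bil B (a *: u) v = a * bil B u v.
Proof. by rewrite /bil -!scalemxAl mxE. Qed.

Lemma bilZr (R : realType) n (B : 'M[R]_n) a u v :
  bil B u (a *: v) = a * bil B u v.
Proof. by rewrite /bil linearZ/= -scalemxAr mxE. Qed.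

Lemma bilNl (R : realType) n (B : 'M[R]_n) u v : bil B (- u) v = - bil B u v.
Proof. by rewrite -scaleN1r bilZl mulN1r. Qed.

Lemma bilNr (R : realType) n (B : 'M[R]_n) u v : bil B u (- v) = - bil B u v.
Proof. by rewrite -scaleN1r bilZr mulN1r. Qed.

Lemma bil0l (R : realType) n (B : 'M[R]_n) u : bil B 0 u = 0.
Proof. by rewrite -(scale0r 0) bilZl mul0r. Qed.

Lemma bil_nondegenerate (R : realType) n (B : 'M[R]_n) u :
  \det B != 0 -> (forall z, bil B u z = 0) -> u = 0.
Proof.
move=> dB uz; have uB : B \in unitmx by rewrite unitmxE unitfE.
apply: (can_inj (mulmxK uB)); rewrite mul0mx; apply/rowP => j.
have := uz (delta_mx 0 j); rewrite /bil trmx_delta -colE mxE => ->.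
by rewrite mxE.
Qed.

Lemma smooth_at_cst (R : realType) n (p w : 'rV[R]_n) : smooth_at p (cst w).
Proof.
by exists setT; split=> //; [exact: openT|move=> k; exact: Ck_cst].
Qed.

Lemma smooth_at_on (R : realType) n (W : set 'rV[R]_n) (Y : 'rV[R]_n -> 'rV[R]_n)
    p : open W -> W p -> smooth_on W Y -> smooth_at p Y.
Proof. by move=> oW Wp sY; exists W. Qed.

Lemma smooth_at_diff (R : realType) n (Y : 'rV[R]_n -> 'rV[R]_n) p :
  smooth_at p Y -> differentiable Y p.
Proof. by move=> [W [_ Wp sY]]; exact: smooth_diff sY Wp. Qed.

Lemma lie_bracket_cst (R : realType) n (p v w : 'rV[R]_n) :
  lie_bracket (cst v) (cst w) p = 0.
Proof.
rewrite /lie_bracket; have D0 (a b : 'rV[R]_n) : 'D_a (cst b) p = 0.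
  exact: derive_cst.
by rewrite !D0 subrr.
Qed.

Lemma levi_civita_sym (R : realType) n (U : set 'rV[R]_n)
    (h : 'rV[R]_n -> 'M[R]_n) (hnabla : connection R n) p v w :
  levi_civita U h hnabla -> U p ->
  hnabla p v (cst w) = hnabla p w (cst v).
Proof.
move=> [tf _] Up; have := tf p (cst v) (cst w) Up (smooth_at_cst _ _) (smooth_at_cst _ _).
by rewrite lie_bracket_cst => /eqP; rewrite subr_eq0 => /eqP.
Qed.

(** A [connection] carries no Leibniz axiom. Torsion-freeness against the constant field [v]
    produces the term ['D_v Y], and symmetry on constant fields exchanges the two arguments of what
    remains. *)
Lemma levi_civita_cst (R : realType) n (U : set 'rV[R]_n)
    (h : 'rV[R]_n -> 'M[R]_n) (hnabla : connection R n) p v Y :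
  levi_civita U h hnabla -> U p -> smooth_at p Y ->
  hnabla p v Y = hnabla p v (cst (Y p)) + 'D_v Y p.
Proof.
move=> lc Up sY; have [tf _] := lc.
have := tf p (cst v) Y Up (smooth_at_cst _ _) sY.
have := levi_civita_sym v (Y p) lc Up.
rewrite /lie_bracket => ->.
have -> : 'D_(Y p) (cst v) p = 0 by exact: derive_cst.
by rewrite subr0 /cst => /eqP; rewrite subr_eq addrC => /eqP.
Qed.

Lemma bil_lincomb (R : realType) n (B C : 'M[R]_n) a v w :
  bil (a *: B + C) v w = a * bil B v w + bil C v w.
Proof. by rewrite /bil mulmxDr mulmxDl mxE -scalemxAr -scalemxAl mxE. Qed.

Lemma derive_bil (R : realType) n (h : 'rV[R]_n -> 'M[R]_n) p u v w :
  differentiable h p ->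
  'D_u (fun q => bil (h q) v w) p = bil ('D_u h p) v w.
Proof.
move=> dh.
have dv : differentiable (fun q => v *m h q) p.
  exact: (differentiableMx (differentiable_cst v p) dh).
have dvw := differentiableMx dv (differentiable_cst w^T p).
apply: etrans (esym (derive_entry u 0 0 dvw)) _.
have D0 m1 m2 (B : 'M[R]_(m1, m2)) : 'D_u (cst B) p = 0 by exact: derive_cst.
have E1 := deriveMx u dv (differentiable_cst w^T p).
have E2 := deriveMx u (differentiable_cst v p) dh.
rewrite D0 mulmx0 addr0 in E1; rewrite D0 mul0mx add0r in E2.
by apply: etrans (congr1 (fun M : 'M[R]_(1, 1) => M 0 0) E1) _; rewrite E2.
Qed.

Section blaschke_local.
Variables (R : realType) (n : nat) (U : set 'rV[R]_n).
Variables (x xi : 'rV[R]_n -> 'rV[R]_n.+1) (h S : 'rV[R]_n -> 'M[R]_n).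
Variable nabla : connection R n.
Hypothesis oU : open U.
Hypothesis bl : blaschke U x xi h S nabla.

Lemma blaschke_diff p : U p -> differentiable x p.
Proof. exact: smooth_diff (bl_smooth bl). Qed.

Lemma blaschke_inj p v w : U p -> 'D_v x p = 'D_w x p -> v = w.
Proof.
move=> Up E; have dx := blaschke_diff Up.
apply: subr0_eq; apply: (bl_immersion bl Up).
apply: etrans (deriveDv _ _ dx) _.
by rewrite (deriveNv _ dx) E subrr.
Qed.

(** The properties of [nabla] and of [h] below are obtained by expanding a second derivative of [x]
    in two ways; this is the comparison of tangential and transversal parts. *)
Lemma blaschke_split p v w s t : U p ->
  'D_v x p + s *: xi p = 'D_w x p + t *: xi p -> v = w /\ s = t.
Proof.
move=> Up E; have dx := blaschke_diff Up.
have E2 : (t - s) *: xi p = 'D_(v - w) x p.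
  apply/esym; apply: etrans (deriveDv _ _ dx) _.
  rewrite (deriveNv _ dx) scalerBl -[X in X - _](addrK (s *: xi p)) E.
  by rewrite -!addrA addrC -!addrA addNr addr0.
have ts : s = t.
  apply/eqP; rewrite eq_sym -subr_eq0; apply/negP => /negP ts0.
  apply: (bl_transversal bl (v := (t - s)^-1 *: (v - w)) Up).
  by rewrite (deriveZv _ _ dx) -E2 scalerA mulVf// scale1r.
split=> //; apply: (blaschke_inj Up).
by move: E; rewrite ts => /addIr.
Qed.

Lemma gauss_cst p v w : U p ->
  'D_v (fun q => 'D_w x q) p =
    'D_(nabla p v (cst w)) x p + bil (h p) v w *: xi p.
Proof. by move=> Up; exact: (bl_gauss bl v Up (smooth_at_cst p w)). Qed.

Lemma nabla_cst p v Y : U p -> smooth_at p Y ->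
  nabla p v Y = nabla p v (cst (Y p)) + 'D_v Y p.
Proof.
move=> Up sY; have dx := blaschke_diff Up.
have G1 := bl_gauss bl v Up sY.
have G2 := derive_field v oU (bl_smooth bl) Up (smooth_at_diff sY).
have G3 := gauss_cst v (Y p) Up.
suff [] : nabla p v Y = nabla p v (cst (Y p)) + 'D_v Y p /\
    bil (h p) v (Y p) = bil (h p) v (Y p) by [].
apply: (blaschke_split Up); rewrite -G1 G2 G3 addrA; congr (_ + _).
by apply/esym; apply: etrans (deriveDv _ _ dx) _; rewrite addrC.
Qed.

(** Schwarz's theorem for [x], read in its tangential and transversal parts. *)
Lemma nabla_sym p v w : U p ->
  nabla p v (cst w) = nabla p w (cst v) /\ bil (h p) v w = bil (h p) w v.
Proof.
move=> Up; apply: (blaschke_split Up).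
apply: etrans (esym (gauss_cst v w Up)) _.
apply: etrans _ (gauss_cst w v Up).
exact: schwarz_mx (bl_smooth bl) Up.
Qed.

Lemma blaschke_hC p v w : U p -> bil (h p) v w = bil (h p) w v.
Proof. by move=> Up; have [] := nabla_sym v w Up. Qed.

Lemma nabla_torsion p X Y : U p -> smooth_at p X -> smooth_at p Y ->
  nabla p (X p) Y - nabla p (Y p) X = lie_bracket X Y p.
Proof.
move=> Up sX sY; rewrite (nabla_cst _ Up sX) (nabla_cst _ Up sY).
have [-> _] := nabla_sym (X p) (Y p) Up.
by rewrite opprD addrACA subrr add0r.
Qed.

Lemma nabla_linear p a v v' w : U p ->
  nabla p (a *: v + v') (cst w) = a *: nabla p v (cst w) + nabla p v' (cst w).
Proof.
move=> Up; have dx := blaschke_diff Up.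
have dDx := smooth_diff (smooth_derive w (bl_smooth bl)) Up.
suff [] : nabla p (a *: v + v') (cst w) =
    a *: nabla p v (cst w) + nabla p v' (cst w) /\
    bil (h p) (a *: v + v') w = a * bil (h p) v w + bil (h p) v' w by [].
apply: (blaschke_split Up); apply: etrans (esym (gauss_cst _ w Up)) _.
apply: etrans (derive_lincomb a v v' dDx) _.
rewrite (gauss_cst v w Up) (gauss_cst v' w Up).
rewrite (derive_lincomb a _ _ dx) scalerDr scalerDl scalerA.
by rewrite addrACA.
Qed.

Variables (hnabla : connection R n).
Hypothesis lc : levi_civita U h hnabla.
Let K := difference_tensor nabla hnabla.

Lemma nabla_split p v Y : U p -> smooth_at p Y ->
  nabla p v Y = hnabla p v Y + K p v (Y p).
Proof.
move=> Up sY; rewrite (nabla_cst _ Up sY) (levi_civita_cst _ lc Up sY).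
by rewrite /K /difference_tensor [RHS]addrC addrA subrK.
Qed.

Lemma KC p v w : U p -> K p v w = K p w v.
Proof.
move=> Up; rewrite /K /difference_tensor (levi_civita_sym v w lc Up).
by have [-> _] := nabla_sym v w Up.
Qed.

(** On constant fields the brackets in Koszul's formula vanish, so [h(hnabla_v w, z)] is expressed
    through derivatives of [h], which are linear in their direction. Nondegeneracy of [h] then
    transfers linearity to [hnabla]. *)
Lemma levi_civita_linear p a v v' w : U p -> differentiable h p ->
  hnabla p (a *: v + v') (cst w) = a *: hnabla p v (cst w) + hnabla p v' (cst w).
Proof.
move=> Up dh; have [_ mc] := lc; have hC := blaschke_hC _ _ Up.
have [D Dlin koszul] : exists2 D : 'rV[R]_n -> 'M[R]_n,
    (forall a v v', D (a *: v + v') = a *: D v + D v') &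
    forall u y z, 2 * bil (h p) (hnabla p u (cst y)) z =
      bil (D u) y z + bil (D y) u z - bil (D z) u y.
  exists (fun u => 'D_u h p) => [? ? ?|u y z]; first exact: derive_lincomb.
  have mcc (u' y' z' : 'rV[R]_n) : bil ('D_u' h p) y' z' =
      bil (h p) (hnabla p u' (cst y')) z' + bil (h p) y' (hnabla p u' (cst z')).
    apply: etrans (esym (derive_bil u' y' z' dh)) _.
    exact: (mc p u' (cst y') (cst z') Up (smooth_at_cst _ _) (smooth_at_cst _ _)).
  rewrite !mcc (levi_civita_sym y u lc Up) (levi_civita_sym z u lc Up).
  by rewrite (levi_civita_sym z y lc Up) (hC y); ring.
have dh0 := bl_nondegenerate bl Up.
apply/eqP; rewrite -subr_eq0; apply/eqP; apply: (bil_nondegenerate dh0) => z.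
have : 2 * bil (h p) (hnabla p (a *: v + v') (cst w)) z =
    a * (2 * bil (h p) (hnabla p v (cst w)) z) +
    2 * bil (h p) (hnabla p v' (cst w)) z.
  rewrite !koszul Dlin !(bilDl, bilDr, bilZl, bilZr) !bil_lincomb.
  by ring.
rewrite bilDl bilNl bilDl bilZl; lra.
Qed.

Lemma K_linearl p a v v' w : U p -> differentiable h p ->
  K p (a *: v + v') w = a *: K p v w + K p v' w.
Proof.
move=> Up dh; rewrite /K /difference_tensor nabla_linear// levi_civita_linear//.
by rewrite scalerBr opprD addrACA.
Qed.

Lemma K_linearr p a v w w' : U p -> differentiable h p ->
  K p v (a *: w + w') = a *: K p v w + K p v w'.
Proof. by move=> Up dh; rewrite !(KC v)// K_linearl. Qed.

End blaschke_local.

(** * Symmetries of the difference tensor *)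

Definition frame_mx (R : realType) (u v w : 'rV[R]_3) : 'M[R]_3 :=
  \matrix_(i < 3) [:: u; v; w]`_i.

Definition mx3 (R : realType) (s : seq (seq R)) : 'M[R]_3 :=
  \matrix_(i, j) (nth [::] s i)`_j.

Lemma ord3P (i : 'I_3) : [\/ i = 0, i = 1 | i = 2].
Proof.
by case: i => [[|[|[|//]]] ?]; [apply: Or31|apply: Or32|apply: Or33];
  exact: val_inj.
Qed.

Lemma sum3 (V : nmodType) (F : 'I_3 -> V) : \sum_i F i = F 0 + F 1 + F 2.
Proof.
rewrite !big_ord_recl big_ord0 addr0 addrA.
by congr (_ + F _ + F _); exact: val_inj.
Qed.

Lemma matrix3P (T : Type) (A B : 'M[T]_3) :
  A 0 0 = B 0 0 -> A 0 1 = B 0 1 -> A 0 2 = B 0 2 ->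
  A 1 0 = B 1 0 -> A 1 1 = B 1 1 -> A 1 2 = B 1 2 ->
  A 2 0 = B 2 0 -> A 2 1 = B 2 1 -> A 2 2 = B 2 2 -> A = B.
Proof.
by move=> *; apply/matrixP => i j; case: (ord3P i) => ->; case: (ord3P j) => ->.
Qed.

Ltac mx3_compute := rewrite ?mxE ?sum3 ?mxE /=.

Lemma row_frame_mx (R : realType) (a u v w : 'rV[R]_3) :
  a *m frame_mx u v w = a 0 0 *: u + a 0 1 *: v + a 0 2 *: w.
Proof. by apply/rowP => j; rewrite !mxE sum3 !mxE. Qed.

Record kform (R : realType) (K : 'rV[R]_3 -> 'rV[R]_3 -> 'rV[R]_3) : Prop := Kform {
  klinl : forall a v v' w, K (a *: v + v') w = a *: K v w + K v' w;
  klinr : forall a v w w', K v (a *: w + w') = a *: K v w + K v w';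
  kC : forall v w, K v w = K w v
}.

(** The difference tensor in the coordinates of an adapted frame, [mu] standing for mu1. *)
Definition kappa3 (R : realType) (mu mu2 : R) (a b : 'rV[R]_3) : 'rV[R]_3 :=
  vec 3 [:: 2 * mu * (a 0 0 * b 0 0) - mu * (a 0 1 * b 0 1) - mu * (a 0 2 * b 0 2);
    - mu * (a 0 0 * b 0 1 + a 0 1 * b 0 0) + mu2 * (a 0 1 * b 0 1 - a 0 2 * b 0 2);
    - mu * (a 0 0 * b 0 2 + a 0 2 * b 0 0) - mu2 * (a 0 1 * b 0 2 + a 0 2 * b 0 1)].

Section adapted.
Variables (R : realType) (h S : 'M[R]_3) (K : 'rV[R]_3 -> 'rV[R]_3 -> 'rV[R]_3).
Variables (e1 e2 e3 : 'rV[R]_3) (mu mu2 lambda a : R).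
Hypothesis af : adapted_frame_at h S K e1 e2 e3 mu mu2 lambda a.
Hypothesis hC : forall v w, bil h v w = bil h w v.
Hypothesis kf : kform K.
Let P := frame_mx e1 e2 e3.
Let G := symmetry_group h S K.

Lemma frame_gram : P *m h *m P^T = 1%:M.
Proof.
have [[h11 h22 h33] [h12 h13 h23]] := af_orthonormal af.
have E i j : (P *m h *m P^T) i j = bil h (row i P) (row j P).
  rewrite /bil [LHS]mxE [RHS]mxE; apply: eq_bigr => k _.
  by rewrite -row_mul !mxE.
apply/matrixP => i j; rewrite E !rowK !mxE.
by case: (ord3P i) => ->; case: (ord3P j) => -> /=; rewrite ?(hC e2 e1) ?(hC e3 _).
Qed.

Lemma frame_unit : P \in unitmx.
Proof.
have /mulmx1_unit[] : P *m (h *m P^T) = 1%:M by rewrite mulmxA frame_gram.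
by [].
Qed.

Lemma frame_metric : h = invmx P *m (invmx P)^T.
Proof.
have uP := frame_unit; rewrite -[LHS](mulKmx uP) -[P *m h](@mulmxK _ _ _ P^T).
  by rewrite frame_gram mul1mx trmx_inv.
by rewrite unitmx_tr.
Qed.

Lemma K_lincomb (s t u s' t' u' : R) :
  K (s *: e1 + t *: e2 + u *: e3) (s' *: e1 + t' *: e2 + u' *: e3) =
  kappa3 mu mu2 (vec 3 [:: s; t; u]) (vec 3 [:: s'; t'; u']) *m P.
Proof.
have addl v v' w : K (v + v') w = K v w + K v' w.
  by rewrite -[v]scale1r klinl// !scale1r.
have addr v v' w : K w (v + v') = K w v + K w v' by rewrite !(kC kf w) addl.
have K0l w : K 0 w = 0.
  by have := addl 0 0 w; rewrite addr0 => /eqP; rewrite -subr_eq0 opprD addrA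
    subrr sub0r oppr_eq0 => /eqP.
have sl c v w : K (c *: v) w = c *: K v w.
  by have := klinl kf c v 0 w; rewrite K0l !addr0.
have sr c v w : K w (c *: v) = c *: K w v by rewrite !(kC kf w) sl.
rewrite !(addl, addr, sl, sr) (kC kf e2 e1) (kC kf e3 e1) (kC kf e3 e2).
rewrite (af_K11 af) (af_K12 af) (af_K13 af) (af_K22 af) (af_K23 af) (af_K33 af).
rewrite row_frame_mx; apply/rowP => j; rewrite !mxE /=; ring.
Qed.

Lemma K_coords u v : K (u *m P) (v *m P) = kappa3 mu mu2 u v *m P.
Proof.
rewrite !row_frame_mx K_lincomb row_frame_mx /kappa3.
by apply/rowP => j; rewrite !mxE.
Qed.

Lemma frame_shape : P *m S = diag_mx (vec 3 [:: lambda; a; a]) *m P.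
Proof.
apply/row_matrixP => i; rewrite row_mul rowK mul_diag_mx.
have -> : row i (\matrix_(i, j) (vec 3 [:: lambda; a; a] 0 i * P i j)) =
    vec 3 [:: lambda; a; a] 0 i *: row i P.
  by apply/rowP => j; rewrite !mxE.
by rewrite rowK; case: (ord3P i) => -> /=;
  rewrite ?(af_S1 af) ?(af_S2 af) ?(af_S3 af) !mxE /=.
Qed.

Lemma frame_symmetry D : D *m D^T = 1%:M -> 0 < \det D ->
  D *m diag_mx (vec 3 [:: lambda; a; a]) = diag_mx (vec 3 [:: lambda; a; a]) *m D ->
  (forall u v, kappa3 mu mu2 (u *m D) (v *m D) = kappa3 mu mu2 u v *m D) ->
  G (invmx P *m D *m P).
Proof.
move=> DD D0 DL DK; have uP := frame_unit.
have dP : \det P != 0 by move: uP; rewrite unitmxE unitfE.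
split=> [|v w|v|v w].
- by rewrite !det_mulmx det_inv mulrAC mulVf// mul1r.
- rewrite /bil trmx_mul; congr ((_ : 'M[R]_1) 0 0).
  set Q := invmx P *m D *m P; have QhQ : Q *m h *m Q^T = h.
    rewrite [RHS]frame_metric /Q !trmx_mul !mulmxA.
    rewrite -(mulmxA (invmx P *m D) P h) -(mulmxA (invmx P *m D) (P *m h)).
    by rewrite frame_gram mulmx1 -(mulmxA (invmx P)) DD mulmx1.
  by rewrite -{2}QhQ !mulmxA.
- rewrite -!mulmxA; congr (v *m _).
  apply: (can_inj (mulKmx uP)); rewrite !mulmxA mulmxV// mul1mx.
  rewrite frame_shape -!mulmxA frame_shape !mulmxA.
  by rewrite -(mulmxA _ P) mulmxV// mulmx1 DL.
- have -> : K v w = kappa3 mu mu2 (v *m invmx P) (w *m invmx P) *m P.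
    by rewrite -K_coords !mulmxKV.
  by rewrite !mulmxA K_coords DK mulmxK.
Qed.

Lemma symmetry_mul T1 T2 : G T1 -> G T2 -> G (T1 *m T2).
Proof.
move=> [d1 h1 S1 K1] [d2 h2 S2 K2]; split=> [|v w|v|v w].
- by rewrite det_mulmx mulr_gt0.
- by rewrite !mulmxA h2 h1.
- by rewrite !mulmxA S2 S1.
- by rewrite !mulmxA K2 K1.
Qed.

Lemma symmetry_frame T : G T ->
  forall u v, let D := P *m T *m invmx P in
  kappa3 mu mu2 (u *m D) (v *m D) = kappa3 mu mu2 u v *m D.
Proof.
move=> [_ _ _ KT] u v /=; have uP := frame_unit.
apply: (can_inj (mulmxK uP)).
by rewrite -K_coords !mulmxA !mulmxKV// KT K_coords.
Qed.

End adapted.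

Lemma SO2_comm (R : realType) (Q Q' : 'M[R]_2) : @SO R 2 Q -> @SO R 2 Q' ->
  Q *m Q' = Q' *m Q.
Proof.
have sum2 (F : 'I_2 -> R) : \sum_i F i = F 0 + F 1.
  by rewrite !big_ord_recl big_ord0 addr0; congr (_ + F _); exact: val_inj.
have ord2 (i : 'I_2) : i = 0 \/ i = 1.
  by case: i => [[|[|//]] ?]; [left|right]; exact: val_inj.
have SO2E (A : 'M[R]_2) : @SO R 2 A -> A 1 1 = A 0 0 /\ A 1 0 = - A 0 1.
  move=> [AA dA].
  have dE : A 0 0 * A 1 1 - A 0 1 * A 1 0 = 1.
    rewrite -dA (expand_det_row _ 0) sum2 /cofactor !det_mx11 !mxE /=.
    rewrite expr0 expr1 mul1r mulN1r mulrN.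
    by congr (_ * A _ _ - _ * A _ _); exact: val_inj.
  have := congr1 (fun M : 'M[R]_2 => M 0 0) AA.
  have := congr1 (fun M : 'M[R]_2 => M 1 1) AA.
  rewrite !mxE !sum2 !mxE /= => h1 h0.
  (* Both rows are unit vectors and the determinant is 1, so the sum of squares is [1 + 1 - 2]. *)
  have : (A 1 1 - A 0 0) ^+ 2 + (A 1 0 + A 0 1) ^+ 2 = 0.
    have -> : (A 1 1 - A 0 0) ^+ 2 + (A 1 0 + A 0 1) ^+ 2 =
      (A 1 0 * A 1 0 + A 1 1 * A 1 1) + (A 0 0 * A 0 0 + A 0 1 * A 0 1) -
      2 * (A 0 0 * A 1 1 - A 0 1 * A 1 0) by ring.
    by rewrite h1 h0 dE; ring.
  move=> /eqP; rewrite paddr_eq0 ?sqr_ge0// !sqrf_eq0 => /andP[].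
  by rewrite subr_eq0 addr_eq0 => /eqP -> /eqP ->.
move=> /SO2E[a1 a2] /SO2E[b1 b2]; apply/matrixP => i j.
case: (ord2 i) => ->; case: (ord2 j) => ->; rewrite !mxE !sum2 ?a1 ?a2 ?b1 ?b2; ring.
Qed.

(** SO(2) and Z/3 are both abelian, and an injective multiplicative map pulls commutativity back; no
    element of the group has to be identified. *)
Lemma iso_comm (R : realType) n (G : set 'M[R]_n) :
  (forall T1 T2, G T1 -> G T2 -> G (T1 *m T2)) ->
  is_SO2 G \/ is_Z3 G -> forall T1 T2, G T1 -> G T2 -> T1 *m T2 = T2 *m T1.
Proof.
move=> Gm [] [phi [phiG phi_inj _] phiM] T1 T2 G1 G2; apply: phi_inj;
  rewrite ?inE; try exact: Gm; rewrite !phiM//.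
  by apply: SO2_comm; exact: phiG.
by rewrite addrC.
Qed.

(** Rotation by a third of a turn about the first axis. On the plane of the last two axes the cubic
    form of [kappa3] is [mu2 * Re (x + i y)^3], which this rotation preserves for every [mu2]. *)
Definition rot3 (R : realType) : 'M[R]_3 :=
  mx3 [:: [:: 1; 0; 0]; [:: 0; - 2^-1; Num.sqrt 3 / 2];
          [:: 0; - (Num.sqrt 3 / 2); - 2^-1]].

(** Half-turn about the second axis. It reverses the first axis and is compatible with the [mu2]
    terms of [kappa3], so it becomes a symmetry once [mu = 0]. *)
Definition flip3 (R : realType) : 'M[R]_3 :=
  mx3 [:: [:: -1; 0; 0]; [:: 0; 1; 0]; [:: 0; 0; -1]].

Lemma sqrt3_half (R : realType) :
  (Num.sqrt 3 / 2 : R) * (Num.sqrt 3 / 2) = 3 / 4 /\ (Num.sqrt 3 / 2 : R) != 0.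
Proof.
have s0 : (0 : R) <= 3 by [].
split; first by rewrite mulf_div -expr2 sqr_sqrtr// -natrM.
by rewrite mulf_neq0// sqrtr_eq0 -ltNge.
Qed.

(** Commuting with [rot3] makes [D] a scalar on the axis plus a similarity [x + y J] of the plane.
    Being an involution compatible with [mu != 0] forces the scalar 1, [y = 0] and [x = 1] or
    [x = -1]. As [D] is not the identity it is the half-turn about the axis, which changes the sign
    of the [mu2] term. *)
Lemma commutant_involution (R : realType) (mu mu2 : R) (D : 'M[R]_3) :
  mu != 0 -> rot3 R *m D = D *m rot3 R -> D *m D = 1%:M -> D != 1%:M ->
  (forall u v, kappa3 mu mu2 (u *m D) (v *m D) = kappa3 mu mu2 u v *m D) ->
  mu2 = 0.
Proof.
move=> mu0 Dr DD D1 DK; have [ss s0] := sqrt3_half R.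
have Dij i j := congr1 (fun M : 'M[R]_3 => M i j) Dr.
have DDij i j := congr1 (fun M : 'M[R]_3 => M i j) DD.
have DKij u v i :=
  congr1 (fun M : 'rV[R]_3 => M 0 i) (DK (delta_mx 0 u) (delta_mx 0 v)).
move: (Dij 0 1) (Dij 0 2) (Dij 1 0) (Dij 2 0) (Dij 1 1) (Dij 1 2); clear Dij.
move: (DDij 0 0) (DDij 1 1) (DDij 1 2); clear DDij.
move: (DKij 0 0 0) (DKij 1 1 1); clear DKij.
move: ss s0 D1; rewrite /rot3; mx3_compute; mx3_compute.
move: (Num.sqrt 3 / 2) => c ss s0 D1 k0 k1 dd0 dd1 dd2 r01 r02 r10 r20 r11 r12.
have cc x : c * (c * x) = 3 / 4 * x by rewrite mulrA ss.
have d01 : D 0 1 = 0.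
  have := congr1 (fun x => c * x) r02; have := cc (D 0 1); lra.
have d02 : D 0 2 = 0.
  have := congr1 (fun x => c * x) r01; have := cc (D 0 2); lra.
have d10 : D 1 0 = 0.
  have := congr1 (fun x => c * x) r20; have := cc (D 1 0); lra.
have d20 : D 2 0 = 0.
  have := congr1 (fun x => c * x) r10; have := cc (D 2 0); lra.
have d21 : D 2 1 = - D 1 2.
  by apply: (mulfI s0); move: r11; rewrite d10; lra.
have d22 : D 2 2 = D 1 1.
  by apply: (mulfI s0); move: r12; rewrite d10; lra.
move: k0 k1 dd0 dd1 dd2; rewrite d01 d02 d10 d20 d21 d22 => k0 k1 dd0 dd1 dd2.
have d00 : D 0 0 = 1.
  have : mu * (D 0 0 * D 0 0 - D 0 0) = 0 by lra.
  move=> /eqP; rewrite mulf_eq0 (negbTE mu0)/= => /eqP; lra.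
have xy : D 1 1 * D 1 2 = 0 by lra.
have x0 : D 1 1 != 0.
  apply/negP => /eqP x0; move: dd1; rewrite x0.
  have : 0 <= D 1 2 * D 1 2 by rewrite -expr2 sqr_ge0.
  lra.
have y0 : D 1 2 = 0.
  by move/eqP: xy; rewrite mulf_eq0 (negbTE x0) => /eqP.
move: k1 dd1 d21; rewrite y0 => k1 dd1 d21.
have : (D 1 1 - 1) * (D 1 1 + 1) = 0 by lra.
move=> /eqP; rewrite mulf_eq0 => /orP[/eqP x1|/eqP x1]; last first.
  have xE : D 1 1 = -1 by lra.
  by move: k1; rewrite xE; lra.
case/negP: D1; apply/eqP; have xE : D 1 1 = 1 by lra.
by apply: matrix3P; rewrite ?d00 ?d01 ?d02 ?d10 ?d20 ?d21 ?d22 ?xE ?y0 !mxE ?oppr0.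
Qed.

(** * What the symmetry group says about [mu] and [mu2] *)

Section groups.
Variables (R : realType) (h S : 'M[R]_3) (K : 'rV[R]_3 -> 'rV[R]_3 -> 'rV[R]_3).
Variables (e1 e2 e3 : 'rV[R]_3) (mu mu2 lambda a : R).
Hypothesis af : adapted_frame_at h S K e1 e2 e3 mu mu2 lambda a.
Hypothesis hC : forall v w, bil h v w = bil h w v.
Hypothesis kf : kform K.
Let P := frame_mx e1 e2 e3.
Let G := symmetry_group h S K.

Lemma rot3_symmetry : G (invmx P *m rot3 R *m P).
Proof.
have [ss s0] := sqrt3_half R; apply: (frame_symmetry af hC kf).
- apply: matrix3P; mx3_compute; rewrite ?(mul0r, mulr0, addr0, add0r, mulr1)//; lra.
(* The determinant is positive because its cube is 1. *)
- have r3 : rot3 R *m rot3 R *m rot3 R = 1%:M.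
    have ss3 : Num.sqrt 3 / 2 * (Num.sqrt 3 / 2) * (Num.sqrt 3 / 2) =
      3 / 4 * (Num.sqrt 3 / 2) :> R by rewrite ss.
    move: ss ss3; rewrite /rot3; move: (Num.sqrt 3 / 2) => c ss ss3.
    by apply: matrix3P; mx3_compute; mx3_compute; lra.
  have := congr1 determinant r3; rewrite !det_mulmx det1.
  move: (\det _) => x x3; rewrite ltNge; apply/negP => x0.
  have : 0 <= x * x by rewrite -expr2 sqr_ge0.
  by move=> /(mulr_ge0_le0)/(_ x0); rewrite x3 ler10.
- apply: matrix3P; rewrite mul_diag_mx mul_mx_diag; mx3_compute; ring.
- move: ss; rewrite /rot3; move: (Num.sqrt 3 / 2) => c ss u v.
  apply/rowP => j; case: (ord3P j) => ->; mx3_compute; mx3_compute.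
  + have E x y : c * c * x * y = 3 / 4 * x * y by rewrite ss.
    have := E (mu * u 0 1) (v 0 1); have := E (mu * u 0 2) (v 0 2); lra.
  + have E x y : c * c * x * y = 3 / 4 * x * y by rewrite ss.
    have := E (mu2 * u 0 1) (v 0 1); have := E (mu2 * u 0 2) (v 0 2); lra.
  + have E x y : c * c * x * y = 3 / 4 * x * y by rewrite ss.
    have := E (mu2 * u 0 1) (v 0 2); have := E (mu2 * u 0 2) (v 0 1); lra.
Qed.

Lemma flip3_symmetry : mu = 0 -> G (invmx P *m flip3 R *m P).
Proof.
move=> mu0; apply: (frame_symmetry af hC kf).
- apply: matrix3P; mx3_compute; ring.
- have -> : flip3 R = diag_mx (vec 3 [:: -1; 1; -1]).
    by apply: matrix3P; mx3_compute.
  by rewrite det_diag !big_ord_recl big_ord0 !mxE /=; lra.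
- apply: matrix3P; rewrite mul_diag_mx mul_mx_diag; mx3_compute; ring.
- by move=> u v; apply/rowP => j; case: (ord3P j) => ->; mx3_compute; rewrite mu0; ring.
Qed.

(* If [mu = 0], then [flip3] is a symmetry that does not commute with [rot3],
   whereas SO(2) and Z/3 are abelian. *)
Lemma symmetric_mu_neq0 : is_SO2 G \/ is_Z3 G -> mu != 0.
Proof.
move=> GI; apply/negP => /eqP mu0.
have uP := frame_unit af hC.
have := iso_comm (@symmetry_mul _ h S K) GI rot3_symmetry (flip3_symmetry mu0).
rewrite !mulmxA !(mulmxK uP) => /(can_inj (mulmxK uP)).
rewrite -!mulmxA => /(can_inj (mulKVmx uP)).
move=> /(congr1 (fun M : 'M[R]_3 => M 1 2)); mx3_compute.
have [_ s0] := sqrt3_half R; rewrite ?(mul0r, mulr0, addr0, add0r, mulr1, mul1r).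
by move: s0 => /[swap]; move: (Num.sqrt 3 / 2) => c cE /eqP; apply; lra.
Qed.

(* SO(2) contains an involution, and an involution commuting with [rot3] can
   only preserve K when [mu2 = 0]. *)
Lemma SO2_mu2_eq0 : mu != 0 -> is_SO2 G -> mu2 = 0.
Proof.
move=> mu0 GI; have uP := frame_unit af hC.
have Gm := @symmetry_mul _ h S K.
have [phi [phiG phi_inj phi_surj] phiM] := GI.
have SO1 : @SO R 2 1%:M by split; rewrite ?det1// trmx1 mulmx1.
have SON1 : @SO R 2 (- 1%:M).
  split; first by rewrite linearN/= trmx1 mulNmx mulmxN opprK mulmx1.
  by rewrite -scaleN1r detZ det1 mulr1 sqrrN expr1n.
have [T GT phiT] := phi_surj _ SON1; have [I GI1 phiI] := phi_surj _ SO1.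
have TT : T *m T = I.
  apply: phi_inj; rewrite ?inE//; first exact: Gm.
  by rewrite phiM// phiT phiI mulNmx mulmxN opprK mulmx1.
(* The isomorphism is only known to be multiplicative: the preimage of the identity is idempotent
   and invertible, hence the identity. *)
have II : I *m I = I.
  by apply: phi_inj; rewrite ?inE//; [exact: Gm|rewrite phiM// phiI mulmx1].
have I1 : I = 1%:M.
  have uI : I \in unitmx by case: GI1 => d _ _ _; rewrite unitmxE unitfE gt_eqF.
  by apply: (can_inj (mulmxK uI)); rewrite II mul1mx.
have T1 : T != 1%:M.
  apply/negP => /eqP TE; have : phi T = phi I by rewrite TE I1.
  rewrite phiT phiI => /matrixP /(_ 0 0); rewrite !mxE /=; lra.
pose D := P *m T *m invmx P.
have DT : T = invmx P *m D *m P by rewrite /D !mulmxA mulVmx// mul1mx mulmxKV.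
have DK := symmetry_frame af hC kf GT; rewrite -/D/= in DK.
have DD : D *m D = 1%:M.
  by rewrite /D !mulmxA mulmxKV// -(mulmxA P) TT I1 mulmx1 mulmxV.
have Dr : rot3 R *m D = D *m rot3 R.
  have := iso_comm Gm (or_introl GI) rot3_symmetry GT.
  rewrite DT !mulmxA !(mulmxK uP) => /(can_inj (mulmxK uP)).
  by rewrite -!mulmxA => /(can_inj (mulKVmx uP)).
have D1 : D != 1%:M.
  apply: contra_neq T1 => D1; rewrite DT D1 mulmx1 mulVmx//.
exact: (commutant_involution mu0 Dr DD D1 DK).
Qed.

End groups.

(** * Structure equations in an adapted frame *)

(* Opaque copies of ['D]: unification must not unfold the directional
   derivative. *)
Definition mD (R : realType) n m1 m2 (f : 'rV[R]_n -> 'M[R]_(m1, m2))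
  (p v : 'rV[R]_n) : 'M[R]_(m1, m2) := 'D_v f p.

Definition sD (R : realType) n (f : 'rV[R]_n -> R) (p v : 'rV[R]_n) : R :=
  'D_v f p.

Definition dot (R : realType) n (u : 'rV[R]_n) (z : 'cV[R]_n) : R :=
  (u *m z) 0 0.

(** * Calculus of the opaque derivatives *)

Section wrappers.
Variables (R : realType) (n : nat).
Implicit Types (p v w : 'rV[R]_n) (W : set 'rV[R]_n).

Lemma mD_lincomb m1 m2 (f : 'rV[R]_n -> 'M[R]_(m1, m2)) p a v w :
  differentiable f p -> mD f p (a *: v + w) = a *: mD f p v + mD f p w.
Proof. exact: derive_lincomb. Qed.

Lemma sD_lincomb (f : 'rV[R]_n -> R) p a v w :
  differentiable f p -> sD f p (a *: v + w) = a * sD f p v + sD f p w.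
Proof. exact: derive_lincomb. Qed.

Lemma mD_ext m1 m2 (f g : 'rV[R]_n -> 'M[R]_(m1, m2)) W p v :
  open W -> W p -> (forall q, W q -> f q = g q) -> mD f p v = mD g p v.
Proof.
move=> oW Wp fg; apply: near_eq_derive.
by apply: filterS fg _; exact: open_nbhs_nbhs.
Qed.

Lemma sD_ext (f g : 'rV[R]_n -> R) W p v :
  open W -> W p -> (forall q, W q -> f q = g q) -> sD f p v = sD g p v.
Proof.
move=> oW Wp fg; apply: near_eq_derive.
by apply: filterS fg _; exact: open_nbhs_nbhs.
Qed.

Lemma mD_cst m1 m2 (a : 'M[R]_(m1, m2)) p v : mD (fun _ : 'rV[R]_n => a) p v = 0.
Proof. exact: derive_cst. Qed.

Lemma sD_cst (a : R) p v : sD (fun _ : 'rV[R]_n => a) p v = 0.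
Proof. exact: derive_cst. Qed.

Lemma mDD m1 m2 (f g : 'rV[R]_n -> 'M[R]_(m1, m2)) p v :
  differentiable f p -> differentiable g p ->
  mD (fun q => f q + g q) p v = mD f p v + mD g p v.
Proof. by move=> df dg; apply: deriveD; exact: diff_derivable. Qed.

Lemma sDM (f g : 'rV[R]_n -> R) p v :
  differentiable f p -> differentiable g p ->
  sD (fun q => f q * g q) p v = f p * sD g p v + g p * sD f p v.
Proof. by move=> df dg; apply: deriveM; exact: diff_derivable. Qed.

Lemma sDZ (a : R) (f : 'rV[R]_n -> R) p v : differentiable f p ->
  sD (fun q => a * f q) p v = a * sD f p v.
Proof. by move=> df; apply: deriveZ; exact: diff_derivable. Qed.

Lemma mD_entry m1 m2 (f : 'rV[R]_n -> 'M[R]_(m1, m2)) p v i j :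
  differentiable f p -> mD f p v i j = sD (fun q => f q i j) p v.
Proof. exact: derive_entry. Qed.

Lemma mDZ m1 m2 (a : 'rV[R]_n -> R) (f : 'rV[R]_n -> 'M[R]_(m1, m2)) p v :
  differentiable a p -> differentiable f p ->
  mD (fun q => a q *: f q) p v = sD a p v *: f p + a p *: mD f p v.
Proof.
move=> da df; have dfij i j : differentiable (fun q => f q i j : R) p.
  exact: (differentiable_mxP f p).1.
have daf : differentiable (fun q => a q *: f q) p.
  apply/differentiable_mxP => i j.
  have -> : (fun q => (a q *: f q) i j : R) = a * (fun q => f q i j).
    by apply/funext => q; rewrite mxE.
  exact: differentiableM.
apply/matrixP => i j; rewrite mD_entry// !mxE mD_entry//.
have -> : (fun q => (a q *: f q) i j : R) = (fun q => a q * f q i j).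
  by apply/funext => q; rewrite mxE.
by rewrite sDM// [LHS]addrC; congr (_ + _); exact: mulrC.
Qed.

Lemma dotDl m (u v : 'rV[R]_m) z : dot (u + v) z = dot u z + dot v z.
Proof. by rewrite /dot mulmxDl mxE. Qed.

Lemma dotDr m (u : 'rV[R]_m) y z : dot u (y + z) = dot u y + dot u z.
Proof. by rewrite /dot mulmxDr mxE. Qed.

Lemma dotZl m a (u : 'rV[R]_m) z : dot (a *: u) z = a * dot u z.
Proof. by rewrite /dot -scalemxAl mxE. Qed.

Lemma dotZr m a (u : 'rV[R]_m) z : dot u (a *: z) = a * dot u z.
Proof. by rewrite /dot -scalemxAr mxE. Qed.

Lemma dotNl m (u : 'rV[R]_m) z : dot (- u) z = - dot u z.
Proof. by rewrite /dot mulNmx mxE. Qed.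

Lemma dot_suml m (I : Type) (r : seq I) (P : pred I) (F : I -> 'rV[R]_m) z :
  dot (\sum_(i <- r | P i) F i) z = \sum_(i <- r | P i) dot (F i) z.
Proof. by rewrite /dot mulmx_suml summxE. Qed.

Lemma sD_dot m (f : 'rV[R]_n -> 'rV[R]_m) (z : 'rV[R]_n -> 'cV[R]_m) p v :
  differentiable f p -> differentiable z p ->
  sD (fun q => dot (f q) (z q)) p v = dot (mD f p v) (z p) + dot (f p) (mD z p v).
Proof.
move=> df dz; have dfz := differentiableMx df dz.
apply: etrans (esym (derive_entry v 0 0 dfz)) _.
apply: etrans (congr1 (fun M : 'M[R]_(1, 1) => M 0 0) (deriveMx v df dz)) _.
by rewrite mxE.
Qed.

Lemma smooth_dot m W (f : 'rV[R]_n -> 'rV[R]_m) (z : 'rV[R]_n -> 'cV[R]_m) :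
  open W -> smooth_on W f -> smooth_on W z ->
  smooth_on W (fun q => dot (f q) (z q)).
Proof.
by move=> oW sf sz k; exact: (Ck_mxP k _ oW).1 (Ck_mulmx oW (sf k) (sz k)) 0 0.
Qed.

End wrappers.

Lemma mD_smooth_field (R : realType) n m (U : set 'rV[R]_n)
    (Y : 'rV[R]_n -> 'rV[R]_n) (x : 'rV[R]_n -> 'rV[R]_m) :
  open U -> smooth_on U Y -> smooth_on U x ->
  smooth_on U (fun q => mD x q (Y q)).
Proof. exact: smooth_row_derive. Qed.

Lemma mD_commutator (R : realType) n m (U : set 'rV[R]_n)
    (X Y : 'rV[R]_n -> 'rV[R]_n) (x : 'rV[R]_n -> 'rV[R]_m) p :
  open U -> smooth_on U x -> U p -> differentiable X p -> differentiable Y p ->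
  mD (fun q => mD x q (Y q)) p (X p) - mD (fun q => mD x q (X q)) p (Y p) =
  mD x p (lie_bracket X Y p).
Proof. exact: derive_commutator. Qed.

Lemma mD_gauss (R : realType) n (U : set 'rV[R]_n)
    (x xi : 'rV[R]_n -> 'rV[R]_n.+1) (h S : 'rV[R]_n -> 'M[R]_n)
    (nabla : connection R n) p v Y :
  blaschke U x xi h S nabla -> U p -> smooth_at p Y ->
  mD (fun q => mD x q (Y q)) p v =
    mD x p (nabla p v Y) + bil (h p) v (Y p) *: xi p.
Proof. by move=> bl; exact: (bl_gauss bl). Qed.

Lemma mD_weingarten (R : realType) n (U : set 'rV[R]_n)
    (x xi : 'rV[R]_n -> 'rV[R]_n.+1) (h S : 'rV[R]_n -> 'M[R]_n)
    (nabla : connection R n) p v :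
  blaschke U x xi h S nabla -> U p -> mD xi p v = - mD x p (v *m S p).
Proof. by move=> bl; exact: (bl_weingarten bl). Qed.

Lemma mD_volume (R : realType) n (U : set 'rV[R]_n)
    (x xi : 'rV[R]_n -> 'rV[R]_n.+1) (h S : 'rV[R]_n -> 'M[R]_n)
    (nabla : connection R n) p (X : 'I_n -> 'rV[R]_n) :
  blaschke U x xi h S nabla -> U p ->
  `| \det (col_mx (xi p) (\matrix_(i < n) mD x p (X i)) : 'M[R]_n.+1) | =
    Num.sqrt `| \det (\matrix_(i < n, j < n) bil (h p) (X i) (X j)) |.
Proof. by move=> bl; exact: (bl_volume bl). Qed.

Lemma levi_civita_mD (R : realType) n (U : set 'rV[R]_n)
    (h : 'rV[R]_n -> 'M[R]_n) (hnabla : connection R n) p v Y Z :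
  levi_civita U h hnabla -> U p -> smooth_at p Y -> smooth_at p Z ->
  sD (fun q => bil (h q) (Y q) (Z q)) p v =
       bil (h p) (hnabla p v Y) (Z p) + bil (h p) (Y p) (hnabla p v Z).
Proof. by move=> [_ lc]; exact: lc. Qed.

Opaque mD sD.

Section frame.
Variables (R : realType) (U W : set 'rV[R]_3).
Variables (x xi : 'rV[R]_3 -> 'rV[R]_4) (h S : 'rV[R]_3 -> 'M[R]_3).
Variables (nabla hnabla : connection R 3).
Variables (e1 e2 e3 : 'rV[R]_3 -> 'rV[R]_3) (mu mu2 lam : 'rV[R]_3 -> R).
Hypothesis oU : open U.
Hypothesis oW : open W.
Hypothesis WU : W `<=` U.
Hypothesis bl : blaschke U x xi h S nabla.
Hypothesis lc : levi_civita U h hnabla.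
Hypothesis s1 : smooth_on W e1.
Hypothesis s2 : smooth_on W e2.
Hypothesis s3 : smooth_on W e3.
Hypothesis af : forall r, W r -> adapted_frame_at (h r) (S r)
  (difference_tensor nabla hnabla r) (e1 r) (e2 r) (e3 r) (mu r) (mu2 r) (lam r) 0.
Let K := difference_tensor nabla hnabla.
Let P q := frame_mx (e1 q) (e2 q) (e3 q).

Lemma frame_hC r v w : W r -> bil (h r) v w = bil (h r) w v.
Proof. by move=> /WU Ur; exact: (blaschke_hC oU bl). Qed.

Lemma frame_smooth : smooth_on W P.
Proof.
move=> k; apply/Ck_mxP => // i j.
have C (f : 'rV[R]_3 -> 'rV[R]_3) : smooth_on W f -> Ck_on k W (fun q => f q 0 j : R).
  by move=> sf; exact: (Ck_mxP k f oW).1 (sf k) 0 j.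
have E l (f : 'rV[R]_3 -> 'rV[R]_3) : (forall q, [:: e1 q; e2 q; e3 q]`_l = f q) ->
    smooth_on W f -> Ck_on k W (fun q => [:: e1 q; e2 q; e3 q]`_l 0 j : R).
  by move=> Ef sf; apply: Ck_ext (C f sf) => // q _; rewrite Ef.
have : Ck_on k W (fun q => [:: e1 q; e2 q; e3 q]`_i 0 j : R).
  by case: (ord3P i) => ->; [exact: (E _ e1)|exact: (E _ e2)|exact: (E _ e3)].
by apply: Ck_ext => // q _; rewrite mxE.
Qed.

(** An orthonormal frame determines the metric: [h] is the inverse of the frame matrix times the
    transpose of that inverse, hence as smooth as the frame. *)
Lemma metric_smooth : smooth_on W h.
Proof.
move=> k; have uP q : W q -> P q \in unitmx.
  by move=> Wq; apply: (frame_unit (af Wq)) => v w; exact: frame_hC.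
have C1 := Ck_invmx oW uP (frame_smooth k).
apply: Ck_ext (Ck_mulmx oW C1 (Ck_tr oW C1)) => // q Wq /=.
by apply/esym/(frame_metric (af Wq)) => v w; exact: frame_hC.
Qed.

Lemma K_form r : W r -> kform (K r).
Proof.
move=> Wr; have dh := smooth_diff metric_smooth Wr; have Ur := WU Wr.
split=> [a v v' w|a v w w'|v w]; last exact: (KC oU bl lc).
  exact: (K_linearl oU bl lc).
exact: (K_linearr oU bl lc).
Qed.

(** Indices start at 0: [e 0], [e 1], [e 2] are [e1], [e2], [e3]. The number [c r a b k] is the
    coefficient along [e k] of the derivative of [e b] in the direction [e a]. *)
Let e (a : 'I_3) : 'rV[R]_3 -> 'rV[R]_3 := nth e1 [:: e1; e2; e3] a.
Definition frame_vec a q : 'rV[R]_4 := mD x q (e a q).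
Local Notation E := frame_vec.
Let c r a b k : R := bil (h r) (nabla r (e a r) (e b)) (e k r).

Lemma frame_field_smooth a : smooth_on W (e a).
Proof. by case: (ord3P a) => ->. Qed.

Lemma frame_field_smooth_at a r : W r -> smooth_at r (e a).
Proof. by move=> Wr; exact: smooth_at_on oW Wr (frame_field_smooth a). Qed.

Lemma frame_orth r a b : W r -> bil (h r) (e a r) (e b r) = (a == b)%:R.
Proof.
move=> Wr; have [[h11 h22 h33] [h12 h13 h23]] := af_orthonormal (af Wr).
have hC v w := frame_hC v w Wr.
by case: (ord3P a) => ->; case: (ord3P b) => -> /=;
  rewrite ?(hC (e2 r) (e1 r)) ?(hC (e3 r) (e1 r)) ?(hC (e3 r) (e2 r)).
Qed.

Lemma frame_expand r v : W r -> v = \sum_k bil (h r) v (e k r) *: e k r.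
Proof.
move=> Wr; have uP := frame_unit (af Wr) (fun v w => frame_hC v w Wr).
rewrite sum3 -[LHS](mulmxKV uP) row_frame_mx /=.
have E0 k : (v *m invmx (P r)) 0 k = bil (h r) v (e k r).
  have := frame_metric (af Wr) (fun v w => frame_hC v w Wr).
  rewrite -/(P r) /bil => ->.
  have -> : (e k r)^T = (P r)^T *m delta_mx k 0.
    rewrite -colE -tr_row; congr trmx.
    by rewrite rowK; case: (ord3P k) => ->.
  rewrite !mulmxA -(mulmxA (v *m invmx (P r))) -trmx_mul mulmxV//.
  by rewrite trmx1 mulmx1 -colE [RHS]mxE.
by rewrite !E0.
Qed.

Lemma frame_vec_smooth a : smooth_on W (E a).
Proof.
exact: mD_smooth_field oW (frame_field_smooth a) (smooth_sub WU (bl_smooth bl)).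
Qed.

Lemma frame_vec_gauss r v a : W r ->
  mD (E a) r v = mD x r (nabla r v (e a)) + bil (h r) v (e a r) *: xi r.
Proof. by move=> Wr; exact: mD_gauss bl (WU Wr) (frame_field_smooth_at a Wr). Qed.

Lemma frame_weingarten r v : W r -> mD xi r v = - mD x r (v *m S r).
Proof. by move=> Wr; exact: mD_weingarten bl (WU Wr). Qed.

Lemma immersion_diff r : W r -> differentiable x r.
Proof. by move=> /WU; exact: smooth_diff (bl_smooth bl). Qed.

Lemma normal_diff r : W r -> differentiable xi r.
Proof. by move=> /WU; exact: smooth_diff (bl_normal_smooth bl). Qed.

Lemma mD_expand m1 m2 (f : 'rV[R]_3 -> 'M[R]_(m1, m2)) r v :
  differentiable f r -> W r ->
  mD f r v = \sum_k bil (h r) v (e k r) *: mD f r (e k r).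
Proof.
move=> df Wr; rewrite {1}(frame_expand v Wr) !sum3.
have L b u w := mD_lincomb b u w df.
have L3 b b' b'' u w z : mD f r (b *: u + b' *: w + b'' *: z) =
    b *: mD f r u + b' *: mD f r w + b'' *: mD f r z.
  have D0 : mD f r 0 = 0.
    have := L 1 0 0; rewrite !scale1r addr0 => /esym/eqP.
    by rewrite -subr_eq0 addrK => /eqP.
  rewrite -addrA; apply: etrans (L _ _ _) _; rewrite -[RHS]addrA; congr (_ + _).
  apply: etrans (L _ _ _) _; congr (_ + _).
  by rewrite -[b'' *: z]addr0; apply: etrans (L _ _ _) _; rewrite D0 addr0.
exact: L3.
Qed.

Lemma sD_expand (f : 'rV[R]_3 -> R) r v : differentiable f r -> W r ->
  sD f r v = \sum_k bil (h r) v (e k r) * sD f r (e k r).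
Proof.
move=> df Wr; rewrite {1}(frame_expand v Wr) !sum3.
have L b u w := sD_lincomb b u w df.
have L3 b b' b'' u w z : sD f r (b *: u + b' *: w + b'' *: z) =
    b * sD f r u + b' * sD f r w + b'' * sD f r z.
  have D0 : sD f r 0 = 0 by have := L 1 0 0; rewrite !scale1r addr0; lra.
  rewrite -addrA; apply: etrans (L _ _ _) _; rewrite -[RHS]addrA; congr (_ + _).
  apply: etrans (L _ _ _) _; congr (_ + _).
  by rewrite -[b'' *: z]addr0; apply: etrans (L _ _ _) _; rewrite D0 addr0.
exact: L3.
Qed.

Lemma dot_expand m (f : 'rV[R]_3 -> 'rV[R]_m) r v z :
  differentiable f r -> W r ->
  dot (mD f r v) z = \sum_k bil (h r) v (e k r) * dot (mD f r (e k r)) z.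
Proof.
move=> df Wr; rewrite (mD_expand v df Wr) dot_suml.
by apply: eq_bigr => k _; rewrite dotZl.
Qed.

(** By the volume condition the matrix with rows [xi], [E 0], [E 1], [E 2] has determinant 1 up to
    sign, and the columns of its inverse are the smooth dual covectors. The two kept are dual to
    [E 0] and to [xi]: their combinations contain the covector that annihilates the leaves and
    [N]. *)
Lemma dual_frame : exists rho rhox : 'rV[R]_3 -> 'cV[R]_4,
  [/\ smooth_on W rho /\ smooth_on W rhox,
      forall r a, W r -> dot (E a r) (rho r) = (a == 0)%:R,
      forall r, W r -> dot (xi r) (rho r) = 0,
      forall r a, W r -> dot (E a r) (rhox r) = 0 &
      (forall r, W r -> dot (xi r) (rhox r) = 1) /\
      (forall r (z : 'cV[R]_4), W r -> (forall a, dot (E a r) z = 0) ->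
         dot (xi r) z = 0 -> z = 0)].
Proof.
pose Phi q : 'M[R]_(1 + 3) := col_mx (xi q) (\matrix_(k < 3) E k q).
have uPhi q : W q -> Phi q \in unitmx.
  move=> Wq; have := mD_volume (fun k => e k q) bl (WU Wq).
  have -> : (\matrix_(i, j) bil (h q) (e i q) (e j q)) = 1%:M.
    by apply/matrixP => i j; rewrite !mxE frame_orth.
  rewrite det1 normr1 sqrtr1 => d1; rewrite unitmxE unitfE.
  by apply/negP => /eqP d0; move: d1; rewrite -/(Phi q) d0 normr0 => /esym/eqP;
    rewrite oner_eq0.
have sPhi : smooth_on W Phi.
  move=> k; apply/Ck_mxP => // i j; have [i' ->|i' ->] := split_ordP i.
    have := (Ck_mxP k xi oW).1 (smooth_sub WU (bl_normal_smooth bl) k) i' j.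
    by apply: Ck_ext => // q _; rewrite col_mxEu.
  have := (Ck_mxP k (E i') oW).1 (frame_vec_smooth i' k) 0 j.
  by apply: Ck_ext => // q _; rewrite col_mxEd mxE.
pose Psi q := invmx (Phi q).
have sPsi : smooth_on W Psi by move=> k; exact: Ck_invmx.
have PhiPsi q : W q -> Phi q *m Psi q = 1%:M by move=> /uPhi; exact: mulmxV.
have scol j : smooth_on W (fun q => col j (Psi q)).
  move=> k; apply/Ck_mxP => // i l.
  have := (Ck_mxP k Psi oW).1 (sPsi k) i j.
  by apply: Ck_ext => // q _; rewrite mxE.
have rowE a q : row (rshift 1 a) (Phi q) = E a q.
  by apply/rowP => j; rewrite mxE col_mxEd mxE.
have rowxi q : row (lshift 3 0) (Phi q) = xi q.
  by apply/rowP => j; rewrite mxE col_mxEu.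
have dotE q i j : W q -> dot (row i (Phi q)) (col j (Psi q)) = (i == j)%:R.
  move=> Wq; have := congr1 (fun M : 'M[R]_(1 + 3) => M i j) (PhiPsi q Wq).
  rewrite /dot mxE [X in _ = X -> _]mxE => <-; rewrite mxE.
  by apply: eq_bigr => l _; rewrite !mxE.
exists (fun q => col (rshift 1 0) (Psi q)), (fun q => col (lshift 3 0) (Psi q)).
split=> //.
- by move=> r a Wr; rewrite -rowE dotE// (inj_eq (@rshift_inj _ _)).
- by move=> r Wr; rewrite -rowxi dotE// eq_lrshift.
- by move=> r a Wr; rewrite -rowE dotE// eq_rlshift.
split=> [r Wr|r z Wr Ez xiz]; first by rewrite -rowxi dotE// eqxx.
apply: (can_inj (mulKmx (uPhi r Wr))); rewrite mulmx0; apply/colP => i.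
rewrite mxE [RHS]mxE; have [i' ->|i' ->] := split_ordP i.
  rewrite -[RHS]xiz /dot mxE; apply: eq_bigr => l _.
  by rewrite col_mxEu (ord1 i').
rewrite -[RHS](Ez i') /dot mxE; apply: eq_bigr => l _.
by rewrite col_mxEd mxE.
Qed.

Hypothesis eta_mu : forall r v, W r -> bil (h r) v (e1 r) = 0 ->
  hnabla r v e1 = mu r *: v.
Hypothesis mu_neq0 : forall r, W r -> mu r != 0.
Let g r a b k : R := bil (h r) (hnabla r (e a r) (e b)) (e k r).

Lemma hnabla_frame_skew r a b k : W r -> g r a b k = - g r a k b.
Proof.
move=> Wr; have := @levi_civita_mD _ _ _ _ _ r (e a r) (e b) (e k) lc (WU Wr)
  (frame_field_smooth_at b Wr) (frame_field_smooth_at k Wr).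
have -> : sD (fun q => bil (h q) (e b q) (e k q)) r (e a r) = 0.
  have := @sD_ext _ _ (fun q => bil (h q) (e b q) (e k q)) (fun=> (b == k)%:R)
    W r (e a r) oW Wr.
  by rewrite sD_cst; apply=> q Wq; exact: frame_orth.
rewrite (frame_hC (e b r) _ Wr) => /esym/eqP; rewrite addr_eq0 => /eqP.
by [].
Qed.

Lemma frame_rowE r k : e k r = delta_mx 0 k *m P r.
Proof. by rewrite -rowE rowK; case: (ord3P k) => ->. Qed.

Lemma bil_coords r (u v : 'rV[R]_3) : W r ->
  bil (h r) (u *m P r) (v *m P r) = (u *m v^T) 0 0.
Proof.
move=> Wr; have gram := frame_gram (af Wr) (fun v w => frame_hC v w Wr).
rewrite /bil trmx_mul !mulmxA -(mulmxA u) -(mulmxA u) gram mulmx1.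
by [].
Qed.

Lemma nabla_frame_split r a b k : W r -> c r a b k =
  g r a b k + kappa3 (mu r) (mu2 r) (delta_mx 0 a) (delta_mx 0 b) 0 k.
Proof.
move=> Wr; rewrite /c /g (nabla_split oU bl lc _ (WU Wr) (frame_field_smooth_at b Wr)).
rewrite bilDl; congr (_ + _); rewrite !frame_rowE.
rewrite (K_coords (af Wr) (K_form Wr)) bil_coords//.
by rewrite trmx_delta -colE mxE.
Qed.

Lemma hnabla_frame_e1 r a k : W r -> a != 0 -> g r a 0 k = mu r * (a == k)%:R.
Proof.
move=> Wr a0; rewrite /g /= eta_mu//; first by rewrite bilZl frame_orth.
by have := frame_orth a 0 Wr; rewrite (negbTE a0).
Qed.

(** The table of [nabla = hnabla + K]; five Levi-Civita coefficients stay free. Along the leaves,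
    [eta = mu1] cancels the [- mu1] of [K], so the derivative of [e1] vanishes there, whereas in the
    derivative of [e2] or [e3] along itself the two [e1]-components add up to [- 2 mu]. *)
Lemma nabla_frame_values r : W r -> exists w2 w3 om p q : R,
  [/\ [/\ c r 0 0 0 = 2 * mu r, c r 0 0 1 = w2, c r 0 0 2 = w3,
          c r 0 1 0 = - w2 & c r 0 2 0 = - w3],
      [/\ c r 0 1 1 = - mu r, c r 0 1 2 = om, c r 0 2 1 = - om & c r 0 2 2 = - mu r],
      (forall k, c r 1 0 k = 0) /\ (forall k, c r 2 0 k = 0),
      [/\ c r 1 1 0 = - 2 * mu r, c r 1 1 1 = mu2 r, c r 1 1 2 = p &
          [/\ c r 1 2 0 = 0, c r 1 2 1 = - p & c r 1 2 2 = - mu2 r]] &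
      [/\ c r 2 1 0 = 0, c r 2 1 1 = 0, c r 2 1 2 = q - mu2 r &
          [/\ c r 2 2 0 = - 2 * mu r, c r 2 2 1 = - q - mu2 r & c r 2 2 2 = 0]]].
Proof.
move=> Wr.
exists (g r 0 0 1), (g r 0 0 2), (g r 0 1 2), (g r 1 1 2), (g r 2 1 2).
have g0 a b : g r a b b = 0 by have := hnabla_frame_skew a b b Wr; lra.
have g10' k : g r 1 0 k = mu r * (1 == k)%:R by exact: hnabla_frame_e1.
have g20' k : g r 2 0 k = mu r * (2 == k)%:R by exact: hnabla_frame_e1.
have g1_0 b : g r 1 b 0 = - mu r * (1 == b)%:R by rewrite hnabla_frame_skew//
  hnabla_frame_e1// mulNr.
have g2_0 b : g r 2 b 0 = - mu r * (2 == b)%:R by rewrite hnabla_frame_skew//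
  hnabla_frame_e1// mulNr.
have kE a b k : kappa3 (mu r) (mu2 r) (delta_mx 0 a) (delta_mx 0 b) 0 k =
  [:: 2 * mu r * ((a == 0)%:R * (b == 0)%:R) - mu r * ((a == 1)%:R * (b == 1)%:R)
        - mu r * ((a == 2)%:R * (b == 2)%:R);
      - mu r * ((a == 0)%:R * (b == 1)%:R + (a == 1)%:R * (b == 0)%:R)
        + mu2 r * ((a == 1)%:R * (b == 1)%:R - (a == 2)%:R * (b == 2)%:R);
      - mu r * ((a == 0)%:R * (b == 2)%:R + (a == 2)%:R * (b == 0)%:R)
        - mu2 r * ((a == 1)%:R * (b == 2)%:R + (a == 2)%:R * (b == 1)%:R)]`_k.
  by rewrite /kappa3 !mxE /= !(eq_sym _ a) !(eq_sym _ b).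
have gs a b k := hnabla_frame_skew a b k Wr.
split; [split|split|split|split; last split|split; last split];
  try (move=> k; case: (ord3P k) => ->); rewrite nabla_frame_split// kE /= ?g0
    ?g10' ?g20' ?g1_0 ?g2_0//=;
  rewrite ?(gs 0 1 0) ?(gs 0 2 0) ?(gs 0 2 1) ?(gs 1 2 1) ?(gs 2 2 1) ?(gs 2 1
    0); try lra.
Qed.

(** The [e1]-component of the Gauss equation. It is obtained by pairing the commutator identity for
    [E d] with the covector [rho] dual to [E 0], so that only the coefficients with last index 0 are
    differentiated. *)
Lemma frame_flat rho r (a b d : 'I_3) : W r -> smooth_on W rho ->
  (forall q k, W q -> dot (E k q) (rho q) = (k == 0)%:R) ->
  (forall q, W q -> dot (xi q) (rho q) = 0) ->
  sD (fun q => c q b d 0) r (e a r) + \sum_k c r b d k * c r a k 0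
    - (b == d)%:R * (lam r * (a == 0)%:R) -
  (sD (fun q => c q a d 0) r (e b r) + \sum_k c r a d k * c r b k 0
    - (a == d)%:R * (lam r * (b == 0)%:R)) =
  \sum_k (c r a b k - c r b a k) * c r k d 0.
Proof.
move=> Wr srho Erho xirho.
have drho := smooth_diff srho Wr; have dx := immersion_diff Wr.
have dotx q v : W q -> dot (mD x q v) (rho q) = bil (h q) v (e 0 q).
  move=> Wq; have Ek k : dot (mD x q (e k q)) (rho q) = (k == 0)%:R by exact: Erho.
  rewrite dot_expand//; last exact: immersion_diff.
  under eq_bigr do rewrite Ek.
  by rewrite sum3 /= mulr1 !mulr0 !addr0.
have sY i j : smooth_on W (fun q => mD (E j) q (e i q)).
  exact: mD_smooth_field oW (frame_field_smooth i) (frame_vec_smooth j).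
have YE q i j : W q -> dot (mD (E j) q (e i q)) (rho q) = c q i j 0.
  by move=> Wq; rewrite frame_vec_gauss// dotDl dotZl xirho// mulr0 addr0 dotx.
(* The derivative of [rho] is known through its pairings: differentiating the constants
   [dot (E k q) (rho q)] moves it onto the frame. *)
have dotE i k : dot (E k r) (mD rho r (e i r)) = - c r i k 0.
  have dEk := smooth_diff (frame_vec_smooth k) Wr.
  have := sD_dot (e i r) dEk drho; rewrite YE//.
  have -> : sD (fun q => dot (E k q) (rho q)) r (e i r) = 0.
    have := @sD_ext _ _ (fun q => dot (E k q) (rho q)) (fun=> (k == 0)%:R) W r
      (e i r) oW Wr.
    by rewrite sD_cst; apply=> q Wq; exact: Erho.
  by move=> /esym/eqP; rewrite addrC addr_eq0 => /eqP.
have dotxi i : dot (xi r) (mD rho r (e i r)) = lam r * (i == 0)%:R.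
  have := sD_dot (e i r) (normal_diff Wr) drho.
  have -> : sD (fun q => dot (xi q) (rho q)) r (e i r) = 0.
    have := @sD_ext _ _ (fun q => dot (xi q) (rho q)) (fun=> 0) W r (e i r) oW Wr.
    by rewrite sD_cst; apply=> q Wq; exact: xirho.
  rewrite frame_weingarten// dotNl dotx// => /esym/eqP.
  rewrite addrC subr_eq0 => /eqP ->.
  case: (ord3P i) => ->; rewrite /= ?(af_S1 (af Wr)) ?(af_S2 (af Wr)) ?(af_S3
    (af Wr)) ?scale0r ?bil0l ?mulr0//.
  by rewrite bilZl (frame_orth 0 0 Wr).
have dotv i v : dot (mD x r v) (mD rho r (e i r)) =
    - \sum_k bil (h r) v (e k r) * c r i k 0.
  rewrite (mD_expand _ dx Wr) dot_suml -sumrN; apply: eq_bigr => k _.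
  by rewrite dotZl dotE mulrN.
have main i j : sD (fun q => c q j d 0) r (e i r) +
    \sum_k c r j d k * c r i k 0 - (j == d)%:R * (lam r * (i == 0)%:R) =
    dot (mD (fun q => mD (E d) q (e j q)) r (e i r)) (rho r).
  have dY := smooth_diff (sY j d) Wr.
  have := sD_dot (e i r) dY drho.
  have -> : sD (fun q => dot (mD (E d) q (e j q)) (rho q)) r (e i r) =
      sD (fun q => c q j d 0) r (e i r).
    by apply: (sD_ext _ oW Wr) => q Wq; exact: YE.
  rewrite frame_vec_gauss// dotDl dotZl dotxi dotv frame_orth// => ->.
  rewrite /c; ring.
rewrite !main -dotNl -dotDl.
rewrite (mD_commutator oW (frame_vec_smooth d) Wr (smooth_diff (frame_field_smooth a) Wr)
  (smooth_diff (frame_field_smooth b) Wr)).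
rewrite -(nabla_torsion oU bl (WU Wr) (frame_field_smooth_at a Wr)
  (frame_field_smooth_at b Wr)).
rewrite dot_expand//; last exact: smooth_diff (frame_vec_smooth d) Wr.
apply: eq_bigr => k _; rewrite YE//; congr (_ * _).
by rewrite bilDl bilNl.
Qed.

Lemma frame_vecE a q : E a q = mD x q (e a q). Proof. by []. Qed.

Opaque frame_vec.

(** Four consequences of flatness are combined: [mu] is constant on the leaves, [nabla_e1 e1] is
    along [e1], [lam = - 2 e1(mu) - 8 mu^2], and [S] vanishes on the leaves. Substituting them into
    the derivatives of [xi] and [E] leaves only terms in [tau], and the combination [xi - 2 mu E]
    makes the derivative of [N] proportional to [N] itself. *)
Lemma frame_equations : exists theta : 'rV[R]_3 -> 'cV[R]_4,
  let N q := xi q - (2 * mu q) *: mD x q (e1 q) in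
  [/\ smooth_on W theta /\ smooth_on W mu,
      (forall r v, W r -> mD N r v = (- 2 * mu r * bil (h r) v (e1 r)) *: N r),
      (forall r v, W r -> mD (fun q => mD x q (e1 q)) r v =
         bil (h r) v (e1 r) *: ((4 * mu r) *: mD x r (e1 r) + N r)),
      (forall r v, W r -> mD theta r v = (- 4 * mu r * bil (h r) v (e1 r)) *: theta r) &
      forall r, W r -> [/\
        forall v, dot (mD x r v) (theta r) = bil (h r) v (e1 r),
        dot (N r) (theta r) = 0 &
        forall z, (forall v, dot (mD x r v) z = 0) -> dot (xi r) z = 0 -> z = 0]].
Proof.
have [rho [rhox [[srho srhox] Erho xirho Erhox [xirhox Eonto]]]] := dual_frame.
have sc a b : smooth_on W (fun q => c q a b 0).
  have sY : smooth_on W (fun q => mD (E b) q (e a q)).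
    exact: mD_smooth_field oW (frame_field_smooth a) (frame_vec_smooth b).
  apply: smooth_ext (smooth_dot oW sY srho) => // q Wq.
  rewrite frame_vec_gauss// dotDl dotZl xirho// mulr0 addr0.
  have Ek k : dot (mD x q (e k q)) (rho q) = (k == 0)%:R by rewrite -frame_vecE Erho.
  rewrite dot_expand//; last exact: immersion_diff.
  under eq_bigr do rewrite Ek.
  by rewrite sum3 /= mulr1 !mulr0 !addr0.
(* Smoothness of [mu] is read off the coefficient [c q 1 1 0 = - 2 * mu q]. *)
have smu : smooth_on W mu.
  have : smooth_on W (fun q => - 2^-1 * c q 1 1 0).
    by move=> k; apply: CkM => //; [exact: Ck_cst|exact: sc].
  apply: smooth_ext => // q Wq.
  have [? [? [? [? [? [_ _ _ [-> _ _ _] _]]]]]] := nabla_frame_values Wq.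
  by rewrite mulrA mulrNN mulVf ?mul1r// pnatr_eq0.
have fl r a b d Wr := @frame_flat rho r a b d Wr srho Erho xirho.
have dmu r : W r -> differentiable mu r by exact: smooth_diff.
have sDc r v a b z : W r -> (forall q, W q -> c q a b 0 = z * mu q) ->
    sD (fun q => c q a b 0) r v = z * sD mu r v.
  move=> Wr cz; rewrite -sDZ; last exact: dmu.
  by apply: (sD_ext _ oW Wr) => q Wq; exact: cz.
have sDc0 r v a b : W r -> (forall q, W q -> c q a b 0 = 0) ->
    sD (fun q => c q a b 0) r v = 0.
  move=> Wr cz; have := @sD_ext _ _ (fun q => c q a b 0) (fun=> 0) W r v oW Wr.
  by rewrite sD_cst; exact.
have c110 q : W q -> c q 1 1 0 = - 2 * mu q.
  by move=> Wq; have [? [? [? [? [? [_ _ _ [-> _ _ _] _]]]]]] := nabla_frame_values Wq.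
have c220 q : W q -> c q 2 2 0 = - 2 * mu q.
  by move=> Wq; have [? [? [? [? [? [_ _ _ _ [_ _ _ [-> _ _]]]]]]]] :=
    nabla_frame_values Wq.
have c000 q : W q -> c q 0 0 0 = 2 * mu q.
  by move=> Wq; have [? [? [? [? [? [[-> _ _ _ _] _ _ _ _]]]]]] := nabla_frame_values Wq.
have c210 q : W q -> c q 2 1 0 = 0.
  by move=> Wq; have [? [? [? [? [? [_ _ _ _ [-> _ _ _]]]]]]] := nabla_frame_values Wq.
have c120 q : W q -> c q 1 2 0 = 0.
  by move=> Wq; have [? [? [? [? [? [_ _ _ [_ _ _ [-> _ _]] _]]]]]] :=
    nabla_frame_values Wq.
have c100 q k : W q -> c q 1 0 k = 0.
  by move=> Wq; have [? [? [? [? [? [_ _ [-> _] _ _]]]]]] := nabla_frame_values Wq.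
have c200 q k : W q -> c q 2 0 k = 0.
  by move=> Wq; have [? [? [? [? [? [_ _ [_ ->] _ _]]]]]] := nabla_frame_values Wq.
(* [e2, e3] applied to e3 and e2: mu is constant along the leaves *)
have Dmu r : W r -> sD mu r (e 1 r) = 0 /\ sD mu r (e 2 r) = 0.
  move=> Wr; have f1 := fl r 1 2 2 Wr; have f2 := fl r 1 2 1 Wr.
  move: f1 f2; rewrite !sum3 /=.
  rewrite !(sDc0 r _ 1 2 Wr c120) !(sDc0 r _ 2 1 Wr c210).
  rewrite !(sDc r _ 1 1 _ Wr c110) !(sDc r _ 2 2 _ Wr c220).
  have [w2 [w3 [om [p [q [[v1 v2 v3 v4 v5] [v6 v7 v8 v9] [v10 v11]
    [v12 v13 v14 [v15 v16 v17]] [v18 v19 v20 [v21 v22 v23]]]]]]]] :=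
      nabla_frame_values Wr.
  rewrite !(v1, v2, v3, v4, v5, v6, v7, v8, v9, v10, v11, v12, v13, v14, v15,
    v16, v17, v18, v19, v20, v21, v22, v23) => f1 f2.
  by split; lra.
(* Flatness for the pairs [(e1, e2)] and [(e1, e3)], applied to [e1], gives [mu] times the
   transverse components of [nabla_e1 e1]; here [mu != 0] is used. *)
have w0 r : W r -> c r 0 0 1 = 0 /\ c r 0 0 2 = 0.
  move=> Wr; have [D1 D2] := Dmu r Wr; have mu0 := mu_neq0 Wr.
  have f1 := fl r 0 1 0 Wr; have f2 := fl r 0 2 0 Wr; move: f1 f2; rewrite !sum3.
  rewrite !(sDc0 r _ 1 0 Wr (fun q => @c100 q 0)) !(sDc0 r _ 2 0 Wr (fun q => @c200 q 0)).
  rewrite !(sDc r _ 0 0 _ Wr c000) D1 D2.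
  have [w2 [w3 [om [p [q [[v1 v2 v3 v4 v5] [v6 v7 v8 v9] [v10 v11]
    [v12 v13 v14 [v15 v16 v17]] [v18 v19 v20 [v21 v22 v23]]]]]]]] :=
      nabla_frame_values Wr.
  rewrite !(v1, v2, v3, v4, v5, v6, v7, v8, v9, v10, v11, v12, v13, v14, v15,
    v16, v17, v18, v19, v20, v21, v22, v23) /= => f1 f2.
  by split; apply: (mulfI mu0); lra.
have c010 q : W q -> c q 0 1 0 = 0.
  move=> Wq; have [W1 W2] := w0 q Wq.
  by have [? [? [? [? [? [[_ E1 _ -> _] _ _ _ _]]]]]] := nabla_frame_values Wq;
    rewrite -E1 W1 oppr0.
have c020 q : W q -> c q 0 2 0 = 0.
  move=> Wq; have [W1 W2] := w0 q Wq.
  by have [? [? [? [? [? [[_ _ E1 _ ->] _ _ _ _]]]]]] := nabla_frame_values Wq;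
    rewrite -E1 W2 oppr0.
(* Flatness for [(e1, e2)] applied to [e2] determines the remaining eigenvalue of [S]. *)
have lamE r : W r -> lam r = - 2 * sD mu r (e 0 r) - 8 * mu r ^+ 2.
  move=> Wr; have f1 := fl r 0 1 1 Wr; move: f1; rewrite !sum3.
  rewrite (sDc0 r _ 0 1 Wr c010) (sDc r _ 1 1 _ Wr c110).
  have := c010 r Wr; have := c020 r Wr.
  have [w2 [w3 [om [p [q [[v1 v2 v3 v4 v5] [v6 v7 v8 v9] [v10 v11]
    [v12 v13 v14 [v15 v16 v17]] [v18 v19 v20 [v21 v22 v23]]]]]]]] :=
      nabla_frame_values Wr.
  rewrite !(v1, v2, v3, v4, v5, v6, v7, v8, v9, v10, v11, v12, v13, v14, v15,
    v16, v17, v18, v19, v20, v21, v22, v23) /= => -> -> f1.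
  by rewrite expr2; lra.
have sEE b r a : W r -> mD (E b) r (e a r) =
    \sum_k c r a b k *: E k r + (a == b)%:R *: xi r.
  move=> Wr; rewrite frame_vec_gauss// frame_orth//; congr (_ + _).
  rewrite (mD_expand _ (immersion_diff Wr) Wr); apply: eq_bigr => k _.
  by rewrite frame_vecE.
have dE b r : W r -> differentiable (E b) r by exact: smooth_diff (frame_vec_smooth b).
pose N q : 'rV[R]_4 := xi q - (2 * mu q) *: E 0 q.
have DE0 r v : W r -> mD (E 0) r v = bil (h r) v (e1 r) *: ((2 * mu r) *: E 0 r + xi r).
  move=> Wr; rewrite (mD_expand v (dE 0 r Wr) Wr) sum3 !sEE// !sum3.
  have [-> ->] := w0 r Wr; rewrite !c000// !c100// !c200//.
  rewrite -[e1 r]/(e 0 r); move: (bil _ _ _) (bil _ _ _) (bil _ _ _) => t0 t1 t2.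
  move: (E 0 r) (E 1 r) (E 2 r) (xi r) => z0 z1 z2 z3.
  by apply/matrixP => i j; rewrite !mxE /=; ring.
have sE0 := frame_vec_smooth 0.
have sN : smooth_on W N.
  move=> k; apply: CkD => //; first exact: smooth_sub WU (bl_normal_smooth bl) k.
  apply: CkN => //; apply: Ck_scale => //.
  by apply: CkM => //; exact: Ck_cst.
have Dxi r a : W r -> mD xi r (e a r) = - ((a == 0)%:R * lam r) *: E 0 r.
  move=> Wr; rewrite frame_weingarten//.
  have -> : e a r *m S r = ((a == 0)%:R * lam r) *: e 0 r.
    by case: (ord3P a) => ->; rewrite /= ?(af_S1 (af Wr)) ?(af_S2 (af Wr))
      ?(af_S3 (af Wr)) ?mul1r ?mul0r ?scale0r.
  have L := mD_lincomb ((a == 0)%:R * lam r) (e 0 r) 0 (immersion_diff Wr).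
  have L0 := mD_lincomb 1 0 0 (immersion_diff Wr).
  have D0 : mD x r 0 = 0.
    by move: L0; rewrite !scale1r addr0 => /esym/eqP; rewrite -subr_eq0 addrK => /eqP.
  by rewrite addr0 D0 addr0 in L; rewrite L scaleNr -frame_vecE.
have DN r v : W r -> mD N r v = (- 2 * mu r * bil (h r) v (e1 r)) *: N r.
  move=> Wr; have [D1 D2] := Dmu r Wr.
  have dmu2 : differentiable (fun q => 2 * mu q) r.
    by apply: differentiableZ; exact: dmu.
  have dmE : differentiable (fun q => - (2 * mu q) *: E 0 q) r.
    have sC : smooth_on W (fun q => - (2 * mu q) *: E 0 q).
      move=> k; apply: Ck_scale => //; apply: CkN => //.
      by apply: CkM => //; exact: Ck_cst.
    exact: smooth_diff sC Wr.
  have DNa a : mD N r (e a r) = (- 2 * mu r * (a == 0)%:R) *: N r.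
    have NE : N = fun q => xi q + - (2 * mu q) *: E 0 q.
      by apply/funext => q; rewrite /N scaleNr.
    have dm2 : differentiable (fun q => - (2 * mu q)) r by exact: differentiableN.
    have E2 := mDZ (e a r) dm2 (dE 0 r Wr).
    have E3 : sD (fun q => - (2 * mu q)) r (e a r) = - 2 * sD mu r (e a r).
      have mE : (fun q => - (2 * mu q)) = fun q => - 2 * mu q.
        by apply/funext => q; rewrite mulNr.
      by rewrite mE; exact: sDZ (dmu r Wr).
    rewrite NE; apply: etrans (mDD (e a r) (normal_diff Wr) dmE) _.
    rewrite E2 E3 (Dxi r a Wr) (DE0 r (e a r) Wr) (frame_orth a 0 Wr) (lamE r Wr).
    move: D1 D2; move: (E 0 r) (xi r) => z0 z1.
    case: (ord3P a) => -> /= D1 D2; apply/matrixP => i j; rewrite !mxE ?D1 ?D2; ring.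
  rewrite (mD_expand v (smooth_diff sN Wr) Wr).
  under eq_bigr do rewrite DNa.
  rewrite sum3 /=.
  rewrite -[e1 r]/(e 0 r); move: (bil _ _ _) (bil _ _ _) (bil _ _ _) => t0 t1 t2.
  by move: (N r) => z0; apply/matrixP => i j; rewrite !mxE; ring.
(* The coefficient [2 mu] is forced by the condition that [theta] vanish on [N = xi - 2 mu E]. *)
pose theta q := rho q + (2 * mu q) *: rhox q.
have stheta : smooth_on W theta.
  move=> k; apply: CkD => //; apply: Ck_scale => //.
  by apply: CkM => //; exact: Ck_cst.
have Etheta r a : W r -> dot (E a r) (theta r) = (a == 0)%:R.
  by move=> Wr; rewrite dotDr dotZr Erho// Erhox// mulr0 addr0.
have xitheta r : W r -> dot (xi r) (theta r) = 2 * mu r.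
  by move=> Wr; rewrite dotDr dotZr xirho// xirhox// mulr1 add0r.
have dtheta r : W r -> differentiable theta r by exact: smooth_diff.
have DEtheta r v b : W r -> dot (mD (E b) r v) (theta r) =
    4 * mu r * bil (h r) v (e1 r) * (b == 0)%:R.
  move=> Wr; rewrite dot_expand//; last exact: dE.
  have Ea a : dot (mD (E b) r (e a r)) (theta r) =
      c r a b 0 + 2 * mu r * (a == b)%:R.
    rewrite (sEE b r a Wr) sum3.
    have := Etheta r 0 Wr; have := Etheta r 1 Wr; have := Etheta r 2 Wr.
    have := xitheta r Wr; move: (E 0 r) (E 1 r) (E 2 r) (xi r) => z0 z1 z2 z3.
    by rewrite !dotDl !dotZl => -> -> -> -> /=; ring.
  under eq_bigr do rewrite Ea.
  rewrite sum3 -[e1 r]/(e 0 r).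
  move: (bil _ _ _) (bil _ _ _) (bil _ _ _) => t0 t1 t2.
  case: (ord3P b) => -> /=; rewrite ?c000// ?c100// ?c200// ?c010// ?c110// ?c210//
    ?c020// ?c120// ?c220//; ring.
have Dmuv r v : W r -> 2 * sD mu r v = - bil (h r) v (e1 r) * (lam r + 8 * mu r ^+ 2).
  move=> Wr; have [D1 D2] := Dmu r Wr.
  have dmr := dmu r Wr.
  rewrite (sD_expand v dmr Wr) sum3 D1 D2 (lamE r Wr) -[e1 r]/(e 0 r).
  by ring.
have Dxitheta r v : W r -> dot (mD xi r v) (theta r) = - bil (h r) v (e1 r) * lam r.
  move=> Wr; rewrite dot_expand//; last exact: normal_diff.
  under eq_bigr do rewrite (Dxi r _ Wr) dotZl (Etheta r 0 Wr).
  rewrite sum3 /= -[e1 r]/(e 0 r); ring.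
have NE q : N q = xi q - (2 * mu q) *: mD x q (e1 q) by rewrite /N frame_vecE.
have NfE : N = fun q => xi q - (2 * mu q) *: mD x q (e1 q) by apply/funext.
exists theta => /=; split=> //.
- move=> r v Wr.
  have -> : (fun q => mD x q (e1 q)) = E 0.
    by apply/funext => q; rewrite frame_vecE.
  rewrite DE0//; congr (_ *: _); rewrite -[e1 r]/(e 0 r) -frame_vecE /N.
  move: (E 0 r) (xi r) => z0 z1.
  by apply/matrixP => i j; rewrite !mxE; ring.
- move=> r v Wr; apply/eqP; rewrite -subr_eq0; apply/eqP.
  have dth := dtheta r Wr.
  apply: (Eonto r _ Wr) => [a|].
    rewrite -scaleNr dotDr dotZr Etheta//.
    have := sD_dot v (dE a r Wr) dth.
    have -> : sD (fun q => dot (E a q) (theta q)) r v = 0.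
      have := @sD_ext _ _ (fun q => dot (E a q) (theta q)) (fun=> (a == 0)%:R)
        W r v oW Wr.
      by rewrite sD_cst; apply=> q Wq; exact: Etheta.
    rewrite DEtheta//.
    move: (dot _ _) (bil _ _ _) => y t.
    by case: (a == 0) => /=; lra.
  rewrite -scaleNr dotDr dotZr xitheta//.
  have := sD_dot v (normal_diff Wr) dth.
  have -> : sD (fun q => dot (xi q) (theta q)) r v = 2 * sD mu r v.
    rewrite -sDZ; last exact: dmu.
    by apply: (sD_ext _ oW Wr) => q Wq; exact: xitheta.
  rewrite Dxitheta// Dmuv//.
  by move: (dot _ _) (bil _ _ _) => y t; lra.
- move=> r Wr; split=> [v||z Ez].
  + rewrite dot_expand//; last exact: immersion_diff.
    under eq_bigr do rewrite -frame_vecE (Etheta r _ Wr).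
    by rewrite sum3 /= mulr1 !mulr0 !addr0.
  + by rewrite -NE /N dotDl dotNl dotZl (Etheta r 0 Wr) xitheta// mulr1 subrr.
  + by apply: Eonto => // a; rewrite frame_vecE.
Qed.

(** For [mu2 = 0] the tensor no longer distinguishes directions in the leaf. The frame-free form is
    the one applicable to coordinate fields, which are not orthonormal. *)
Lemma K_leaf r v w : W r -> mu2 r = 0 -> bil (h r) v (e1 r) = 0 ->
  bil (h r) w (e1 r) = 0 -> K r v w = (- mu r * bil (h r) v w) *: e1 r.
Proof.
move=> Wr mu20 v0 w0.
have hvw : bil (h r) v w = bil (h r) v (e2 r) * bil (h r) w (e2 r) +
    bil (h r) v (e3 r) * bil (h r) w (e3 r).
  rewrite {1}(frame_expand w Wr) sum3 !bilDr !bilZr /= v0; ring.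
rewrite hvw {1}(frame_expand v Wr) {1}(frame_expand w Wr) !sum3 /K /=.
rewrite (K_lincomb (af Wr) (K_form Wr)) row_frame_mx v0 w0 mu20.
rewrite -[e2 r]/(e 1 r) -[e3 r]/(e 2 r).
move: (bil _ v (e 1 r)) (bil _ v (e 2 r)) (bil _ w (e 1 r)) (bil _ w (e 2 r)).
move: (e1 r) (e 1 r) (e 2 r) => f1 f2 f3 t1 t2 t3 t4.
by apply/rowP => j; rewrite !mxE /=; ring.
Qed.

End frame.

(** * Affine coordinates adapted to the leaves *)

(** What is retained from the frame computation. It does not mention the non-canonical fields [e2],
    [e3], and [tau] stands for pairing with [e1]; the last field says that a covector is determined
    by its values on tangent vectors and on [xi]. *)
Record leafwise (R : realType) (W : set 'rV[R]_3) (x xi : 'rV[R]_3 -> 'rV[R]_4)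
    (tau : 'rV[R]_3 -> 'rV[R]_3 -> R) (e1 : 'rV[R]_3 -> 'rV[R]_3)
    (mu : 'rV[R]_3 -> R) (theta : 'rV[R]_3 -> 'cV[R]_4) : Prop := Leafwise {
  lw_open : open W;
  lw_x : smooth_on W x;
  lw_xi : smooth_on W xi;
  lw_e1 : smooth_on W e1;
  lw_mu : smooth_on W mu;
  lw_theta : smooth_on W theta;
  lw_mu0 : forall r, W r -> mu r != 0;
  lw_unit : forall r, W r -> tau r (e1 r) = 1;
  lw_N : forall r v, W r ->
    mD (fun q => xi q - (2 * mu q) *: mD x q (e1 q)) r v =
    (- 2 * mu r * tau r v) *: (xi r - (2 * mu r) *: mD x r (e1 r));
  lw_E : forall r v, W r -> mD (fun q => mD x q (e1 q)) r v =
    tau r v *: ((4 * mu r) *: mD x r (e1 r) +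
                (xi r - (2 * mu r) *: mD x r (e1 r)));
  lw_Dtheta : forall r v, W r ->
    mD theta r v = (- 4 * mu r * tau r v) *: theta r;
  lw_tau : forall r v, W r -> dot (mD x r v) (theta r) = tau r v;
  lw_Ntheta : forall r, W r ->
    dot (xi r - (2 * mu r) *: mD x r (e1 r)) (theta r) = 0;
  lw_sep : forall r z, W r -> (forall v, dot (mD x r v) z = 0) ->
    dot (xi r) z = 0 -> z = 0
}.

(* In the linear coordinates given by [L] the line spanned by [xi - 2 mu E] is
   the third axis, [E] lies in the plane of the last two axes, and the tangent
   plane of the leaf through [q] lies in the kernel of the last coordinate. *)
Record adapted_at (R : realType) (L : 'M[R]_4) (E N : 'rV[R]_4)
    (Dx DE : 'rV[R]_3 -> 'rV[R]_4) : Prop := AdaptedAt {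
  ad_N0 : (N *m L) 0 0 = 0;
  ad_N1 : (N *m L) 0 1 = 0;
  ad_N3 : (N *m L) 0 3 = 0;
  ad_N2 : (N *m L) 0 2 != 0;
  ad_E0 : (E *m L) 0 0 = 0;
  ad_E1 : (E *m L) 0 1 = 0;
  ad_E3 : (E *m L) 0 3 * (N *m L) 0 2 ^+ 2 = 1;
  ad_x : forall v, DE v = 0 -> (Dx v *m L) 0 3 = 0
}.

Lemma ball_sD0_const (R : realType) n (g : 'rV[R]_n -> R) q r :
  (forall p, ball q r p -> differentiable g p) ->
  (forall p v, ball q r p -> sD g p v = 0) ->
  forall a b, ball q r a -> ball q r b -> g a = g b.
Proof. Transparent sD. exact: ball_derive0_const. Opaque sD. Qed.

Lemma sDV (R : realType) n (g : 'rV[R]_n -> R) p v :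
  g p != 0 -> differentiable g p ->
  sD (fun q => (g q)^-1) p v = - (g p)^-1 * (g p)^-1 * sD g p v.
Proof.
Transparent sD. move=> g0 dg; apply: etrans (deriveV g0 (diff_derivable dg)) _.
by rewrite expr2 invfM mulNr. Opaque sD.
Qed.

(** Two solutions of the same equation [du = a u] have constant quotient. The conclusion is
    cross-multiplied so that zeros of [f] can be propagated from one point to another. *)
Lemma ball_proportional (R : realType) n (f g : 'rV[R]_n -> R)
    (a : 'rV[R]_n -> 'rV[R]_n -> R) q r :
  (forall p, ball q r p -> differentiable f p) ->
  (forall p, ball q r p -> differentiable g p) ->
  (forall p, ball q r p -> g p != 0) ->
  (forall p v, ball q r p -> sD f p v = a p v * f p) ->
  (forall p v, ball q r p -> sD g p v = a p v * g p) ->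
  forall p p', ball q r p -> ball q r p' -> f p * g p' = f p' * g p.
Proof.
move=> df dg g0 Df Dg p p' qp qp'.
have dV b : ball q r b -> differentiable (fun q => (g q)^-1) b.
  by move=> qb; apply: differentiableV; [exact: dg|exact: g0].
have E : f p * (g p)^-1 = f p' * (g p')^-1.
  apply: (@ball_sD0_const _ _ (fun q => f q * (g q)^-1) q r) => // [b qb|b v qb].
    by apply: differentiableM; [exact: df|exact: dV].
  rewrite sDM; [|exact: df|exact: dV].
  rewrite sDV; [|exact: g0|exact: dg].
  by rewrite Df// Dg//; field; exact: g0.
have gp := g0 p qp; have gp' := g0 p' qp'.
have := congr1 (fun z => z * (g p * g p')) E.
have -> : f p * (g p)^-1 * (g p * g p') = f p * g p' by field.
by have -> : f p' * (g p')^-1 * (g p * g p') = f p' * g p by field.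
Qed.

Lemma sum4 (V : nmodType) (F : 'I_4 -> V) : \sum_i F i = F 0 + F 1 + F 2 + F 3.
Proof.
rewrite !big_ord_recl big_ord0 addr0 !addrA.
by congr (_ + F _ + F _ + F _); exact: val_inj.
Qed.

Lemma ord4P (i : 'I_4) : [\/ i = 0, i = 1, i = 2 | i = 3].
Proof.
by case: i => [[|[|[|[|//]]]] ?];
  [apply: Or41|apply: Or42|apply: Or43|apply: Or44]; exact: val_inj.
Qed.

Section leafwise_local.
Variables (R : realType) (W : set 'rV[R]_3) (x xi : 'rV[R]_3 -> 'rV[R]_4).
Variables (tau : 'rV[R]_3 -> 'rV[R]_3 -> R) (e1 : 'rV[R]_3 -> 'rV[R]_3).
Variables (mu : 'rV[R]_3 -> R) (theta : 'rV[R]_3 -> 'cV[R]_4).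
Hypothesis lw : leafwise W x xi tau e1 mu theta.
Variable L : 'M[R]_4.
Hypothesis uL : L \in unitmx.

Definition lwE q : 'rV[R]_4 := mD x q (e1 q).
Definition lwN q : 'rV[R]_4 := xi q - (2 * mu q) *: lwE q.
Local Notation E := lwE.
Local Notation N := lwN.

Definition adapted q : Prop := adapted_at L (E q) (N q) (mD x q) (mD E q).

Lemma lwE_smooth : smooth_on W E.
Proof.
exact: mD_smooth_field (lw_open lw) (lw_e1 lw) (lw_x lw).
Qed.

Lemma lwN_smooth : smooth_on W N.
Proof.
move=> k; apply: CkD; [exact: lw_open lw|exact: (lw_xi lw k)|].
apply: CkN; first exact: lw_open lw.
apply: Ck_scale; [exact: lw_open lw| |exact: lwE_smooth].
by apply: CkM; [exact: lw_open lw|exact: Ck_cst|exact: (lw_mu lw k)].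
Qed.

(** If [N] vanished, [xi] would be tangent, and a covector killing the three tangent rows would be
    zero by [lw_sep]; but three rows in dimension 4 always have a nonzero annihilator. *)
Lemma lwN_neq0 q : W q -> N q != 0.
Proof.
move=> Wq; apply/negP => /eqP N0; have mu0 := lw_mu0 lw Wq.
have xiE : xi q = (2 * mu q) *: E q by apply/subr0_eq.
have z0 (z : 'cV[R]_4) : (forall v, dot (mD x q v) z = 0) -> z = 0.
  by move=> zv; apply: (lw_sep lw Wq zv); rewrite xiE dotZl zv mulr0.
pose A := \matrix_(i < 3) mD x q (delta_mx 0 i).
have /rowV0Pn[u] : kermx A^T != 0.
  rewrite kermx_eq0 -row_leq_rank -ltnNge.
  by rewrite (leq_ltn_trans (rank_leq_col _)).
move=> /sub_kermxP uA u0; move: u0; apply/negP; rewrite negbK.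
have uT : u^T = 0.
  apply: z0 => v; have dx := smooth_diff (lw_x lw) Wq.
  have Dv : mD x q v = v *m A.
    rewrite [in RHS](row_sum_delta v) mulmx_suml.
    have -> : mD x q v = \sum_i v 0 i *: mD x q (delta_mx 0 i).
      Transparent mD. exact: derive_row. Opaque mD.
    apply: eq_bigr => i _; apply: etrans (scalemxAl _ _ _).
    by congr (_ *: _); rewrite -rowE; apply/esym; exact: rowK.
  by rewrite /dot Dv -mulmxA -[A]trmxK -trmx_mul uA trmx0 mulmx0 mxE.
by rewrite -[u]trmxK uT trmx0.
Qed.

Lemma coord_diff (f : 'rV[R]_3 -> 'rV[R]_4) q j : smooth_on W f -> W q ->
  differentiable (fun p => (f p *m L) 0 j : R) q.
Proof.
move=> sf Wq; have df := smooth_diff sf Wq.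
exact: (differentiable_mxP _ _).1 (differentiableMx df (differentiable_cst L q)) 0 j.
Qed.

Lemma coord_sD (f : 'rV[R]_3 -> 'rV[R]_4) q j v : smooth_on W f -> W q ->
  sD (fun p => (f p *m L) 0 j) q v = (mD f q v *m L) 0 j.
Proof.
move=> sf Wq; have df := smooth_diff sf Wq.
have dfL := differentiableMx df (differentiable_cst L q).
rewrite -(mD_entry v 0 j dfL); congr ((_ : 'M[R]_(1, 4)) 0 j).
Transparent mD.
apply: etrans (deriveMx v df (differentiable_cst L q)) _.
have -> : 'D_v (cst L) q = 0 by exact: derive_cst.
by rewrite mulmx0 addr0.
Opaque mD.
Qed.

Lemma lwEE q : E q = mD x q (e1 q). Proof. by []. Qed.

Lemma lw_xiE q : xi q = N q + (2 * mu q) *: E q.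
Proof. by rewrite /lwN subrK. Qed.

Lemma lwDN r v : W r -> mD N r v = (- 2 * mu r * tau r v) *: N r.
Proof. exact: (lw_N lw). Qed.

Lemma lwDE r v : W r -> mD E r v = tau r v *: ((4 * mu r) *: E r + N r).
Proof. exact: (lw_E lw). Qed.

Lemma lwE_theta r : W r -> dot (E r) (theta r) = 1.
Proof. by move=> Wr; apply: etrans (lw_tau lw _ Wr) (lw_unit lw Wr). Qed.

Lemma lwN_theta r : W r -> dot (N r) (theta r) = 0.
Proof. exact: (lw_Ntheta lw). Qed.

Opaque lwE lwN.

Section on_ball.
Variables (q0 : 'rV[R]_3) (r0 : R).
Hypothesis BW : ball q0 r0 `<=` W.

(** All coordinates of [N] solve one and the same linear equation. Their squares are therefore
    proportional to the sum of all the squares, which never vanishes, so the coordinates that are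
    zero at [q] are exactly those that are zero at [r]. *)
Lemma adapted_N q r : ball q0 r0 q -> ball q0 r0 r -> adapted q ->
  [/\ (N r *m L) 0 0 = 0, (N r *m L) 0 1 = 0, (N r *m L) 0 3 = 0 &
      (N r *m L) 0 2 != 0].
Proof.
move=> Bq Br ad; pose f j p := (N p *m L) 0 j; pose g p := \sum_j f j p * f j p.
have Wb p : ball q0 r0 p -> W p := @BW p.
have df j p : ball q0 r0 p -> differentiable (f j) p.
  by move=> Bp; apply: coord_diff; [exact: lwN_smooth|exact: Wb].
have dff j p : ball q0 r0 p -> differentiable (fun p => f j p * f j p) p.
  by move=> Bp; apply: differentiableM; exact: df.
have Df j p v : ball q0 r0 p -> sD (f j) p v = - 2 * mu p * tau p v * f j p.
  move=> Bp; have Wp := Wb p Bp; rewrite (coord_sD j v lwN_smooth Wp).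
  rewrite (lwDN v Wp).
  by rewrite -scalemxAl mxE.
have Dff j p v : ball q0 r0 p -> sD (fun p => f j p * f j p) p v =
    - 4 * mu p * tau p v * (f j p * f j p).
  by move=> Bp; rewrite sDM; [rewrite Df//; ring|exact: df|exact: df].
have gE : g = fun p => f 0 p * f 0 p + f 1 p * f 1 p + f 2 p * f 2 p + f 3 p * f 3 p.
  by apply/funext => p; rewrite /g sum4.
have sDD (u w : 'rV[R]_3 -> R) p v : differentiable u p -> differentiable w p ->
    sD (fun q => u q + w q) p v = sD u p v + sD w p v.
  Transparent sD. by move=> du dw; apply: deriveD; exact: diff_derivable. Opaque sD.
have dg p : ball q0 r0 p -> differentiable g p.
  move=> Bp; rewrite gE; do 3?apply: differentiableD; exact: dff.
have Dg p v : ball q0 r0 p -> sD g p v = - 4 * mu p * tau p v * g p.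
  move=> Bp; rewrite gE.
  rewrite sDD; [|do 2?apply: differentiableD; exact: dff|exact: dff].
  rewrite sDD; [|apply: differentiableD; exact: dff|exact: dff].
  rewrite sDD; [|exact: dff|exact: dff].
  by rewrite !Dff//; ring.
have g0 p : ball q0 r0 p -> g p != 0.
  move=> Bp; apply/negP => /eqP; rewrite /g => /eqP.
  rewrite psumr_eq0 => [/allP fj0|j _]; last by rewrite -expr2 sqr_ge0.
  have := lwN_neq0 (Wb p Bp); apply/negP; rewrite negbK.
  apply/eqP; apply: (can_inj (mulmxK uL)); rewrite mul0mx.
  apply/rowP => j; have := fj0 j (mem_index_enum j).
  by rewrite /= -expr2 sqrf_eq0 => /eqP; rewrite /f => ->; rewrite mxE.
have prop j := ball_proportional (dff j) dg g0 (Dff j) Dg Bq Br.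
have z j : f j q = 0 -> f j r = 0.
  move=> fq; have := prop j; rewrite fq mul0r mul0r => /esym/eqP.
  by rewrite mulf_eq0 (negbTE (g0 q Bq)) orbF mulf_eq0 orbb => /eqP.
have nz j : f j q != 0 -> f j r != 0.
  move=> fq; apply/negP => /eqP fr; have := prop j; rewrite fr !mul0r => /eqP.
  by rewrite mulf_eq0 (negbTE (g0 r Br)) orbF mulf_eq0 orbb (negbTE fq).
case: ad => a0 a1 a3 a2 _ _ _ _.
by split; [exact: z a0|exact: z a1|exact: z a3|exact: nz a2].
Qed.

(** Subtracting [tau q v *: e1 q] from [v] leaves a direction tangent to the leaf, on which the last
    coordinate vanishes. *)
Lemma adapted_tau q v : W q -> adapted q ->
  (mD x q v *m L) 0 3 = tau q v * (E q *m L) 0 3.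
Proof.
move=> Wq ad; have dx := smooth_diff (lw_x lw) Wq.
have L1 := mD_lincomb (- tau q v) (e1 q) v dx.
have tw : tau q (- tau q v *: e1 q + v) = 0.
  apply: etrans (esym (lw_tau lw _ Wq)) _; rewrite L1 dotDl dotZl -lwEE.
  by rewrite (lwE_theta Wq) (lw_tau lw v Wq) mulr1 addNr.
have Ew : mD E q (- tau q v *: e1 q + v) = 0 by rewrite lwDE// tw scale0r.
have := ad_x ad Ew; rewrite L1 -lwEE; move: (mD x q v) (E q) (tau q v) => y z t.
rewrite mulmxDl mxE -scalemxAl mxE => /eqP.
by rewrite addrC mulNr subr_eq0 => /eqP.
Qed.

(** Pairing [dE] with [theta] gives [4 mu tau]. The leaf directions are thus the kernel of [dE], and
    this is why [adapted_at] can describe them without the metric. *)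
Lemma lw_tau0 q v : W q -> mD E q v = 0 -> tau q v = 0.
Proof.
move=> Wq Ev; have := lwDE v Wq; rewrite Ev => /esym E0.
have := congr1 (fun z => dot z (theta q)) E0.
rewrite dotZl dotDl dotZl (lwN_theta Wq) (lwE_theta Wq) addr0 mulr1.
rewrite /dot mul0mx mxE => /eqP; rewrite !mulf_eq0 (negbTE (lw_mu0 lw Wq)).
by rewrite pnatr_eq0 !orbF => /eqP.
Qed.

(** Both covectors kill [N] and the leaf directions and agree on [E]; [lw_sep] makes them equal. *)
Lemma adapted_theta q : W q -> adapted q ->
  theta q = ((E q *m L) 0 3)^-1 *: col 3 L.
Proof.
move=> Wq ad; have e30 : (E q *m L) 0 3 != 0.
  by apply/negP => /eqP e30; have := ad_E3 ad; rewrite e30 mul0r => /esym/eqP;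
    rewrite oner_eq0.
have dotL y : dot y (col 3 L) = (y *m L) 0 3.
  by rewrite /dot -[in RHS](mulmx1 L) !mxE; apply: eq_bigr => l _; rewrite mulmx1 !mxE.
have dotB y b : dot y (theta q - b *: col 3 L) = dot y (theta q) - b * (y *m L) 0 3.
  by rewrite dotDr -scaleNr dotZr dotL mulNr.
apply: subr0_eq; apply: (lw_sep lw Wq) => [v|]; rewrite dotB.
  move: (adapted_tau v Wq ad) (lw_tau lw v Wq) e30.
  move: (mD x q v) (E q) => y z -> -> e30.
  by rewrite mulrCA mulVf// mulr1 subrr.
have [nth eth n3] := And3 (lwN_theta Wq) (lwE_theta Wq) (ad_N3 ad).
rewrite lw_xiE; move: (N q) (E q) nth eth n3 e30 => y z nth eth n3 e30.
have coordD b : ((y + b *: z) *m L) 0 3 = (y *m L) 0 3 + b * (z *m L) 0 3.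
  by rewrite mulmxDl mxE -scalemxAl [X in _ + X]mxE.
by rewrite dotDl dotZl nth eth coordD n3 !add0r mulr1; field.
Qed.

(** Let [n] be the third coordinate of [N]. Where a coordinate [j] of [N] vanishes identically, the
    function [E_j * n ^ 2] is constant; [theta] is proportional to [n ^ 2]. These conserved
    quantities carry each condition from [q] to [r]. *)
Lemma adapted_ball q r : ball q0 r0 q -> ball q0 r0 r -> adapted q -> adapted r.
Proof.
move=> Bq Br ad; have Wb p : ball q0 r0 p -> W p := @BW p.
pose n p := (N p *m L) 0 2; pose g p := n p * n p.
have Nb b : ball q0 r0 b -> _ := fun Bb => adapted_N Bq Bb ad.
have dn b : ball q0 r0 b -> differentiable n b.
  by move=> Bb; apply: coord_diff; [exact: lwN_smooth|exact: Wb].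
have dg b : ball q0 r0 b -> differentiable g b.
  by move=> Bb; apply: differentiableM; exact: dn.
have Dg b v : ball q0 r0 b -> sD g b v = - 4 * mu b * tau b v * g b.
  move=> Bb; have Wp := Wb b Bb; rewrite sDM; [|exact: dn|exact: dn].
  have -> : sD n b v = - 2 * mu b * tau b v * n b.
    rewrite (coord_sD 2 v lwN_smooth Wp).
    rewrite (lwDN v Wp).
    by rewrite -scalemxAl mxE.
  by rewrite /g; ring.
have g0 b : ball q0 r0 b -> g b != 0.
  by move=> Bb; have [_ _ _ n0] := Nb b Bb; rewrite mulf_neq0.
pose f j p := (E p *m L) 0 j.
have df j b : ball q0 r0 b -> differentiable (f j) b.
  by move=> Bb; apply: coord_diff; [exact: lwE_smooth|exact: Wb].
have Ec j : (forall b, ball q0 r0 b -> (N b *m L) 0 j = 0) -> f j q * g q = f j r * g r.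
  move=> Nj; apply: (@ball_sD0_const _ _ (fun p => f j p * g p) q0 r0) => // [b
    Bb|b v Bb].
    by apply: differentiableM; [exact: df|exact: dg].
  rewrite sDM; [|exact: df|exact: dg]; rewrite Dg//.
  have Wp := Wb b Bb; rewrite (coord_sD j v lwE_smooth Wp).
  rewrite (lwDE v Wp).
  rewrite -scalemxAl mxE mulmxDl mxE (Nj b Bb) -scalemxAl mxE -/(f j b); ring.
have E0 : f 0 q * g q = f 0 r * g r by apply: Ec => b /Nb[].
have E1 : f 1 q * g q = f 1 r * g r by apply: Ec => b /Nb[].
have E3 : f 3 q * g q = f 3 r * g r by apply: Ec => b /Nb[].
have th i : theta q i 0 * g r = theta r i 0 * g q.
  have dth b : ball q0 r0 b -> differentiable theta b.
    by move=> Bb; exact: smooth_diff (lw_theta lw) (Wb b Bb).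
  apply: (@ball_proportional _ _ (fun p => theta p i 0 : R) g
    (fun b v => - 4 * mu b * tau b v) q0 r0 _ dg g0 _ Dg q r Bq Br) => [b Bb|b v Bb].
    exact: (differentiable_mxP theta b).1 (dth b Bb) i 0.
  by rewrite -(mD_entry _ _ _ (dth b Bb)) (lw_Dtheta lw v (Wb b Bb)) mxE.
have [n0 n1 n3 n2] := Nb r Br.
have Ez (a b c d : R) : a * c = b * d -> d != 0 -> a = 0 -> b = 0.
  move=> E' d0 a0; apply/eqP; move/eqP: E'.
  by rewrite a0 mul0r eq_sym mulf_eq0 (negbTE d0) orbF.
apply: AdaptedAt.
- exact: n0.
- exact: n1.
- exact: n3.
- exact: n2.
- exact: (Ez _ _ _ _ E0 (g0 r Br) (ad_E0 ad)).
- exact: (Ez _ _ _ _ E1 (g0 r Br) (ad_E1 ad)).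
- by rewrite expr2; apply: etrans (esym E3) _; rewrite /g -expr2; exact: ad_E3 ad.
- move=> v Ev; have t0 := lw_tau0 (Wb r Br) Ev.
  have thE := adapted_theta (Wb q Bq) ad.
  have e30 : (E q *m L) 0 3 != 0.
    by apply/negP => /eqP e30; have := ad_E3 ad; rewrite e30 mul0r =>
      /esym/eqP; rewrite oner_eq0.
  (* The last column of [L] is a multiple of [theta] at [q], hence of [theta] at [r], so it kills
     the leaf through [r] as well. *)
  have cE : col 3 L = ((E q *m L) 0 3 * g q / g r) *: theta r.
    have aux (e l gr gq t : R) : e != 0 -> gr != 0 ->
        e^-1 * l * gr = t * gq -> l = e * gq / gr * t.
      move=> e0 gr0 E'; have -> : l = e * (e^-1 * l * gr) / gr.
        by field; rewrite e0 gr0.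
      by rewrite E'; ring.
    have colE' i : (col 3 L) i 0 = L i 3 by rewrite mxE.
    have sclE (b : R) (z : 'cV[R]_4) i : (b *: z) i 0 = b * z i 0 by rewrite mxE.
    apply/colP => i; have := th i; rewrite thE !sclE colE'.
    exact: aux e30 (g0 r Br).
  have -> : (mD x r v *m L) 0 3 = dot (mD x r v) (col 3 L).
    by rewrite /dot !mxE; apply: eq_bigr => l _; rewrite !mxE.
  by rewrite cE dotZr (lw_tau lw v (Wb r Br)) t0 mulr0.
Qed.

End on_ball.
End leafwise_local.

(** * Graphs and separation of variables *)

Lemma unitmx_inj (R : realType) n (A : 'M[R]_n) :
  (forall v : 'rV[R]_n, v *m A = 0 -> v = 0) -> A \in unitmx.
Proof.
move=> Ainj; rewrite -row_free_unit -kermx_eq0; apply/eqP/row_matrixP => i.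
by rewrite row0; apply: Ainj; apply/sub_kermxP; exact: row_sub.
Qed.

Lemma ord2P (i : 'I_2) : i = 0 \/ i = 1.
Proof. by case: i => [[|[|//]] ?]; [left|right]; exact: val_inj. Qed.

Lemma sum2 (V : nmodType) (F : 'I_2 -> V) : \sum_i F i = F 0 + F 1.
Proof.
by rewrite !big_ord_recl big_ord0 addr0; congr (_ + F _); exact: val_inj.
Qed.

Lemma det2 (R : comNzRingType) (A : 'M[R]_2) :
  \det A = A 0 0 * A 1 1 - A 0 1 * A 1 0.
Proof.
rewrite (expand_det_row _ 0) sum2 /cofactor !det_mx11 !mxE /=.
rewrite expr0 expr1 mul1r mulN1r mulrN.
by congr (_ * A _ _ - _ * A _ _); exact: val_inj.
Qed.

Definition embed (R : realType) (t : R) (w : 'rV[R]_2) : 'rV[R]_3 :=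
  vec 3 [:: t; w 0 0; w 0 1].

(** The matrix of the inclusion [(u, v) |-> (0, u, v)]. *)
Definition shift2 (R : realType) : 'M[R]_(2, 3) :=
  \matrix_(i, j) (i.+1 == j :> nat)%:R.

Lemma embedE (R : realType) (t : R) (w : 'rV[R]_2) :
  embed t w = t *: delta_mx 0 0 + w *m shift2 R.
Proof.
apply/rowP => j; rewrite !mxE sum2 !mxE.
by case: (ord3P j) => -> /=; rewrite ?mulr1 ?mulr0 ?addr0 ?add0r.
Qed.

Lemma delta_shift2 (R : realType) (i : 'I_2) :
  (delta_mx 0 i : 'rV[R]_2) *m shift2 R = delta_mx 0 (lift ord0 i).
Proof.
rewrite -rowE; apply/rowP => j; rewrite !mxE eqxx /=; congr (_%:R).
by rewrite -val_eqE /= eq_sym.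
Qed.

(** The norm on rows is the maximum norm, so a ball is itself the product of an interval and a
    planar ball. Product domains are therefore obtained by shrinking to balls. *)
Lemma ball_embed (R : realType) (c : 'rV[R]_3) (d : R) t (w : 'rV[R]_2) :
  ball c d (embed t w) <->
  ball (c 0 0) d t /\ ball (vec 2 [:: c 0 1; c 0 2]) d w.
Proof.
split=> [[d0 cd]|[ct [d0 cw]]].
  split; first by have := cd 0 0; rewrite !mxE.
  split=> // i j; rewrite (ord1 i) !mxE.
  by case: (ord2P j) => -> /=; [have := cd 0 1|have := cd 0 2]; rewrite !mxE.
split=> // i j; rewrite (ord1 i) !mxE; case: (ord3P j) => -> //=.
  by have := cw 0 0; rewrite !mxE.
by have := cw 0 1; rewrite !mxE.
Qed.

Lemma embed_smooth (R : realType) (t : R) (D : set 'rV[R]_2) : open D ->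
  smooth_on D (embed t).
Proof.
move=> oD k.
have C : Ck_on k D (fun w : 'rV[R]_2 => t *: delta_mx 0 0 + w *m shift2 R).
  apply: CkD => //; first exact: Ck_cst.
  by apply: Ck_mulmx => //; [exact: Ck_id|exact: Ck_cst].
by apply: Ck_ext C => // w _; rewrite embedE.
Qed.

Lemma sD_embed (R : realType) (g : 'rV[R]_3 -> R) t (w v : 'rV[R]_2) :
  differentiable g (embed t w) ->
  sD (fun w => g (embed t w)) w v = sD g (embed t w) (v *m shift2 R).
Proof.
Transparent sD mD. move=> dg.
have de : differentiable (embed t) w := smooth_diff (embed_smooth t openT) (I : setT w).
apply: etrans (derive_comp_row v de dg) _; congr ('D__ g _).
have frame_rowE : embed t = fun w : 'rV[R]_2 => t *: delta_mx 0 0 + w *m shift2 R.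
  by apply/funext => ?; exact: embedE.
have did : differentiable (@id 'rV[R]_2) w by [].
have d1 := differentiableMx did (differentiable_cst (shift2 R) w).
have E1 : mD (fun w : 'rV[R]_2 => w *m shift2 R) w v = v *m shift2 R.
  apply: etrans (deriveMx v did (differentiable_cst (shift2 R) w)) _.
  have -> : 'D_v (cst (shift2 R)) w = 0 by exact: derive_cst.
  by rewrite mulmx0 addr0; congr (_ *m _); exact: derive_id.
rewrite frame_rowE; apply: etrans (mDD v (differentiable_cst (t *: delta_mx 0 0
  : 'rV[R]_3) w) d1) _.
by rewrite E1 mD_cst add0r.
Opaque sD mD.
Qed.

Lemma derive_embed (R : realType) (W : normedModType R) (g : 'rV[R]_3 -> W)
    (t v : R) (w : 'rV[R]_2) :
  differentiable g (embed t w) ->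
  differentiable (fun t => g (embed t w)) t /\
  'D_v (fun t => g (embed t w)) t = 'D_(v *: delta_mx 0 0) g (embed t w).
Proof.
move=> dg; have frame_rowE : (fun t => embed t w) =
    fun t : R => t *: (delta_mx 0 0 : 'rV[R]_3) + w *m shift2 R.
  by apply/funext => ?; exact: embedE.
have de : is_diff t (fun t => embed t w) (fun s : R => s *: (delta_mx 0 0 : 'rV[R]_3)).
  by rewrite frame_rowE; apply: is_diff_eq; rewrite addr0.
have det : differentiable (fun t => embed t w) t by case: de.
split; first exact: (differentiable_comp det dg).
apply: etrans (derive_comp_row v det dg) _; congr ('D__ g _).
by rewrite deriveE// diff_val.
Qed.

(** Vanishing mixed derivatives make the [t]-derivative of [phi] independent of [w]; the difference
    of [phi] at [w] and [w'] then has zero derivative in [t]. *)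
Lemma separate_variables (R : realType) (phi : 'rV[R]_3 -> R) (c : 'rV[R]_3)
    (d : R) : smooth_on (ball c d) phi ->
  (forall z (i : 'I_2), ball c d z ->
     sD (fun z => sD phi z (delta_mx 0 0)) z (delta_mx 0 (lift ord0 i)) = 0) ->
  forall t t' w w', ball (c 0 0) d t -> ball (c 0 0) d t' ->
    ball (vec 2 [:: c 0 1; c 0 2]) d w -> ball (vec 2 [:: c 0 1; c 0 2]) d w' ->
  phi (embed t w) - phi (embed t w') = phi (embed t' w) - phi (embed t' w').
Proof.
move=> sphi Dphi t t' w w' ct ct' cw cw'.
have oB : open (ball c d) by exact: ball_open.
have spsi : smooth_on (ball c d) (fun z => sD phi z (delta_mx 0 0)).
  Transparent sD. exact: smooth_derive. Opaque sD.
have Be s y : ball (c 0 0) d s -> ball (vec 2 [:: c 0 1; c 0 2]) d y ->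
    ball c d (embed s y) by move=> *; apply/ball_embed.
have psi_w s : ball (c 0 0) d s ->
    sD phi (embed s w) (delta_mx 0 0) = sD phi (embed s w') (delta_mx 0 0).
  move=> cs.
  apply: (@ball_sD0_const _ _ (fun y => sD phi (embed s y) (delta_mx 0 0))
     (vec 2 [:: c 0 1; c 0 2]) d) => // [y cy|y v cy].
    have dpsi := smooth_diff spsi (Be _ _ cs cy).
    have de := smooth_diff (embed_smooth s openT) (I : setT y).
    exact: (differentiable_comp de dpsi).
  have dpsi := smooth_diff spsi (Be _ _ cs cy).
  rewrite (sD_embed v dpsi) (row_sum_delta v) mulmx_suml sum2.
  rewrite -!scalemxAl !delta_shift2 -[X in _ + X]addr0 sD_lincomb// sD_lincomb//.
  have S0 : sD (fun z => sD phi z (delta_mx 0 0)) (embed s y) 0 = 0.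
    by have := sD_lincomb 1 0 0 dpsi; rewrite !scale1r addr0; lra.
  by rewrite S0 !Dphi// ?mulr0 ?addr0//; exact: Be.
apply: (@ball_derive0_const R R (fun s => phi (embed s w) - phi (embed s w'))
  (c 0 0) d) => // [s cs|s v cs].
  by apply: differentiableB; apply: (derive_embed 1 _).1;
    exact: (smooth_diff sphi (Be _ _ cs _)).
have [d1 D1] := derive_embed v (smooth_diff sphi (Be _ _ cs cw)).
have [d2 D2] := derive_embed v (smooth_diff sphi (Be _ _ cs cw')).
apply: etrans (deriveB (diff_derivable d1) (diff_derivable d2)) _.
rewrite D1 D2.
have Z u : ball (vec 2 [:: c 0 1; c 0 2]) d u ->
  'D_(v *: delta_mx 0 0) phi (embed s u) = v * sD phi (embed s u) (delta_mx 0 0).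
  move=> cu.
  Transparent sD.
  exact: (deriveZv _ _ (smooth_diff sphi (Be _ _ cs cu))).
  Opaque sD.
by rewrite !Z// psi_w// subrr.
Qed.

Lemma det3 (R : comNzRingType) (A : 'M[R]_3) : \det A =
  A 0 0 * (A 1 1 * A 2 2 - A 1 2 * A 2 1) -
  A 0 1 * (A 1 0 * A 2 2 - A 1 2 * A 2 0) +
  A 0 2 * (A 1 0 * A 2 1 - A 1 1 * A 2 0).
Proof.
have l00 : lift (0 : 'I_3) (0 : 'I_2) = 1 by exact: val_inj.
have l01 : lift (0 : 'I_3) (1 : 'I_2) = 2 by exact: val_inj.
have l10 : lift (1 : 'I_3) (0 : 'I_2) = 0 by exact: val_inj.
have l11 : lift (1 : 'I_3) (1 : 'I_2) = 2 by exact: val_inj.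
have l20 : lift (2 : 'I_3) (0 : 'I_2) = 0 by exact: val_inj.
have l21 : lift (2 : 'I_3) (1 : 'I_2) = 1 by exact: val_inj.
rewrite (expand_det_row _ 0) sum3 /cofactor !det2 !mxE.
rewrite l00 l01 l10 l11 l20 l21 /= !add0n expr0 expr1 sqrrN expr1n.
by rewrite !mul1r mulN1r mulrN.
Qed.

Lemma sD_expand2 (R : realType) (f : 'rV[R]_2 -> R) w v : differentiable f w ->
  sD f w v = v 0 0 * sD f w (delta_mx 0 0) + v 0 1 * sD f w (delta_mx 0 1).
Proof.
move=> df; have S0 : sD f w 0 = 0.
  by have := sD_lincomb 1 0 0 df; rewrite !scale1r addr0; lra.
rewrite {1}(row_sum_delta v) sum2 -[X in _ + X]addr0.
apply: etrans (sD_lincomb _ _ _ df) _; congr (_ + _).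
by apply: etrans (sD_lincomb _ _ _ df) _; rewrite S0 addr0.
Qed.

Definition hessian2 (R : realType) (f : 'rV[R]_2 -> R) (w : 'rV[R]_2) : 'M[R]_2 :=
  \matrix_(i, j) sD (fun y => sD f y (delta_mx 0 j)) w (delta_mx 0 i).

Lemma smooth_sD (R : realType) n (W : set 'rV[R]_n) (f : 'rV[R]_n -> R) v :
  smooth_on W f -> smooth_on W (fun y => sD f y v).
Proof. Transparent sD. exact: smooth_derive. Opaque sD. Qed.

Lemma hessian2E (R : realType) (D : set 'rV[R]_2) (f : 'rV[R]_2 -> R) w u v :
  open D -> smooth_on D f -> D w ->
  sD (fun y => sD f y v) w u = bil (hessian2 f w) u v.
Proof.
move=> oD sf Dw; have df y : D y -> differentiable f y by exact: smooth_diff.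
have dD j : differentiable (fun y => sD f y (delta_mx 0 j)) w.
  exact: smooth_diff (smooth_sD (delta_mx 0 j) sf) Dw.
have -> : sD (fun y => sD f y v) w u = sD (fun y => v 0 0 * sD f y (delta_mx 0 0) +
    v 0 1 * sD f y (delta_mx 0 1)) w u.
  by apply: (sD_ext _ oD Dw) => y Dy; exact: sD_expand2 (df y Dy).
have sDD (a b : 'rV[R]_2 -> R) : differentiable a w -> differentiable b w ->
    sD (fun q => a q + b q) w u = sD a w u + sD b w u.
  Transparent sD. by move=> da db; apply: deriveD; exact: diff_derivable. Opaque sD.
have dZ (b : R) j : differentiable (fun y => b * sD f y (delta_mx 0 j)) w.
  exact: differentiableZ.
have E (b : R) j : sD (fun y => b * sD f y (delta_mx 0 j)) w u =
    b * (u 0 0 * hessian2 f w 0 j + u 0 1 * hessian2 f w 1 j).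
  by rewrite (sDZ b u (dD j)) (sD_expand2 u (dD j)) /hessian2 !mxE.
rewrite (sDD _ _ (dZ _ 0) (dZ _ 1)) (E _ 0) (E _ 1).
move: (hessian2 f w) => H.
rewrite /bil !mxE sum2 !mxE !sum2; ring.
Qed.

Lemma mD_field (R : realType) n m (U : set 'rV[R]_n)
    (Y : 'rV[R]_n -> 'rV[R]_n) (x : 'rV[R]_n -> 'rV[R]_m) p v :
  open U -> smooth_on U x -> U p -> differentiable Y p ->
  mD (fun q => mD x q (Y q)) p v =
  mD x p (mD Y p v) + mD (fun q => mD x q (Y p)) p v.
Proof. Transparent mD. exact: derive_field. Opaque mD. Qed.

(** * Graphs with unit Hessian determinant *)

Section graph.
Variables (R : realType) (D : set 'rV[R]_2) (f : 'rV[R]_2 -> R).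
Hypothesis oD : open D.
Hypothesis sf : smooth_on D f.

Lemma graph_smooth : smooth_on D (graph f).
Proof.
move=> k; apply/Ck_mxP => // i j; case: (ord3P j) => ->.
- by apply: Ck_ext (Ck_coord k D 0 0) => // w _; rewrite mxE.
- by apply: Ck_ext (Ck_coord k D 0 1) => // w _; rewrite mxE.
- by apply: Ck_ext (sf k) => // w _; rewrite mxE.
Qed.

Lemma mD_graph w v : D w ->
  mD (graph f) w v = vec 3 [:: v 0 0; v 0 1; sD f w v].
Proof.
move=> Dw; have dg := smooth_diff graph_smooth Dw.
have Dc j : sD (fun y : 'rV[R]_2 => y 0 j) w v = v 0 j.
  have did : differentiable (@id 'rV[R]_2) w by [].
  rewrite -(mD_entry v 0 j did); congr ((_ : 'rV[R]_2) 0 j).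
  Transparent mD. exact: derive_id. Opaque mD.
apply/rowP => j; rewrite (mD_entry _ _ _ dg) [RHS]mxE; case: (ord3P j) => -> /=.
- apply: etrans (Dc 0); apply: (sD_ext _ oD Dw) => y _; exact: mxE.
- apply: etrans (Dc 1); apply: (sD_ext _ oD Dw) => y _; exact: mxE.
- by apply: (sD_ext _ oD Dw) => y _; exact: mxE.
Qed.

(** With the transversal field [(0, 0, 1)] the induced connection of a graph is the flat one of the
    plane, the affine metric is the Hessian and the shape operator is zero. The volume condition
    reduces to the hypothesis on the determinant. *)
Lemma graph_improper : (forall w, D w -> `|\det (hessian2 f w)| = 1) ->
  improper_affine_sphere D (graph f) (vec 3 [:: 0; 0; 1]).
Proof.
move=> detH; exists (hessian2 f), (fun=> 0), (fun p v Y => mD Y p v).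
Transparent mD.
split.
- exact: graph_smooth.
- move=> p v Dp; rewrite -/(mD _ _ _) mD_graph// => /rowP E; apply/rowP => j.
  by have := E 0; have := E 1; rewrite !mxE /=; case: (ord2P j) => ->.
- by move=> k; exact: Ck_cst.
- move=> p v Dp; rewrite -/(mD _ _ _) mD_graph// => /rowP E.
  have v0 : v = 0.
    apply/rowP => j; have := E 0; have := E 1; rewrite !mxE /=.
    by case: (ord2P j) => ->.
  have := E 2; rewrite v0 !mxE /=.
  have df := smooth_diff sf Dp.
  have -> : sD f p 0 = 0 by have := sD_lincomb 1 0 0 df; rewrite !scale1r addr0; lra.
  by move/eqP; rewrite oner_eq0.
- move=> p v Y Dp sY; rewrite -!/(mD _ _ _).
  apply: etrans (mD_field v oD graph_smooth Dp (smooth_at_diff sY)) _.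
  congr (_ + _); have dg := smooth_diff (smooth_derive (Y p) graph_smooth) Dp.
  apply/rowP => j; rewrite (mD_entry _ _ _ dg) [RHS]mxE mxE.
  case: (ord3P j) => -> /=; rewrite ?mulr0 ?mulr1.
  + apply: etrans (@sD_ext _ _ _ (fun=> Y p 0 0) D p v oD Dp _) (sD_cst _ _ _) => q Dq.
    by rewrite -/(mD _ _ _) mD_graph// mxE.
  + apply: etrans (@sD_ext _ _ _ (fun=> Y p 0 1) D p v oD Dp _) (sD_cst _ _ _) => q Dq.
    by rewrite -/(mD _ _ _) mD_graph// mxE.
  + rewrite -(hessian2E v (Y p) oD sf Dp); apply: (sD_ext _ oD Dp) => q Dq.
    by rewrite -/(mD _ _ _) mD_graph// mxE.
- move=> p v Dp; rewrite mulmx0.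
  have -> : 'D_0 (graph f) p = 0 by exact: derive0.
  by rewrite oppr0; exact: derive_cst.
- by move=> p Dp; rewrite -normr_gt0 detH.
(* The rows of [A] are the vectors [X i]; both sides of the volume condition become [|\det A|]. *)
- move=> p X Dp; pose A : 'M[R]_2 := \matrix_(i, j) X i 0 j.
  have -> : (\matrix_(i, j) bil (hessian2 f p) (X i) (X j)) = A *m hessian2 f p *m A^T.
    have rA i : X i = row i A by apply/rowP => j; rewrite !mxE.
    apply/matrixP => i j; rewrite mxE /bil (rA i) (rA j) -!row_mul !mxE.
    by apply: eq_bigr => l _; rewrite !mxE.
  rewrite !det_mulmx det_tr mulrAC normrM detH// mulr1 -expr2 ger0_norm ?sqr_ge0//.
  rewrite sqrtr_sqr.
  pose M : 'M[R]_(1 + 2, 3) := col_mx (vec 3 [:: 0; 0; 1])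
    (\matrix_(i < 2) 'D_(X i) (graph f) p).
  change (`|\det (M : 'M[R]_3)| = `|\det A|); rewrite det3 det2.
  have r0 j : M 0 j = [:: 0; 0; 1]`_j.
    have -> : M 0 j = M (lshift 2 (0 : 'I_1)) j by congr (M _ j); exact: val_inj.
    by rewrite /M; apply: etrans (col_mxEu _ _ _ _) _; rewrite mxE.
  have rS (i : 'I_2) j : M (lift ord0 i) j = [:: X i 0 0; X i 0 1; sD f p (X i)]`_j.
    have -> : M (lift ord0 i) j = M (rshift 1 i) j by congr (M _ j); exact: val_inj.
    rewrite /M; apply: etrans (col_mxEd _ _ _ _) _; rewrite mxE.
    by rewrite -/(mD _ _ _) mD_graph// mxE.
  have r1 := rS 0; have r2 := rS 1.
  have l1 : lift ord0 (0 : 'I_2) = 1 :> 'I_3 by exact: val_inj.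
  have l2 : lift ord0 (1 : 'I_2) = 2 :> 'I_3 by exact: val_inj.
  rewrite l1 in r1; rewrite l2 in r2; rewrite !r0 !r1 !r2 /= !mxE.
  by congr (`|_|); ring.
Opaque mD.
Qed.

End graph.

(** * Quadratic graphs *)

Definition has_sD (R : realType) n (f : 'rV[R]_n -> R) w v d :=
  differentiable f w /\ sD f w v = d.

Section has_sD.
Variables (R : realType) (n : nat).
Implicit Types (f g : 'rV[R]_n -> R) (w v : 'rV[R]_n).

Lemma has_sD_cst (a : R) w v : has_sD (fun=> a) w v 0.
Proof. by split; [exact: differentiable_cst|exact: sD_cst]. Qed.

Lemma has_sD_coord j w v : has_sD (fun y : 'rV[R]_n => y 0 j) w v (v 0 j).
Proof.
split; first exact: differentiable_coord.
have did : differentiable (@id 'rV[R]_n) w by [].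
rewrite -(mD_entry v 0 j did); congr ((_ : 'rV[R]_n) 0 j).
Transparent mD. exact: derive_id. Opaque mD.
Qed.

Lemma has_sDD f g w v a b : has_sD f w v a -> has_sD g w v b ->
  has_sD (fun y => f y + g y) w v (a + b).
Proof.
move=> [df <-] [dg <-]; split; first exact: differentiableD.
Transparent sD. by apply: deriveD; exact: diff_derivable. Opaque sD.
Qed.

Lemma has_sDB f g w v a b : has_sD f w v a -> has_sD g w v b ->
  has_sD (fun y => f y - g y) w v (a - b).
Proof.
move=> [df <-] [dg <-]; split; first exact: differentiableB.
Transparent sD. by apply: deriveB; exact: diff_derivable. Opaque sD.
Qed.

Lemma has_sDZ f w v (c a : R) : has_sD f w v a ->
  has_sD (fun y => c * f y) w v (c * a).
Proof. by move=> [df <-]; split; [exact: differentiableZ|exact: sDZ]. Qed.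

Lemma has_sDM f g w v a b : has_sD f w v a -> has_sD g w v b ->
  has_sD (fun y => f y * g y) w v (f w * b + g w * a).
Proof. by move=> [df <-] [dg <-]; split; [exact: differentiableM|exact: sDM]. Qed.

End has_sD.

Lemma hessian2_sym (R : realType) (D : set 'rV[R]_2) (f : 'rV[R]_2 -> R) w i j :
  open D -> smooth_on D f -> D w -> hessian2 f w i j = hessian2 f w j i.
Proof.
move=> oD sf Dw; rewrite !mxE.
Transparent sD. exact: (schwarz _ _ oD sf Dw). Opaque sD.
Qed.

(** The Hessian is integrated twice: the partial derivatives of [f] differ from affine functions by
    constants, and then [f] differs from the quadratic polynomial by its value at the centre. *)
Lemma hessian_const_quadratic (R : realType) (f : 'rV[R]_2 -> R) (w0 :
  'rV[R]_2) d (H : 'M[R]_2) :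
  smooth_on (ball w0 d) f -> ball w0 d w0 ->
  (forall w, ball w0 d w -> hessian2 f w = H) ->
  exists l0 l1 : R, forall w, ball w0 d w -> let a := w 0 0 - w0 0 0 in
    let b := w 0 1 - w0 0 1 in
    f w = f w0 + l0 * a + l1 * b + H 0 0 / 2 * (a * a) + H 0 1 * (a * b) +
      H 1 1 / 2 * (b * b).
Proof.
move=> sf Bw0 fH; have oB : open (ball w0 d) by exact: ball_open.
have H10 : H 1 0 = H 0 1 by rewrite -(fH w0 Bw0) (hessian2_sym 1 0 oB sf Bw0).
have has_a w v : has_sD (fun y : 'rV[R]_2 => y 0 0 - w0 0 0) w v (v 0 0).
  by rewrite -[v 0 0]subr0; apply: has_sDB; [exact: has_sD_coord|exact: has_sD_cst].
have has_b w v : has_sD (fun y : 'rV[R]_2 => y 0 1 - w0 0 1) w v (v 0 1).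
  by rewrite -[v 0 1]subr0; apply: has_sDB; [exact: has_sD_coord|exact: has_sD_cst].
pose l j := sD f w0 (delta_mx 0 j).
have fj j w : ball w0 d w -> sD f w (delta_mx 0 j) =
    l j + (H 0 j * (w 0 0 - w0 0 0) + H 1 j * (w 0 1 - w0 0 1)).
  move=> Bw; pose g y := sD f y (delta_mx 0 j) -
    (H 0 j * (y 0 0 - w0 0 0) + H 1 j * (y 0 1 - w0 0 1)).
  have has_g y v : ball w0 d y -> has_sD g y v 0.
    move=> By; have dD : differentiable (fun y => sD f y (delta_mx 0 j)) y.
      exact: smooth_diff (smooth_sD (delta_mx 0 j) sf) By.
    have -> : 0 = (v 0 0 * H 0 j + v 0 1 * H 1 j) -
        (H 0 j * v 0 0 + H 1 j * v 0 1) by ring.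
    apply: has_sDB; last by apply: has_sDD; apply: has_sDZ.
    split=> //; rewrite (sD_expand2 v dD) -(fH y By) /hessian2.
    by rewrite ![in RHS]mxE.
  have : g w = g w0.
    apply: (@ball_sD0_const _ _ g w0 d) => // [y By|y v By].
      by have [] := has_g y 0 By.
    by have [] := has_g y v By.
  rewrite /g !subrr !mulr0 addr0 subr0 => /eqP.
  by rewrite subr_eq => /eqP.
exists (l 0), (l 1) => w Bw /=.
pose q (y : 'rV[R]_2) := l 0 * (y 0 0 - w0 0 0) + l 1 * (y 0 1 - w0 0 1) +
  H 0 0 / 2 * ((y 0 0 - w0 0 0) * (y 0 0 - w0 0 0)) +
  H 0 1 * ((y 0 0 - w0 0 0) * (y 0 1 - w0 0 1)) +
  H 1 1 / 2 * ((y 0 1 - w0 0 1) * (y 0 1 - w0 0 1)).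
have has_q y v := has_sDD (has_sDD (has_sDD (has_sDD
  (has_sDZ (l 0) (has_a y v)) (has_sDZ (l 1) (has_b y v)))
  (has_sDZ (H 0 0 / 2) (has_sDM (has_a y v) (has_a y v))))
  (has_sDZ (H 0 1) (has_sDM (has_a y v) (has_b y v))))
  (has_sDZ (H 1 1 / 2) (has_sDM (has_b y v) (has_b y v))).
have has_f y v : ball w0 d y -> has_sD f y v
    (v 0 0 * sD f y (delta_mx 0 0) + v 0 1 * sD f y (delta_mx 0 1)).
  by move=> By; have df := smooth_diff sf By; split=> //; exact: sD_expand2.
have : f w - q w = f w0 - q w0.
  apply: (@ball_sD0_const _ _ (fun y => f y - q y) w0 d) => // [y By|y v By].
    by have [] := has_sDB (has_f y 0 By) (has_q y 0).
  have [_ E] := has_sDB (has_f y v By) (has_q y v).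
  apply: etrans E _; rewrite (fj 0 y By) (fj 1 y By) H10.
  move: (l 0) (l 1) (H 0 0) (H 0 1) (H 1 1) => l0 l1 h00 h01 h11.
  by move: (y 0 0 - _) (y 0 1 - _) => a b; field.
rewrite /q !subrr; move: (l 0) (l 1) (H 0 0) (H 0 1) (H 1 1) => l0 l1 h00 h01 h11.
move: (w 0 0 - _) (w 0 1 - _) (f w) (f w0) => a b fw fw0 E.
have -> : fw = fw0 + (fw - fw0) by ring.
have -> : fw - fw0 = l0 * a + l1 * b + h00 / 2 * (a * a) + h01 * (a * b) + h11
  / 2 * (b * b).
  by move: E; rewrite !mulr0 !addr0 subr0 => <-; ring.
by ring.
Qed.

(** Completing the square with determinant 1 leaves [h00 / 2 * (a + h01 / h00 * b)^2 + b^2 / (2 *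
    h00)]. With [y0 = k / 2 * (a + h01 / h00 * b)] and [y1 = b / k] this is [s * (y0^2 + y1^2)],
    because [s * k^2 = 2 * h00]. The matrix [P] undoes this substitution and shears in the linear
    terms. *)
Lemma quadratic_elliptic_paraboloid (R : realType) (f : 'rV[R]_2 -> R)
    (D : set 'rV[R]_2) (p q c l0 l1 h00 h01 h11 : R) :
  h00 != 0 -> h00 * h11 - h01 ^+ 2 = 1 ->
  (forall w, D w -> let a := w 0 0 - p in let b := w 0 1 - q in
    f w = c + l0 * a + l1 * b + h00 / 2 * (a * a) + h01 * (a * b) +
      h11 / 2 * (b * b)) ->
  exists2 E, elliptic_paraboloid E & graph f @` D `<=` E.
Proof.
move=> h0 dh fE.
pose s := Num.sg h00; pose k := Num.sqrt (2 * `|h00|).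
have s0 : s != 0 by rewrite sgr_eq0.
have k2 : k ^+ 2 = 2 * `|h00| by rewrite sqr_sqrtr// mulr_ge0.
have k0 : k != 0 by rewrite gt_eqF// sqrtr_gt0 mulr_gt0// normr_gt0.
have sk : s * k ^+ 2 = 2 * h00 by rewrite k2 mulrCA -numEsg.
pose P : 'M[R]_3 := mx3 [:: [:: 2 / k; 0; l0 * 2 / k];
  [:: - (h01 * k / h00); k; l1 * k - l0 * h01 * k / h00]; [:: 0; 0; s]].
pose b0 : 'rV[R]_3 := vec 3 [:: p; q; c].
have uP : P \in unitmx.
  apply: unitmx_inj => v /rowP vP; have := vP 0; have := vP 1; have := vP 2.
  rewrite !mxE !sum3 !mxE /= => v2 v1 v0.
  have v1z : v 0 1 = 0 by apply: (mulIf k0); lra.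
  have v0z : v 0 0 = 0.
    have k20 : 2 / k != 0 by rewrite mulf_neq0// invr_neq0.
    by apply: (mulIf k20); move: v0; rewrite v1z; lra.
  have v2z : v 0 2 = 0 by apply: (mulIf s0); move: v2; rewrite v1z v0z; lra.
  by apply/rowP => j; rewrite mxE; case: (ord3P j) => ->.
exists [set z *m P + b0 | z in range (graph
  (fun y : 'rV[R]_2 => y 0 0 ^+ 2 + y 0 1 ^+ 2))]; first by exists P, b0.
move=> _ [w Dw <-].
pose a := w 0 0 - p; pose b := w 0 1 - q.
pose y : 'rV[R]_2 := vec 2 [:: k / 2 * (a + h01 / h00 * b); b / k].
exists (graph (fun y : 'rV[R]_2 => y 0 0 ^+ 2 + y 0 1 ^+ 2) y); first by exists y.
have h11E : h11 = (1 + h01 ^+ 2) / h00 by rewrite -dh; field.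
apply/rowP => j; rewrite !mxE !sum3 !mxE /=; case: (ord3P j) => -> /=.
- by rewrite /a /b; field; rewrite h0 k0.
- by rewrite /b; field; rewrite h0 k0.
- rewrite (fE w Dw) /= -/a -/b h11E.
  have -> : (k / 2 * (a + h01 / h00 * b)) ^+ 2 + (b / k) ^+ 2 =
    k ^+ 2 / 4 * (a + h01 / h00 * b) ^+ 2 + b ^+ 2 / k ^+ 2 by field; rewrite k0.
  have -> : (k ^+ 2 / 4 * (a + h01 / h00 * b) ^+ 2 + b ^+ 2 / k ^+ 2) * s =
    (s * k ^+ 2) / 4 * (a + h01 / h00 * b) ^+ 2 + b ^+ 2 * s ^+ 2 / (s * k ^+ 2).
    by field; rewrite s0 k0.
  have s2 : s ^+ 2 = 1 by rewrite /s sqr_sg h0.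
  by rewrite sk s2; field; rewrite h0 k0.
Qed.

(** * The local product decomposition *)

Lemma det4_block (R : comNzRingType) (A : 'M[R]_4) :
  A 0 0 = 0 -> A 0 1 = 0 -> A 1 0 = 0 -> A 1 1 = 0 ->
  A 2 0 = 1 -> A 3 0 = 0 -> A 3 1 = 1 ->
  \det A = A 0 2 * A 1 3 - A 0 3 * A 1 2.
Proof.
move=> a00 a01 a10 a11 a20 a30 a31.
have l20 : lift (2 : 'I_4) (0 : 'I_3) = 0 by exact: val_inj.
have l21 : lift (2 : 'I_4) (1 : 'I_3) = 1 by exact: val_inj.
have l22 : lift (2 : 'I_4) (2 : 'I_3) = 3 by exact: val_inj.
have l30 : lift (3 : 'I_4) (0 : 'I_3) = 0 by exact: val_inj.
have l31 : lift (3 : 'I_4) (1 : 'I_3) = 1 by exact: val_inj.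
have l32 : lift (3 : 'I_4) (2 : 'I_3) = 2 by exact: val_inj.
have l00 : lift (0 : 'I_4) (0 : 'I_3) = 1 by exact: val_inj.
have l01 : lift (0 : 'I_4) (1 : 'I_3) = 2 by exact: val_inj.
have l02 : lift (0 : 'I_4) (2 : 'I_3) = 3 by exact: val_inj.
rewrite (expand_det_row _ 0) sum4 a00 a01 !mul0r /cofactor !det3.
have B2 i j : row' 0 (col' 2 A) i j = A (lift 0 i) (lift 2 j) by rewrite !mxE.
have B3 i j : row' 0 (col' 3 A) i j = A (lift 0 i) (lift 3 j) by rewrite !mxE.
rewrite !B2 !B3 !l00 !l01 !l02 !l20 !l21 !l22 !l30 !l31 !l32 a10 a11 a20 a30 a31 /= add0n.
by rewrite -signr_odd /= expr0 -[in X in _ + X]signr_odd /= expr1; ring.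
Qed.

Lemma Ck_idR (R : realType) k (U : set R) : Ck_on k U (@id R).
Proof. by apply: (@Ck_linear _ R R k U idfun) => p; exact: cvg_id. Qed.

Section local_product.
Variables (R : realType) (U W : set 'rV[R]_3) (x xi : 'rV[R]_3 -> 'rV[R]_4).
Variables (h S : 'rV[R]_3 -> 'M[R]_3) (nabla : connection R 3).
Variables (e1 : 'rV[R]_3 -> 'rV[R]_3) (mu : 'rV[R]_3 -> R).
Variables (theta : 'rV[R]_3 -> 'cV[R]_4) (L : 'M[R]_4).
Hypothesis oU : open U.
Hypothesis WU : W `<=` U.
Hypothesis bl : blaschke U x xi h S nabla.
Let tau r v := bil (h r) v (e1 r).
Hypothesis lw : leafwise W x xi tau e1 mu theta.
Hypothesis uL : L \in unitmx.
Local Notation E := (lwE x e1).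
Local Notation N := (lwN x xi e1 mu).
Local Notation adapt := (adapted x xi e1 mu L).

(* The product coordinates (t, u, v). *)
Definition prodmap (q : 'rV[R]_3) : 'rV[R]_3 :=
  vec 3 [:: (x q *m L) 0 3; (x q *m L) 0 0; (x q *m L) 0 1].
Local Notation G := prodmap.

Lemma prodmap_smooth : smooth_on W G.
Proof.
have oW := lw_open lw.
have sxL k : Ck_on k W (fun q => x q *m L).
  by apply: Ck_mulmx => //; [exact: (lw_x lw k)|exact: Ck_cst].
move=> k; apply/(Ck_mxP _ _ oW) => i j; have cx := (Ck_mxP k _ oW).1 (sxL k) 0.
by case: (ord3P j) => ->; [apply: Ck_ext (cx 3)|apply: Ck_ext (cx 0)|apply:
  Ck_ext (cx 1)];
  move=> // q _; rewrite [in RHS]mxE.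
Qed.

Lemma mD_prodmap q v : W q -> mD G q v =
  vec 3 [:: (mD x q v *m L) 0 3; (mD x q v *m L) 0 0; (mD x q v *m L) 0 1].
Proof.
move=> Wq; have dG := smooth_diff prodmap_smooth Wq.
apply/rowP => j; rewrite (mD_entry v 0 j dG) [RHS]mxE.
have oW := lw_open lw.
by case: (ord3P j) => -> /=; rewrite -(coord_sD L _ _ (lw_x lw) Wq);
  apply: (sD_ext _ oW Wq) => p _; rewrite mxE.
Qed.

Lemma adapted_E3 q : adapt q -> (E q *m L) 0 3 != 0.
Proof.
move=> ad; apply/negP => /eqP e30; have := ad_E3 ad.
by rewrite e30 mul0r => /esym/eqP; rewrite oner_eq0.
Qed.

Lemma row4_axis (y n : 'rV[R]_4) : (n *m L) 0 0 = 0 -> (n *m L) 0 1 = 0 ->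
  (n *m L) 0 3 = 0 -> (n *m L) 0 2 != 0 ->
  (y *m L) 0 0 = 0 -> (y *m L) 0 1 = 0 -> (y *m L) 0 3 = 0 ->
  y = ((y *m L) 0 2 / (n *m L) 0 2) *: n.
Proof.
move=> n0 n1 n3 n2 y0 y1 y3; apply: (can_inj (mulmxK uL)).
rewrite -scalemxAl; apply/rowP => j; rewrite [RHS]mxE.
by case: (ord4P j) => ->; rewrite ?y0 ?y1 ?y3 ?n0 ?n1 ?n3 ?mulr0// divfK.
Qed.

Lemma axis_split q v t (c : R) : W q ->
  mD x q v + t *: xi q = c *: N q ->
  v = - (2 * mu q * c) *: e1 q /\ t = c.
Proof.
move=> Wq EN; have Uq := WU Wq; have dx := smooth_diff (lw_x lw) Wq.
have Z : mD x q (- (2 * mu q * c) *: e1 q) = - (2 * mu q * c) *: mD x q (e1 q).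
  Transparent mD. exact: deriveZv. Opaque mD.
have E2 : mD x q v + t *: xi q = mD x q (- (2 * mu q * c) *: e1 q) + c *: xi q.
  apply: etrans EN _; rewrite Z.
  Transparent lwN lwE. rewrite /lwN /lwE. Opaque lwN lwE.
  by rewrite scalerBr scalerA addrC scaleNr [c * _]mulrC.
Transparent mD. exact: (blaschke_split bl Uq E2). Opaque mD.
Qed.

(** The three coordinates that are kept determine a vector of the ambient space up to the direction
    of [N], and no nonzero multiple of [N] is tangent. *)
Lemma prodmap_inj q v : W q -> adapt q -> mD G q v = 0 -> v = 0.
Proof.
move=> Wq ad; rewrite mD_prodmap// => /rowP Z.
have v3 : (mD x q v *m L) 0 3 = 0 by have := Z 0; rewrite !mxE.
have v0 : (mD x q v *m L) 0 0 = 0 by have := Z 1; rewrite !mxE.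
have v1 : (mD x q v *m L) 0 1 = 0 by have := Z 2; rewrite !mxE.
have := row4_axis (ad_N0 ad) (ad_N1 ad) (ad_N3 ad) (ad_N2 ad) v0 v1 v3.
move: (_ / _) => c vN.
have [v_e c0] : v = - (2 * mu q * c) *: e1 q /\ 0 = c.
  by apply: axis_split => //; rewrite scale0r addr0.
by rewrite v_e -c0 mulr0 oppr0 scale0r.
Qed.

Lemma prodmap_jacobian q : W q -> adapt q -> jacobian G q \in unitmx.
Proof.
move=> Wq ad; apply: unitmx_inj => v vG; apply: (prodmap_inj Wq ad).
have dG := smooth_diff prodmap_smooth Wq.
Transparent mD. exact: etrans (deriveEjacobian v dG) vG. Opaque mD.
Qed.

Hypothesis ad : forall q, W q -> adapt q.

(** The coordinate fields of [prodmap]: index 0 is the direction of [t], indices 1 and 2 are those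
    of [u] and [v]. *)
Definition prodfield (i : 'I_3) (q : 'rV[R]_3) : 'rV[R]_3 :=
  delta_mx 0 i *m invmx (jacobian G q).
Local Notation X := prodfield.

Lemma prodfield_smooth i : smooth_on W (X i).
Proof.
have oW := lw_open lw.
move=> k; apply: Ck_mulmx => //; first exact: Ck_cst.
apply: Ck_invmx => //; last exact: (smooth_jacobian oW prodmap_smooth k).
by move=> q Wq; exact: prodmap_jacobian (ad Wq).
Qed.

Lemma mD_prodfield i q : W q -> mD G q (X i q) = delta_mx 0 i.
Proof.
move=> Wq; have dG := smooth_diff prodmap_smooth Wq.
Transparent mD. apply: etrans (deriveEjacobian (X i q) dG) _. Opaque mD.
by rewrite mulmxKV// prodmap_jacobian//; exact: ad.
Qed.

Lemma prodfield_uniq i q v : W q -> mD G q v = delta_mx 0 i -> v = X i q.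
Proof.
move=> Wq vE; apply/eqP; rewrite -subr_eq0; apply/eqP.
apply: (prodmap_inj Wq (ad Wq)); have dG := smooth_diff prodmap_smooth Wq.
rewrite addrC -scaleN1r; apply: etrans (mD_lincomb _ _ _ dG) _.
by rewrite mD_prodfield// vE scaleN1r addNr.
Qed.

Definition prodvec i q : 'rV[R]_4 := mD x q (X i q).
Local Notation Y := prodvec.
Definition height i q : R := (Y i q *m L) 0 2.

Lemma prodvec_smooth i : smooth_on W (Y i).
Proof. exact: mD_smooth_field (lw_open lw) (prodfield_smooth i) (lw_x lw). Qed.

Lemma prodvec_coords i q : W q ->
  [/\ (Y i q *m L) 0 0 = (i == 1)%:R, (Y i q *m L) 0 1 = (i == 2)%:R &
      (Y i q *m L) 0 3 = (i == 0)%:R].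
Proof.
move=> Wq; have := mD_prodfield i Wq; rewrite mD_prodmap// => /rowP Z.
split; [have := Z 1|have := Z 2|have := Z 0]; rewrite !mxE /= ?eqxx /= => ->;
  by rewrite eq_sym.
Qed.

(** All coordinates of the vectors [Y i] other than the third are constant, so their derivatives lie
    on the third axis, which is spanned by [N]. *)
Lemma mD_prodvec i q v : W q ->
  mD (Y i) q v = (sD (height i) q v / (N q *m L) 0 2) *: N q.
Proof.
move=> Wq; have oW := lw_open lw; have aq := ad Wq.
have Z j (c : R) : (forall p, W p -> (Y i p *m L) 0 j = c) ->
    (mD (Y i) q v *m L) 0 j = 0.
  move=> Yc; rewrite -(coord_sD L j v (prodvec_smooth i) Wq).
  by rewrite -(sD_cst c q v); exact: (sD_ext v oW Wq).
rewrite {1}(row4_axis (y := mD (Y i) q v) (ad_N0 aq) (ad_N1 aq) (ad_N3 aq) (ad_N2 aq)).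
- by rewrite -(coord_sD L 2 v (prodvec_smooth i) Wq).
- by apply: (Z _ (i == 1)%:R) => p Wp; have [] := prodvec_coords i Wp.
- by apply: (Z _ (i == 2)%:R) => p Wp; have [] := prodvec_coords i Wp.
- by apply: (Z _ (i == 0)%:R) => p Wp; have [] := prodvec_coords i Wp.
Qed.

(** Comparing the Gauss formula with a derivative along [N = xi - 2 mu E] identifies both parts. The
    second identity says that the second derivatives of the height are [h] times the third
    coordinate of [N]. *)
Lemma prodfield_gauss i q v : W q ->
  nabla q v (X i) = - (2 * mu q * bil (h q) v (X i q)) *: e1 q /\
  sD (height i) q v = (N q *m L) 0 2 * bil (h q) v (X i q).
Proof.
move=> Wq; have n2 := ad_N2 (ad Wq).
have sX := smooth_at_on (lw_open lw) Wq (prodfield_smooth i).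
have GX := mD_gauss v bl (WU Wq) sX.
have := etrans (esym GX) (mD_prodvec i v Wq).
move: (sD _ _ _) => s /(axis_split Wq) [-> E2].
by rewrite E2; split=> //; rewrite mulrC divfK.
Qed.

Lemma prodfield_tau i q : W q ->
  bil (h q) (X i q) (e1 q) = (i == 0)%:R / (E q *m L) 0 3.
Proof.
move=> Wq; have [_ _ Y3] := prodvec_coords i Wq; have e30 := adapted_E3 (ad Wq).
have T : (i == 0)%:R = bil (h q) (X i q) (e1 q) * (E q *m L) 0 3.
  exact: etrans (esym Y3) (adapted_tau lw (X i q) Wq (ad Wq)).
by rewrite T mulfK.
Qed.

Lemma prodfield0 q : W q -> X 0 q = ((E q *m L) 0 3)^-1 *: e1 q.
Proof.
move=> Wq; have aq := ad Wq; have e30 := adapted_E3 aq.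
apply/esym/prodfield_uniq => //; have dG := smooth_diff prodmap_smooth Wq.
have -> : mD G q (((E q *m L) 0 3)^-1 *: e1 q) = ((E q *m L) 0 3)^-1 *: mD G q (e1 q).
  Transparent mD. exact: deriveZv. Opaque mD.
rewrite mD_prodmap// -lwEE (ad_E0 aq) (ad_E1 aq).
move: ((E q *m L) 0 3) e30 => e e30; apply/rowP => j; rewrite !mxE.
by case: (ord3P j) => -> /=; rewrite ?mulr0 ?mulVf.
Qed.

Lemma height0 q : W q -> height 0 q = (E q *m L) 0 2 / (E q *m L) 0 3.
Proof.
move=> Wq; rewrite /height /prodvec prodfield0//.
have dx := smooth_diff (lw_x lw) Wq.
have -> : mD x q (((E q *m L) 0 3)^-1 *: e1 q) = ((E q *m L) 0 3)^-1 *: E q.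
  Transparent mD lwE. exact: deriveZv. Opaque mD lwE.
by rewrite -scalemxAl mxE mulrC.
Qed.

(** [X 0] is a multiple of [e1] and the other two fields are tangent to the leaves. With
    [prodfield_gauss] this orthogonality is the vanishing of the mixed derivatives of the height. *)
Lemma prodfield_metric q i : W q -> i != 0 ->
  [/\ bil (h q) (X 0 q) (X 0 q) = ((E q *m L) 0 3)^-1 ^+ 2,
      bil (h q) (X 0 q) (X i q) = 0 & bil (h q) (X i q) (X 0 q) = 0].
Proof.
move=> Wq i0; have t0 := prodfield_tau 0 Wq; have := prodfield_tau i Wq.
rewrite (negbTE i0) mul0r => ti.
have hi : bil (h q) (X i q) (X 0 q) = 0 by rewrite [X 0 q]prodfield0// bilZr ti mulr0.
split=> //; last by rewrite (blaschke_hC oU bl _ _ (WU Wq)).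
by rewrite {2}[X 0 q]prodfield0// bilZr t0 mul1r expr2.
Qed.

Definition leaf_gram q : 'M[R]_2 :=
  \matrix_(i, j) bil (h q) (X (lift 0 i) q) (X (lift 0 j) q).

Hypothesis dL : `|\det L| = 1.

Lemma prodfield_gram_det q : W q ->
  \det (\matrix_(i < 3, j < 3) bil (h q) (X i q) (X j q)) =
  ((E q *m L) 0 3)^-1 ^+ 2 * \det (leaf_gram q).
Proof.
move=> Wq; rewrite det3 det2 /leaf_gram.
have l0 : lift 0 (0 : 'I_2) = 1 :> 'I_3 by exact: val_inj.
have l1 : lift 0 (1 : 'I_2) = 2 :> 'I_3 by exact: val_inj.
have n1 : (1 : 'I_3) != 0 by []. have n2 : (2 : 'I_3) != 0 by [].
have [a00 a01 a10] := prodfield_metric Wq n1.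
have [_ a02 a20] := prodfield_metric Wq n2.
move: ((E q *m L) 0 3) a00 => e a00; rewrite !mxE l0 l1 a00 a01 a10 a02 a20.
move: (bil _ (X 1 q) (X 1 q)) (bil _ (X 1 q) (X 2 q)).
by move: (bil _ (X 2 q) (X 1 q)) (bil _ (X 2 q) (X 2 q)) => b c d f; ring.
Qed.

(** The volume condition is evaluated on the coordinate fields. In the coordinates of [L], which
    preserve volume, the rows [xi], [Y 0], [Y 1], [Y 2] have determinant [N2], since the [E2]
    contributions cancel; the Gram determinant splits off the factor belonging to [X 0]. *)
Lemma leaf_gram_det q : W q ->
  `|\det (leaf_gram q)| = (N q *m L) 0 2 ^+ 2 * (E q *m L) 0 3 ^+ 2.
Proof.
move=> Wq; have e30 := adapted_E3 (ad Wq).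
have V := mD_volume (fun i => X i q) bl (WU Wq).
set M := col_mx _ _ in V.
pose A : 'M[R]_4 := (M : 'M[R]_4) *m L.
have dA : `|\det (M : 'M[R]_4)| = `|\det A| by rewrite det_mulmx normrM dL mulr1.
have M0 k : (M : 'M[R]_4) 0 k = xi q 0 k.
  have -> : (0 : 'I_4) = lshift 3 (0 : 'I_1) by exact: val_inj.
  exact: col_mxEu.
have MS (i : 'I_3) k : (M : 'M[R]_4) (lift 0 i) k = Y i q 0 k.
  have -> : lift 0 i = rshift 1 i :> 'I_4 by exact: val_inj.
  by apply: etrans (col_mxEd _ _ _ _) _; rewrite mxE.
have A0 j : A 0 j = (xi q *m L) 0 j.
  by rewrite /A !mxE; apply: eq_bigr => k _; rewrite M0.
have AS (i : 'I_3) j : A (lift 0 i) j = (Y i q *m L) 0 j.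
  by rewrite /A !mxE; apply: eq_bigr => k _; rewrite MS.
have s0 : lift 0 (0 : 'I_3) = 1 :> 'I_4 by exact: val_inj.
have s1 : lift 0 (1 : 'I_3) = 2 :> 'I_4 by exact: val_inj.
have s2 : lift 0 (2 : 'I_3) = 3 :> 'I_4 by exact: val_inj.
have [A1 A2 A3] := And3 (AS 0) (AS 1) (AS 2).
rewrite s0 in A1; rewrite s1 in A2; rewrite s2 in A3.
have [Y00 Y01 Y03] := prodvec_coords 0 Wq.
have [Y10 Y11 Y13] := prodvec_coords 1 Wq.
have [Y20 Y21 Y23] := prodvec_coords 2 Wq.
have aq := ad Wq.
have xiL j : (xi q *m L) 0 j = (N q *m L) 0 j + 2 * mu q * (E q *m L) 0 j.
  by rewrite (lw_xiE x xi e1 mu) mulmxDl mxE -scalemxAl [X in _ + X]mxE.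
have dAE : \det A = (N q *m L) 0 2.
  have A02 : A 0 2 = (N q *m L) 0 2 + 2 * mu q * (E q *m L) 0 2.
    exact: etrans (A0 2) (xiL 2).
  have A03 : A 0 3 = 2 * mu q * (E q *m L) 0 3.
    by apply: etrans (A0 3) _; rewrite xiL (ad_N3 aq) add0r.
  have A12 : A 1 2 = (E q *m L) 0 2 / (E q *m L) 0 3.
    exact: etrans (A1 2) (height0 Wq).
  have A13 : A 1 3 = 1 by exact: etrans (A1 3) Y03.
  rewrite det4_block.
  - rewrite A02 A03 A12 A13.
    by move: ((E q *m L) 0 2) ((E q *m L) 0 3) e30 => a e e30; field.
  - by rewrite A0 xiL (ad_N0 aq) (ad_E0 aq) mulr0 addr0.
  - by rewrite A0 xiL (ad_N1 aq) (ad_E1 aq) mulr0 addr0.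
  - exact: etrans (A1 0) Y00.
  - exact: etrans (A1 1) Y01.
  - exact: etrans (A2 0) Y10.
  - exact: etrans (A3 0) Y20.
  - exact: etrans (A3 1) Y21.
move: V; rewrite dA dAE prodfield_gram_det//.
move: ((N q *m L) 0 2) ((E q *m L) 0 3) e30 => n e e30 V.
have := congr1 (fun z => z ^+ 2) V; rewrite sqr_sqrtr// normrM real_normK ?num_real//.
by rewrite (ger0_norm (sqr_ge0 _)) => ->; field.
Qed.

(** A factor [N2 ^ 2] from the scaling meets [N2 ^ 2 * E3 ^ 2] from the Gram matrix, and
    [E3 * N2 ^ 2 = 1] was imposed for this purpose. *)
Lemma leaf_hessian_det q : W q ->
  `|\det ((N q *m L) 0 2 *: leaf_gram q)| = 1.
Proof.
move=> Wq; rewrite detZ normrM leaf_gram_det// normrX real_normK ?num_real//.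
rewrite mulrCA; have := ad_E3 (ad Wq).
by move: ((N q *m L) 0 2) ((E q *m L) 0 3) => n e en; rewrite -[RHS](expr1n _
  2) -en; ring.
Qed.

(** The inverse function theorem gives some open image; it is cut down to a ball so as to be a
    product of an interval and a planar domain. *)
Lemma product_chart q0 : W q0 -> exists (V : set 'rV[R]_3)
    (Ginv : 'rV[R]_3 -> 'rV[R]_3) (d : R),
  [/\ open V /\ V q0, V `<=` W, 0 < d,
      (forall p, V p -> ball (G q0) d (G p) /\ Ginv (G p) = p) /\
      (forall z, ball (G q0) d z -> V (Ginv z) /\ G (Ginv z) = z) &
      smooth_on (ball (G q0) d) Ginv].
Proof.
move=> Wq0; have oW := lw_open lw.
have [V [Ginv [[oV Vq0] VW oGV GK sGi]]] := inverse_function oW Wq0 prodmap_smooth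
  (fun p Wp => prodmap_jacobian Wp (ad Wp)).
have /nbhs_ballP[d d0 dGV] : nbhs (G q0) (G @` V).
  by apply: open_nbhs_nbhs; split=> //; exists q0.
have oB : open (ball (G q0) d) by exact: ball_open.
exists (V `&` G @^-1` ball (G q0) d), Ginv, d; split.
- split; last by split=> //; exact: ballxx.
  rewrite openE => p [Vp Bp]; apply: filterI; first exact: open_nbhs_nbhs.
  have dG := smooth_diff prodmap_smooth (VW p Vp).
  by apply: (differentiable_continuous dG); exact: open_nbhs_nbhs.
- by move=> p [Vp _]; exact: VW.
- exact: d0.
- split=> [p [Vp Bp]|z Bz]; first by split=> //; exact: GK.
  have [p Vp Gp] := dGV z Bz; rewrite -Gp GK//; split=> //; split=> //=.
  by rewrite Gp.
- exact: smooth_sub dGV sGi.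
Qed.

(** * The immersion in product coordinates *)

Section product_coordinates.
Variables (Ginv : 'rV[R]_3 -> 'rV[R]_3) (c : 'rV[R]_3) (d : R).
Hypothesis GinvW : forall z, ball c d z -> W (Ginv z) /\ G (Ginv z) = z.
Hypothesis sGinv : smooth_on (ball c d) Ginv.

Definition profile z : R := (x (Ginv z) *m L) 0 2.

Lemma mD_Ginv z i : ball c d z -> mD Ginv z (delta_mx 0 i) = X i (Ginv z).
Proof.
move=> Bz; have [Wz GK] := GinvW Bz.
have oB : open (ball c d) by exact: ball_open.
have dGi := smooth_diff sGinv Bz; have dG := smooth_diff prodmap_smooth Wz.
apply: prodfield_uniq => //.
Transparent mD. apply: etrans (esym (derive_comp_row _ dGi dG)) _. Opaque mD.
apply: etrans (_ : mD (G \o Ginv) z (delta_mx 0 i) = mD id z (delta_mx 0 i)) _.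
  by apply: (mD_ext _ oB Bz) => y By; have [] := GinvW By.
Transparent mD. exact: derive_id. Opaque mD.
Qed.

Lemma sD_Ginv (g : 'rV[R]_3 -> R) z i : ball c d z -> differentiable g (Ginv z) ->
  sD (fun z => g (Ginv z)) z (delta_mx 0 i) = sD g (Ginv z) (X i (Ginv z)).
Proof.
move=> Bz dg; have dGi := smooth_diff sGinv Bz.
rewrite -(mD_Ginv i Bz).
Transparent mD sD. exact: (derive_comp_row _ dGi dg). Opaque mD sD.
Qed.

Lemma profile_smooth : smooth_on (ball c d) profile.
Proof.
have oB : open (ball c d) by exact: ball_open.
have oW := lw_open lw; move=> k.
have sxL : Ck_on k W (fun q => x q *m L).
  by apply: Ck_mulmx => //; [exact: (lw_x lw k)|exact: Ck_cst].
have sx2 : Ck_on k W (fun q => (x q *m L) 0 2 : R).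
  exact: (Ck_mxP k _ oW).1 sxL 0 2.
exact: (Ck_comp oB oW (fun z Bz => (GinvW Bz).1) (sGinv k) sx2).
Qed.

Lemma sD_profile z i : ball c d z ->
  sD profile z (delta_mx 0 i) = height i (Ginv z).
Proof.
move=> Bz; have [Wz _] := GinvW Bz.
have dx := coord_diff L 2 (lw_x lw) Wz.
by apply: etrans (sD_Ginv i Bz dx) _; rewrite (coord_sD L 2 _ (lw_x lw) Wz).
Qed.

Lemma sD2_profile z i j : ball c d z ->
  sD (fun z => sD profile z (delta_mx 0 j)) z (delta_mx 0 i) =
  (N (Ginv z) *m L) 0 2 *
    bil (h (Ginv z)) (X i (Ginv z)) (X j (Ginv z)).
Proof.
move=> Bz; have [Wz _] := GinvW Bz; have oB : open (ball c d) by exact: ball_open.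
apply: etrans (sD_ext _ oB Bz (fun y By => sD_profile j By)) _.
have dh := coord_diff L 2 (prodvec_smooth j) Wz.
apply: etrans (sD_Ginv i Bz dh) _.
exact: (prodfield_gauss j _ Wz).2.
Qed.

Lemma product_coords z : ball c d z ->
  x (Ginv z) *m L = vec 4 [:: z 0 1; z 0 2; profile z; z 0 0].
Proof.
move=> Bz; have [_ GK] := GinvW Bz.
have E3 : (x (Ginv z) *m L) 0 3 = z 0 0 by rewrite -[in RHS]GK [RHS]mxE.
have E0 : (x (Ginv z) *m L) 0 0 = z 0 1 by rewrite -[in RHS]GK [RHS]mxE.
have E1 : (x (Ginv z) *m L) 0 1 = z 0 2 by rewrite -[in RHS]GK [RHS]mxE.
by apply/rowP => j; rewrite [RHS]mxE; case: (ord4P j) => ->.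
Qed.

Lemma profile_split t t' w w' :
  ball (c 0 0) d t -> ball (c 0 0) d t' ->
  ball (vec 2 [:: c 0 1; c 0 2]) d w -> ball (vec 2 [:: c 0 1; c 0 2]) d w' ->
  profile (embed t w) - profile (embed t w') =
  profile (embed t' w) - profile (embed t' w').
Proof.
apply: (separate_variables profile_smooth) => z i Bz.
have [Wz _] := GinvW Bz; have oB : open (ball c d) by exact: ball_open.
have i0 : lift ord0 i != 0 :> 'I_3 by [].
have [_ _ h0] := prodfield_metric Wz i0.
by apply: etrans (sD2_profile _ _ Bz) _; rewrite h0 mulr0.
Qed.

Local Notation D := (ball (vec 2 [:: c 0 1; c 0 2] : 'rV[R]_2) d).
Local Notation I := (ball (c 0 0 : R) d).

Definition leaf_profile (w : 'rV[R]_2) : R := profile (embed (c 0 0) w).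

(** Normalised to vanish at the centre, as the height there is already counted in [leaf_profile]. *)
Definition curve_profile (t : R) : R :=
  profile (embed t (vec 2 [:: c 0 1; c 0 2])) -
  profile (embed (c 0 0) (vec 2 [:: c 0 1; c 0 2])).

Hypothesis d0 : 0 < d.

Let Dc : D (vec 2 [:: c 0 1; c 0 2]). Proof. exact: ballxx. Qed.
Let Ic : I (c 0 0). Proof. exact: ballxx. Qed.
Let embB t w : I t -> D w -> ball c d (embed t w).
Proof. by move=> It Dw; apply/ball_embed. Qed.

Lemma leaf_profile_smooth : smooth_on D leaf_profile.
Proof.
have oD : open D by exact: ball_open.
have oB : open (ball c d) by exact: ball_open.
move=> k; exact: (Ck_comp oD oB (fun w Dw => embB Ic Dw) (embed_smooth (c 0 0) oD k)
  (profile_smooth k)).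
Qed.

Lemma product_formula t w : I t -> D w ->
  x (Ginv (embed t w)) *m L =
  vec 4 [:: w 0 0; w 0 1; leaf_profile w + curve_profile t; t].
Proof.
move=> It Dw; rewrite (product_coords (embB It Dw)).
have P := profile_split It Ic Dw Dc.
have -> : profile (embed t w) = leaf_profile w + curve_profile t.
  rewrite /leaf_profile /curve_profile; move: P.
  by move: (profile (embed t w)) => a P; rewrite addrC -addrA; lra.
by rewrite /embed !mxE.
Qed.

Lemma leaf_hessian w : D w -> let q := Ginv (embed (c 0 0) w) in
  hessian2 leaf_profile w = (N q *m L) 0 2 *: leaf_gram q.
Proof.
move=> Dw q; have oD : open D by exact: ball_open.
have Bw := embB Ic Dw.
have D1 (j : 'I_2) y : D y -> sD leaf_profile y (delta_mx 0 j) =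
    sD profile (embed (c 0 0) y) (delta_mx 0 (lift ord0 j)).
  move=> Dy; have dp := smooth_diff profile_smooth (embB Ic Dy).
  by rewrite -delta_shift2; exact: sD_embed.
apply/matrixP => i j; rewrite mxE.
apply: etrans (sD_ext _ oD Dw (D1 j)) _.
have dp := smooth_diff (smooth_sD (delta_mx 0 (lift ord0 j)) profile_smooth) Bw.
apply: etrans (sD_embed _ dp) _; rewrite delta_shift2 sD2_profile//.
by rewrite [RHS]mxE; congr (_ * _); rewrite mxE.
Qed.

Lemma leaf_improper :
  improper_affine_sphere D (graph leaf_profile) (vec 3 [:: 0; 0; 1]).
Proof.
have oD : open D by exact: ball_open.
apply: (graph_improper oD leaf_profile_smooth) => w Dw.
by rewrite leaf_hessian// leaf_hessian_det//; exact: (GinvW (embB Ic Dw)).1.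
Qed.

Lemma curve_profile_smooth : smooth_on I curve_profile.
Proof.
have oI : open I by exact: ball_open.
have oB : open (ball c d) by exact: ball_open.
move=> k; apply: CkD => //; last exact: Ck_cst.
have se : Ck_on k I (fun t : R => embed t (vec 2 [:: c 0 1; c 0 2])).
  apply/(Ck_mxP _ _ oI) => i j; case: (ord3P j) => ->.
  - by apply: Ck_ext (Ck_idR k I) => // t _; rewrite mxE.
  - by apply: Ck_ext (Ck_cst k I (c 0 1)) => // t _; rewrite !mxE.
  - by apply: Ck_ext (Ck_cst k I (c 0 2)) => // t _; rewrite !mxE.
exact: (Ck_comp oI oB (fun t It => embB It Dc) se (profile_smooth k)).
Qed.

(** With the identity as first component, the nondegeneracy determinant is the second derivative of
    [curve_profile], equal to [N2 / E3 ^ 2]. *)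
Lemma curve_profile_affine : affine_curve I id curve_profile.
Proof.
have oI : open I by exact: ball_open.
split.
- by move=> k; exact: Ck_idR.
- exact: curve_profile_smooth.
move=> t It; set w0 := vec 2 [:: c 0 1; c 0 2].
have D1 s : I s -> derive1 curve_profile s = sD profile (embed s w0) (delta_mx 0 0).
  move=> Is; rewrite derive1E.
  have [di Di] := derive_embed 1 (smooth_diff profile_smooth (embB Is Dc)).
  apply: etrans (deriveB (diff_derivable di) (diff_derivable (differentiable_cst _ _))) _.
  have -> : 'D_1 (cst (profile (embed (c 0 0) w0))) s = 0 by exact: derive_cst.
  rewrite subr0; apply: etrans Di _.
  Transparent sD. by rewrite scale1r. Opaque sD.
have D2 : derive1n 2 curve_profile t =
    sD (fun z => sD profile z (delta_mx 0 0)) (embed t w0) (delta_mx 0 0).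
  have dp := smooth_diff (smooth_sD (delta_mx 0 0) profile_smooth) (embB It Dc).
  have [di Di] := derive_embed 1 dp; rewrite scale1r in Di.
  have N1 : 'D_1 (derive1 curve_profile) t =
      'D_1 (fun s : R => sD profile (embed s w0) (delta_mx 0 0) : R) t.
    apply: near_eq_derive.
    by apply: filterS (open_nbhs_nbhs (conj oI It)) => s Is; exact: D1.
  Transparent sD. exact: etrans (derive1E _ _) (etrans N1 Di). Opaque sD.
have [Wz _] := GinvW (embB It Dc).
have n1 : (1 : 'I_3) != 0 by [].
have [h00 _ _] := prodfield_metric Wz n1.
have d2 : derive1n 2 (id : R -> R) t = 0.
  rewrite derive1nS derive1n1.
  have -> : (id : R -> R)^`()%classic = cst 1 by apply/funext => s; exact: derive1_id.
  exact: derive1_cst.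
have d1 : derive1 (id : R -> R) t = 1 by exact: derive1_id.
have D2n := etrans D2 (etrans (sD2_profile 0 0 (embB It Dc))
  (congr1 (fun b => _ * b) h00)).
have nz := mulf_neq0 (ad_N2 (ad Wz))
  (expf_neq0 2 (invr_neq0 (adapted_E3 (ad Wz)))).
move: nz d1 d2; rewrite -D2n => nz d1 d2.
by rewrite d1 d2 mul1r mul0r subr0.
Qed.

(** * The SO(2) case: constant Hessian on the leaf *)

Variable hnabla : connection R 3.
Hypothesis lc : levi_civita U h hnabla.
Hypothesis sh : smooth_on W h.
Hypothesis h_pos : forall r, W r -> positive_definite (h r).
Hypothesis K_e1 : forall r v w, W r ->
  bil (h r) v (e1 r) = 0 -> bil (h r) w (e1 r) = 0 ->
  difference_tensor nabla hnabla r v w = (- mu r * bil (h r) v w) *: e1 r.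

Let B i j q := bil (h q) (X i q) (X j q).
Let nu q := (N q *m L) 0 2.

(** For leaf fields [nabla] contributes [- 2 mu h e1] and [K] contributes [- mu h e1]. The
    difference has no component in the leaf, so the coordinates [u], [v] are affine for the induced
    metric. *)
Lemma prodfield_hnabla i k q : W q -> i != 0 -> k != 0 ->
  hnabla q (X k q) (X i) = - (mu q * B k i q) *: e1 q.
Proof.
move=> Wq i0 k0; have Uq := WU Wq.
have sX := smooth_at_on (lw_open lw) Wq (prodfield_smooth i).
have tau0 l : l != 0 -> bil (h q) (X l q) (e1 q) = 0.
  by move=> l0; rewrite prodfield_tau// (negbTE l0) mul0r.
have Kki := K_e1 Wq (tau0 k k0) (tau0 i i0).
have [nki _] := prodfield_gauss i (X k q) Wq.
have := nabla_split oU bl lc (X k q) Uq sX; rewrite nki Kki -/(B k i q) => E'.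
have -> : hnabla q (X k q) (X i) =
    - (2 * mu q * B k i q) *: e1 q - (- mu q * B k i q) *: e1 q by rewrite E' addrK.
by rewrite -scalerBl; congr (_ *: _); ring.
Qed.

Lemma gram_diff i j q : W q -> differentiable (B i j) q.
Proof.
move=> Wq; have oW := lw_open lw.
apply: (smooth_diff _ Wq) => k.
have C : Ck_on k W (fun q => X i q *m h q *m (X j q)^T).
  apply: Ck_mulmx => //; last by apply: Ck_tr => //; exact: prodfield_smooth.
  by apply: Ck_mulmx => //; exact: prodfield_smooth.
exact: (Ck_mxP k _ oW).1 C 0 0.
Qed.

(** Metric compatibility pairs leaf fields with [e1], which gives zero, and the coordinate [nu] of
    [N] varies only with [tau], which vanishes on leaf directions. *)
Lemma leaf_gram_const i j k q : W q -> i != 0 -> j != 0 -> k != 0 ->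
  sD (fun q => nu q * B i j q) q (X k q) = 0.
Proof.
move=> Wq i0 j0 k0; have Uq := WU Wq; have oW := lw_open lw.
have sX l := smooth_at_on oW Wq (prodfield_smooth l).
have dn : differentiable nu q := coord_diff L 2 (lwN_smooth lw) Wq.
have tk : bil (h q) (X k q) (e1 q) = 0.
  by rewrite prodfield_tau// (negbTE k0) mul0r.
have e1X l : l != 0 -> bil (h q) (e1 q) (X l q) = 0.
  by move=> l0; rewrite (blaschke_hC oU bl _ _ Uq) prodfield_tau// (negbTE l0) mul0r.
have Dn : sD nu q (X k q) = 0.
  apply: etrans (coord_sD L 2 _ (lwN_smooth lw) Wq) _.
  by rewrite (lwDN lw _ Wq) /tau tk mulr0 scale0r mul0mx mxE.
have DB : sD (B i j) q (X k q) = 0.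
  apply: etrans (levi_civita_mD _ lc Uq (sX i) (sX j)) _.
  rewrite !prodfield_hnabla// bilZl bilZr e1X// (blaschke_hC oU bl (X i q) _ Uq) e1X//.
  by rewrite !mulr0 addr0.
by rewrite (sDM _ dn (gram_diff i j Wq)) Dn DB !mulr0 addr0.
Qed.

Lemma leaf_hessian_const w : D w ->
  hessian2 leaf_profile w = hessian2 leaf_profile (vec 2 [:: c 0 1; c 0 2]).
Proof.
move=> Dw; apply: etrans (leaf_hessian Dw) _.
apply: etrans (_ : _ = _) (esym (leaf_hessian Dc)); apply/matrixP => i j.
have FE q : ((N q *m L) 0 2 *: leaf_gram q) i j =
    nu q * B (lift ord0 i) (lift ord0 j) q.
  by rewrite mxE; congr (_ * _); rewrite mxE.
apply: etrans (FE _) (etrans _ (esym (FE _))).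
pose F z := nu (Ginv z) * B (lift ord0 i) (lift ord0 j) (Ginv z).
have Fd z : ball c d z -> differentiable F z.
  move=> Bz; have [Wz _] := GinvW Bz.
  have dG := smooth_diff sGinv Bz.
  have dn : differentiable nu (Ginv z) := coord_diff L 2 (lwN_smooth lw) Wz.
  have dg := differentiableM dn (gram_diff (lift ord0 i) (lift ord0 j) Wz).
  exact: (differentiable_comp dG dg).
have De y : differentiable (embed (c 0 0)) y :=
  smooth_diff (embed_smooth (c 0 0) openT) (Logic.I : setT y).
apply: (@ball_sD0_const _ _ (fun y => F (embed (c 0 0) y))
   (vec 2 [:: c 0 1; c 0 2]) d) => // [y Dy|y v Dy].
  exact: (differentiable_comp (De y) (Fd _ (embB Ic Dy))).
have By := embB Ic Dy; have [Wy _] := GinvW By.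
have D0 (k : 'I_2) : sD (fun y => F (embed (c 0 0) y)) y (delta_mx 0 k) = 0.
  apply: etrans (sD_embed _ (Fd _ By)) _; rewrite delta_shift2.
  have dn : differentiable nu (Ginv (embed (c 0 0) y)) :=
    coord_diff L 2 (lwN_smooth lw) Wy.
  have dg := differentiableM dn (gram_diff (lift ord0 i) (lift ord0 j) Wy).
  by apply: etrans (sD_Ginv _ By dg) _; exact: leaf_gram_const.
have dF := differentiable_comp (De y) (Fd _ By).
by apply: etrans (sD_expand2 v dF) _; rewrite (D0 0) (D0 1) !mulr0 addr0.
Qed.

Lemma prodfield_neq0 i q : W q -> X i q != 0.
Proof.
move=> Wq; apply/negP => /eqP Xi.
have : delta_mx 0 i = X i q *m jacobian G q.
  by rewrite /prodfield mulmxKV// prodmap_jacobian//; exact: ad.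
rewrite Xi mul0mx => /rowP /(_ i); rewrite !mxE !eqxx /= => /eqP.
by rewrite oner_eq0.
Qed.

Lemma leaf_elliptic_paraboloid :
  exists2 P, elliptic_paraboloid P & graph leaf_profile @` D `<=` P.
Proof.
have [Wq _] := GinvW (embB Ic Dc).
move: (leaf_hessian_const) (leaf_hessian Dc) (leaf_hessian_det Wq).
set w0 := vec 2 _; set q := Ginv _; move=> Hc; set H := hessian2 leaf_profile w0.
move=> HE; rewrite -HE => dH.
have l0 : lift 0 (0 : 'I_2) = 1 :> 'I_3 by exact: val_inj.
have l1 : lift 0 (1 : 'I_2) = 2 :> 'I_3 by exact: val_inj.
have He i j : H i j = nu q * B (lift ord0 i) (lift ord0 j) q.
  by rewrite HE mxE; congr (_ * _); rewrite mxE.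
have H00 : H 0 0 = nu q * B 1 1 q by rewrite He l0.
have H01 : H 0 1 = nu q * B 1 2 q by rewrite He l0 l1.
have H10 : H 1 0 = nu q * B 1 2 q.
  by rewrite He l0 l1 /B (blaschke_hC oU bl _ _ (WU Wq)).
have H11 : H 1 1 = nu q * B 2 2 q by rewrite He l1.
have B11 : 0 < B 1 1 q by apply: h_pos => //; exact: prodfield_neq0.
(* Cauchy-Schwarz: the vector [w] is chosen so that [h(w, w)] is [B 1 1 q] times the Gram
   determinant. *)
have gram0 : 0 <= B 1 1 q * B 2 2 q - B 1 2 q ^+ 2.
  pose w := B 1 2 q *: X 1 q - B 1 1 q *: X 2 q.
  have ww : bil (h q) w w = B 1 1 q * (B 1 1 q * B 2 2 q - B 1 2 q ^+ 2).
    have C21 : bil (h q) (X 2 q) (X 1 q) = B 1 2 q.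
      exact: (blaschke_hC oU bl _ _ (WU Wq)).
    rewrite /w bilDl !bilDr !bilNl !bilNr !bilZl !bilZr C21 -!/(B _ _ q).
    by move: (B 1 1 q) (B 1 2 q) (B 2 2 q) => a b e; ring.
  rewrite -(pmulr_rge0 _ B11) -ww; have [->|w0'] := eqVneq w 0; first by rewrite bil0l.
  exact: ltW (h_pos Wq w0').
(* Positive definiteness makes the determinant of the Hessian nonnegative, so its absolute value 1
   is its value; this excludes the hyperbolic paraboloid. *)
have detH : H 0 0 * H 1 1 - H 0 1 ^+ 2 = 1.
  move: dH; rewrite det2 H00 H01 H10 H11 ger0_norm => [<-|]; first by ring.
  have -> : nu q * B 1 1 q * (nu q * B 2 2 q) - nu q * B 1 2 q * (nu q * B 1 2 q) =
     nu q ^+ 2 * (B 1 1 q * B 2 2 q - B 1 2 q ^+ 2) by ring.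
  by rewrite mulr_ge0// sqr_ge0.
have H0 : H 0 0 != 0.
  by rewrite H00; exact: (mulf_neq0 (ad_N2 (ad Wq)) (lt0r_neq0 B11)).
have [a0 [a1 fE]] := hessian_const_quadratic leaf_profile_smooth Dc Hc.
exact: (quadratic_elliptic_paraboloid H0 detH fE).
Qed.

End product_coordinates.
End local_product.

(** * Charts and connected components *)

Lemma leafwise_sub (R : realType) (W W' : set 'rV[R]_3)
    (x xi : 'rV[R]_3 -> 'rV[R]_4) (tau : 'rV[R]_3 -> 'rV[R]_3 -> R)
    (e1 : 'rV[R]_3 -> 'rV[R]_3) (mu : 'rV[R]_3 -> R)
    (theta : 'rV[R]_3 -> 'cV[R]_4) : open W' -> W' `<=` W ->
  leafwise W x xi tau e1 mu theta -> leafwise W' x xi tau e1 mu theta.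
Proof.
move=> oW' WW [oW sx sxi se sm st m0 u dN dE dt lt nt sep].
apply: Leafwise.
- exact: oW'.
- exact: smooth_sub WW sx.
- exact: smooth_sub WW sxi.
- exact: smooth_sub WW se.
- exact: smooth_sub WW sm.
- exact: smooth_sub WW st.
- by move=> r /WW; exact: m0.
- by move=> r /WW; exact: u.
- by move=> r v /WW; exact: dN.
- by move=> r v /WW; exact: dE.
- by move=> r v /WW; exact: dt.
- by move=> r v /WW; exact: lt.
- by move=> r /WW; exact: nt.
- by move=> r z /WW; exact: sep.
Qed.

Lemma transition_open (R : realType) n (M : topologicalType) (c d : chart R n M) :
  open (transition_dom c d).
Proof.
rewrite openE => q [cq dq]; apply: filterI.
  by apply: open_nbhs_nbhs; split=> //; exact: cimg_open.
apply: (cinv_continuous cq); apply: open_nbhs_nbhs; split=> //.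
exact: cdom_open.
Qed.

Lemma restrict_chart (R : realType) n (M : topologicalType)
    (A : set (chart R n M)) (c : chart R n M) (V B : set 'rV[R]_n)
    (G Ginv : 'rV[R]_n -> 'rV[R]_n) :
  (forall d, A d -> compatible c d) ->
  open V -> V `<=` cimg c -> open B ->
  (forall q, V q -> B (G q) /\ Ginv (G q) = q) ->
  (forall z, B z -> V (Ginv z) /\ G (Ginv z) = z) ->
  smooth_on V G -> smooth_on B Ginv ->
  exists kappa : chart R n M, [/\ admissible A kappa,
    forall p, cdom c p -> V (cto c p) -> cdom kappa p,
    cimg kappa = B & cinv kappa = cinv c \o Ginv].
Proof.
move=> Ac oV Vc oB VB BV sG sGi.
pose D := cdom c `&` cto c @^-1` V.
have oD : open D.
  rewrite openE => p [cp Vp]; apply: filterI.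
    by apply: open_nbhs_nbhs; split=> //; exact: cdom_open.
  by apply: (cto_continuous cp); exact: open_nbhs_nbhs.
have cV q : V q -> cto c (cinv c q) = q by move=> /Vc; exact: cinvK.
have toB p : D p -> B (G (cto c p)) by case=> _ /VB[].
have invD z : B z -> D (cinv c (Ginv z)).
  move=> /BV[Vz _]; split; first by apply: cinv_dom; exact: Vc.
  by rewrite /= cV.
have toK p : D p -> cinv c (Ginv (G (cto c p))) = p.
  by case=> cp /VB[_ ->]; exact: ctoK.
have invK z : B z -> G (cto c (cinv c (Ginv z))) = z.
  by move=> /BV[Vz Gz]; rewrite cV.
have cto_cont p : D p -> {for p, continuous (G \o cto c)}.
  case=> cp Vp; apply: continuous_comp; first exact: cto_continuous.
  exact: differentiable_continuous (smooth_diff sG Vp).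
have cinv_cont z : B z -> {for z, continuous (cinv c \o Ginv)}.
  move=> Bz; have [Vz _] := BV z Bz; apply: continuous_comp.
    exact: differentiable_continuous (smooth_diff sGi Bz).
  exact: cinv_continuous (Vc _ Vz).
pose kappa : chart R n M := @Chart R n M D B (G \o cto c) (cinv c \o Ginv)
  oD oB toB invD toK invK cto_cont cinv_cont.
exists kappa; split=> // d Ad; have [scd sdc] := Ac d Ad; split.
  have oK := @transition_open _ _ _ kappa d.
  have oT := @transition_open _ _ _ c d.
  have KT z : transition_dom kappa d z -> transition_dom c d (Ginv z).
    by move=> [Bz dz]; split=> //; exact: Vc (BV z Bz).1.
  have KB : transition_dom kappa d `<=` B by move=> z [].
  move=> k; exact: (Ck_compmx oK oT KT (smooth_sub KB sGi k) (scd k)).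
have oK := @transition_open _ _ _ d kappa.
have KT : transition_dom d kappa `<=` transition_dom d c.
  by move=> z [dz [cz _]]; split.
have KV z : transition_dom d kappa z -> V (cto c (cinv d z)) by case=> _ [].
move=> k; exact: (Ck_compmx oK oV KV (smooth_sub KT sdc k) (sG k)).
Qed.

(** Local constancy of membership makes both [C] and its complement open, so a connected set through
    [p0] stays in [C]. *)
Lemma connected_clopen (T : topologicalType) (C : set T) (p0 p : T) :
  (forall q, exists2 O : set T, open O /\ O q & forall r, O r -> (C q <-> C r)) ->
  C p0 -> connected_component setT p0 p -> C p.
Proof.
move=> locC Cp0 [B [Bp0 _] cB Bp].
have oC : open C.
  rewrite openE => q Cq; have [Q [oQ Qq] QC] := locC q.
  apply: filterS (open_nbhs_nbhs (conj oQ Qq)) => r Or.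
  by apply/(QC r Or).
have oC' : open (~` C).
  rewrite openE => q Cq; have [Q [oQ Qq] QC] := locC q.
  apply: filterS (open_nbhs_nbhs (conj oQ Qq)) => r Or Cr.
  by apply: Cq; apply/(QC r Or).
have clC : closed C by rewrite -[C]setCK; exact: open_closedC.
have E : B `&` C = B.
  by apply: cB; [exists p0|exists C|exists C].
by rewrite -E in Bp; case: Bp.
Qed.

(* Sends the rows [xi, E1, E2, E3] to [E2, E3, xi - m E1, E1]. *)
Definition adapted_rows (R : realType) (m : R) : 'M[R]_4 :=
  \matrix_(i, j) (nth [::] [:: [:: 0; 0; 1; 0]; [:: 0; 0; 0; 1];
    [:: 1; - m; 0; 0]; [:: 0; 1; 0; 0]] i)`_j.

Lemma adapted_rows_det (R : realType) (m : R) : \det (adapted_rows m) = 1.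
Proof. by rewrite det4_block ?mxE //= ?mxE /=; ring. Qed.

Lemma adapted_rowsE (R : realType) (m : R) (M : 'M[R]_4) (Z := adapted_rows m *m M) :
  [/\ row 0 Z = row 2 M, row 1 Z = row 3 M,
      row 2 Z = row 0 M - m *: row 1 M & row 3 Z = row 1 M].
Proof.
by split; apply/rowP => k; rewrite mxE [in LHS]mxE sum4 ![adapted_rows m _ _]mxE /=
  ?mul0r ?mul1r ?add0r ?addr0 !mxE// mulNr.
Qed.

(** * Choice of affine coordinates at one point *)

Section adapted_start.
Variables (R : realType) (U W : set 'rV[R]_3).
Variables (x xi : 'rV[R]_3 -> 'rV[R]_4) (h S : 'rV[R]_3 -> 'M[R]_3).
Variables (nabla hnabla : connection R 3).
Variables (e1 e2 e3 : 'rV[R]_3 -> 'rV[R]_3) (mu mu2 lam : 'rV[R]_3 -> R).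
Variable theta : 'rV[R]_3 -> 'cV[R]_4.
Hypothesis oU : open U.
Hypothesis WU : W `<=` U.
Hypothesis bl : blaschke U x xi h S nabla.
Hypothesis af : forall r, W r -> adapted_frame_at (h r) (S r)
  (difference_tensor nabla hnabla r) (e1 r) (e2 r) (e3 r) (mu r) (mu2 r) (lam r) 0.
Hypothesis lw : leafwise W x xi (fun r v => bil (h r) v (e1 r)) e1 mu theta.

(** [L] inverts the matrix with rows [dF(e2)], [dF(e3)], [N], [E] at [q], so these vectors become
    the coordinate axes. Orthonormality and the volume condition give determinant 1 up to sign, and
    [E3 = N2 = 1] at [q] gives the normalisation. *)
Lemma adapted_start q : W q -> exists L : 'M[R]_4,
  [/\ L \in unitmx, `|\det L| = 1 & adapted x xi e1 mu L q].
Proof.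
move=> Wq; have dx := smooth_diff (lw_x lw) Wq.
pose X (i : 'I_3) := [:: e1 q; e2 q; e3 q]`_i.
have V := mD_volume X bl (WU Wq).
have [[b11 b22 b33] [b12 b13 b23]] := af_orthonormal (af Wq).
have C := blaschke_hC oU bl _ _ (WU Wq).
have gram1 : \matrix_(i, j) bil (h q) (X i) (X j) = 1%:M.
  apply: matrix3P; rewrite !mxE /X /= ?b11 ?b22 ?b33 ?b12 ?b13 ?b23 //.
  - by rewrite C b12.
  - by rewrite C b13.
  - by rewrite C b23.
rewrite gram1 det1 normr1 sqrtr1 in V.
set M := col_mx _ _ in V.
have M0 k : (M : 'M[R]_4) 0 k = xi q 0 k.
  have -> : (0 : 'I_4) = lshift 3 (0 : 'I_1) by exact: val_inj.
  exact: col_mxEu.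
have MS (i : 'I_3) k : (M : 'M[R]_4) (lift 0 i) k = mD x q (X i) 0 k.
  have -> : lift 0 i = rshift 1 i :> 'I_4 by exact: val_inj.
  by apply: etrans (col_mxEd _ _ _ _) _; rewrite mxE.
pose Z := adapted_rows (2 * mu q) *m (M : 'M[R]_4).
have s0 : lift 0 (0 : 'I_3) = 1 :> 'I_4 by exact: val_inj.
have s1 : lift 0 (1 : 'I_3) = 2 :> 'I_4 by exact: val_inj.
have s2 : lift 0 (2 : 'I_3) = 3 :> 'I_4 by exact: val_inj.
have M0r : row 0 (M : 'M[R]_4) = xi q by apply/rowP => k; rewrite mxE M0.
have M1r : row 1 (M : 'M[R]_4) = mD x q (e1 q) by apply/rowP => k; rewrite mxE -s0 MS.
have M2r : row 2 (M : 'M[R]_4) = mD x q (e2 q) by apply/rowP => k; rewrite mxE -s1 MS.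
have M3r : row 3 (M : 'M[R]_4) = mD x q (e3 q) by apply/rowP => k; rewrite mxE -s2 MS.
have dZ : `|\det Z| = 1 by rewrite det_mulmx adapted_rows_det mul1r.
have uZ : Z \in unitmx by rewrite unitmxE unitfE -normr_gt0 dZ.
exists (invmx Z); split; first by rewrite unitmx_inv.
  by rewrite det_inv normfV dZ invr1.
have [r0 r1 r2 r3] := adapted_rowsE (2 * mu q) (M : 'M[R]_4).
rewrite -/Z M2r in r0; rewrite -/Z M3r in r1; rewrite -/Z M0r M1r in r2.
rewrite -/Z M1r in r3.
Transparent lwN lwE.
have r2' : lwN x xi e1 mu q = row 2 Z := esym r2.
have r3' : lwE x e1 q = row 3 Z := esym r3.
Opaque lwN lwE.
have rZ i j : (row i Z *m invmx Z) 0 j = (i == j)%:R.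
  by rewrite -row_mul mulmxV// mxE mxE.
apply: AdaptedAt; rewrite ?r2' ?r3' ?rZ //=.
- by rewrite expr1n mulr1.
- move=> v Ev; have tv := lw_tau0 lw Wq Ev.
  have := frame_expand oU WU bl af v Wq; rewrite sum3 /= tv scale0r add0r => ->.
  move: (bil _ _ _) (bil _ _ _) => b a.
  have Zb : mD x q (b *: e3 q) = b *: mD x q (e3 q).
    Transparent mD. exact: deriveZv. Opaque mD.
  rewrite (mD_lincomb a _ _ dx) Zb -r0 -r1.
  have r03 : (row 0 Z *m invmx Z) 0 3 = 0 by rewrite rZ.
  have r13 : (row 1 Z *m invmx Z) 0 3 = 0 by rewrite rZ.
  rewrite mulmxDl -!scalemxAl; move: (row 0 Z *m _) (row 1 Z *m _) r03 r13.
  by move=> y z y0 z0; rewrite !mxE y0 z0 !mulr0 addr0.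
Qed.

End adapted_start.

(** * Propagation of adapted coordinates over a component *)

Section symmetric_hypersurface.
Variables (R : realType) (M : topologicalType).
Variables (A : set (chart R 3 M)) (F xi : M -> 'rV[R]_4).
Variables (h S : chart R 3 M -> 'rV[R]_3 -> 'M[R]_3).
Variables (nabla hnabla : chart R 3 M -> connection R 3).
Variables (e1 : chart R 3 M -> 'rV[R]_3 -> 'rV[R]_3) (mu1 a eta : M -> R).
Hypothesis M_manifold : smooth_manifold A.
Hypothesis M_blaschke : forall c, A c ->
  blaschke (cimg c) (F \o cinv c) (xi \o cinv c) (h c) (S c) (nabla c).
Hypothesis M_levi_civita : forall c, A c -> levi_civita (cimg c) (h c) (hnabla c).
Hypothesis M_symmetric : pointwise_symmetry A h S nabla hnabla (@is_SO2 R 3) \/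
  pointwise_symmetry A h S nabla hnabla (@is_Z3 R 3).
Hypothesis M_functions : symmetry_functions A h S nabla hnabla e1 mu1 a eta.
Hypothesis a_eq : forall p, a p = - eta p ^+ 2 + mu1 p ^+ 2.
Hypothesis eta_eq : forall p, eta p = mu1 p.

Definition leafwise_chart (c : chart R 3 M) (W : set 'rV[R]_3)
    (theta : 'rV[R]_3 -> 'cV[R]_4) : Prop :=
  leafwise W (F \o cinv c) (xi \o cinv c)
    (fun r v => bil (h c r) v (e1 c r)) (e1 c) (mu1 \o cinv c) theta.

Definition adapted_chart (L : 'M[R]_4) (c : chart R 3 M) (q : 'rV[R]_3) : Prop :=
  adapted (F \o cinv c) (xi \o cinv c) (e1 c) (mu1 \o cinv c) L q.

Lemma local_leafwise c q : A c -> cimg c q -> exists W theta,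
  [/\ W q /\ W `<=` cimg c, leafwise_chart c W theta, smooth_on W (h c),
      (pointwise_symmetry A h S nabla hnabla (@is_SO2 R 3) ->
       forall r v w, W r -> bil (h c r) v (e1 c r) = 0 ->
         bil (h c r) w (e1 c r) = 0 ->
         difference_tensor (nabla c) (hnabla c) r v w =
         (- mu1 (cinv c r) * bil (h c r) v w) *: e1 c r) &
      exists L : 'M[R]_4, [/\ L \in unitmx, `|\det L| = 1 & adapted_chart L c q]].
Proof.
move=> Ac cq; have [[se1 _] frame etaf] := M_functions.
have [W [e2 [e3 [mu2 [lam [oW Wq WU [s2 s3] af0]]]]]] := frame c q Ac cq.
have oU := @cimg_open _ _ _ c.
have bl := M_blaschke Ac; have lc := M_levi_civita Ac.
have s1 : smooth_on W (e1 c) := smooth_sub WU (se1 c Ac).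
have af r : W r -> adapted_frame_at (h c r) (S c r)
    (difference_tensor (nabla c) (hnabla c) r) (e1 c r) (e2 r) (e3 r)
    ((mu1 \o cinv c) r) (mu2 r) (lam r) 0.
  move=> Wr; have := af0 r Wr.
  by have -> : a (cinv c r) = 0 by rewrite a_eq eta_eq addNr.
have hC r v w : W r -> bil (h c r) v w = bil (h c r) w v.
  by move=> Wr; exact: (blaschke_hC oU bl _ _ (WU r Wr)).
have kf r (Wr : W r) := K_form oU oW WU bl lc s1 s2 s3 af Wr.
have mu0 r : W r -> (mu1 \o cinv c) r != 0.
  move=> Wr; apply: (symmetric_mu_neq0 (af r Wr) (fun v w => hC r v w Wr) (kf r Wr)).
  by case: M_symmetric => G; [left|right]; exact: G Ac (WU r Wr).
have em r v : W r -> bil (h c r) v (e1 c r) = 0 ->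
    hnabla c r v (e1 c) = (mu1 \o cinv c) r *: v.
  by move=> Wr vr; rewrite (etaf c r v Ac (WU r Wr) vr) eta_eq.
have [theta [[sth smu] DN DE Dth fr]] := frame_equations oU oW WU bl lc s1 s2
  s3 af em mu0.
have lw : leafwise_chart c W theta.
  apply: Leafwise.
  - exact: oW.
  - exact: smooth_sub WU (bl_smooth bl).
  - exact: smooth_sub WU (bl_normal_smooth bl).
  - exact: s1.
  - exact: smu.
  - exact: sth.
  - exact: mu0.
  - by move=> r Wr; have [[]] := af_orthonormal (af r Wr).
  - exact: DN.
  - exact: DE.
  - exact: Dth.
  - by move=> r v Wr; have [] := fr r Wr.
  - by move=> r Wr; have [] := fr r Wr.
  - by move=> r z Wr; have [_ _] := fr r Wr; apply.
exists W, theta; split=> //.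
- exact: (metric_smooth oU oW WU bl s1 s2 s3 af).
- move=> SO2 r v w Wr ve we.
  have m20 : mu2 r = 0.
    apply: (SO2_mu2_eq0 (af r Wr) (fun v w => hC r v w Wr) (kf r Wr) (mu0 r Wr)).
    exact: SO2 Ac (WU r Wr).
  exact: (K_leaf oU oW WU bl lc s1 s2 s3 af Wr m20 ve we).
- exact: (adapted_start oU WU bl af lw Wq).
Qed.

(** [E] and [N] are ambient vectors attached to points of [M], the same in both charts. The
    differentials of [F] and [E] change by the same derivative of the transition map, so the
    condition on leaf directions carries over. *)
Lemma adapted_transition L c d p : A c -> A d -> cdom c p -> cdom d p ->
  adapted_chart L d (cto d p) -> adapted_chart L c (cto c p).
Proof.
move=> Ac Ad cp dp; pose q := cto c p; pose q' := cto d p.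
pose T := cto d \o cinv c; pose D := transition_dom c d.
have [[_ fe1] _ _] := M_functions.
have oD : open D by exact: transition_open.
have Dq : D q by split; [exact: cto_img|rewrite /= ctoK].
have Tq : T q = q' by rewrite /T /= ctoK.
have [_ _ _ comp] := M_manifold; have [sT _] := comp c d Ac Ad.
have dT r : D r -> differentiable T r := smooth_diff sT.
have TU r : D r -> cimg d (T r) by case=> _ dr; exact: cto_img.
have TK r : D r -> cinv d (T r) = cinv c r by case=> _ dr; rewrite /T /= ctoK.
have bld := M_blaschke Ad; have oU := @cimg_open _ _ _ d.
have DF r v : D r -> mD (F \o cinv c) r v = mD (F \o cinv d) (T r) (mD T r v).
  move=> Dr.
  have -> : mD (F \o cinv c) r v = mD ((F \o cinv d) \o T) r v.
    by apply: (mD_ext _ oD Dr) => s Ds; rewrite /= -[in LHS](TK s Ds).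
  Transparent mD.
  exact: (derive_comp_row _ (dT r Dr) (smooth_diff (bl_smooth bld) (TU r Dr))).
  Opaque mD.
have eT r : D r -> mD T r (e1 c r) = e1 d (T r).
  Transparent mD. by move=> Dr; apply: esym; exact: fe1. Opaque mD.
have EE r : D r -> lwE (F \o cinv c) (e1 c) r = lwE (F \o cinv d) (e1 d) (T r).
  Transparent lwE. move=> Dr.
  exact: etrans (DF r (e1 c r) Dr) (congr1 (mD (F \o cinv d) (T r)) (eT r Dr)).
  Opaque lwE.
have [[se1 _] _ _] := M_functions.
have sE : smooth_on (cimg d) (lwE (F \o cinv d) (e1 d)).
  exact: (mD_smooth_field oU (se1 d Ad) (bl_smooth bld)).
have DEE v : mD (lwE (F \o cinv c) (e1 c)) q v =
    mD (lwE (F \o cinv d) (e1 d)) q' (mD T q v).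
  have -> : mD (lwE (F \o cinv c) (e1 c)) q v =
      mD (lwE (F \o cinv d) (e1 d) \o T) q v by exact: (mD_ext _ oD Dq).
  rewrite -Tq.
  Transparent mD.
  exact: (derive_comp_row _ (dT q Dq) (smooth_diff sE (TU q Dq))).
  Opaque mD.
have NN : lwN (F \o cinv c) (xi \o cinv c) (e1 c) (mu1 \o cinv c) q =
    lwN (F \o cinv d) (xi \o cinv d) (e1 d) (mu1 \o cinv d) q'.
  Transparent lwN.
  by rewrite /lwN (EE q Dq) Tq /= -(TK q Dq) Tq.
  Opaque lwN.
rewrite /adapted_chart /adapted -/q -/q' (EE q Dq) NN Tq.
move=> ad; apply: AdaptedAt.
- exact: ad_N0 ad.
- exact: ad_N1 ad.
- exact: ad_N3 ad.
- exact: ad_N2 ad.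
- exact: ad_E0 ad.
- exact: ad_E1 ad.
- exact: ad_E3 ad.
- by move=> v; rewrite DEE (DF q v Dq) Tq; exact: (ad_x ad).
Qed.

(** Within a small chart ball adaptedness holds at all points or at none by [adapted_ball], and it
    does not depend on the chart by [adapted_transition]. It is therefore locally constant on
    [M]. *)
Lemma adapted_component L p0 p : L \in unitmx ->
  (exists c, [/\ A c, cdom c p0 & adapted_chart L c (cto c p0)]) ->
  connected_component [set: M] p0 p ->
  forall c, A c -> cdom c p -> adapted_chart L c (cto c p).
Proof.
move=> uL ad0; have [_ _ atlas _] := M_manifold.
pose C := [set p | forall c, A c -> cdom c p -> adapted_chart L c (cto c p)].
apply: (@connected_clopen _ C) => [q|]; last first.
  by have [c [Ac cp ad]] := ad0 => d Ad dp; exact: adapted_transition ad.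
have [c Ac cq] := atlas q.
have [W [theta [[Wq WU] lw _ _ _]]] := local_leafwise Ac (cto_img cq).
have [r r0 BW] : exists2 r : R, 0 < r & ball (cto c q) r `<=` W.
  have /nbhs_ballP[r r0 BW] := open_nbhs_nbhs (conj (lw_open lw) Wq).
  by exists r.
pose Q := cdom c `&` cto c @^-1` ball (cto c q) r.
exists Q.
  split; last by split=> //; exact: ballxx.
  rewrite openE => s [cs Bs]; apply: filterI.
    by apply: open_nbhs_nbhs; split=> //; exact: cdom_open.
  apply: (cto_continuous cs); apply: open_nbhs_nbhs; split=> //.
  exact: ball_open.
move=> s [cs Bs]; have Bq : ball (cto c q) r (cto c q) by exact: ballxx.
split=> Cq d Ad dp.
  apply: (adapted_transition Ad Ac dp cs).
  exact: (adapted_ball lw uL BW Bq Bs (Cq c Ac cq)).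
apply: (adapted_transition Ad Ac dp cq).
exact: (adapted_ball lw uL BW Bs Bq (Cq c Ac cs)).
Qed.

End symmetric_hypersurface.

Theorem theorem5 (R : realType) (M : topologicalType)
    (A : set (chart R 3 M)) (F xi : M -> 'rV[R]_4)
    (h S : chart R 3 M -> 'rV[R]_3 -> 'M[R]_3)
    (nabla hnabla : chart R 3 M -> connection R 3)
    (e1 : chart R 3 M -> 'rV[R]_3 -> 'rV[R]_3) (mu1 a eta : M -> R)
    (M_manifold : smooth_manifold A)
    (M_blaschke : forall c, A c ->
       blaschke (cimg c) (F \o cinv c) (xi \o cinv c) (h c) (S c) (nabla c))
    (M_positive : forall c q, A c -> cimg c q -> positive_definite (h c q))
    (M_levi_civita : forall c, A c -> levi_civita (cimg c) (h c) (hnabla c))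
    (M_symmetric : pointwise_symmetry A h S nabla hnabla (@is_SO2 R 3) \/
                   pointwise_symmetry A h S nabla hnabla (@is_Z3 R 3))
    (M_functions : symmetry_functions A h S nabla hnabla e1 mu1 a eta)
    (a_eq : forall p, a p = - eta p ^+ 2 + mu1 p ^+ 2)
    (eta_eq : forall p, eta p = mu1 p) :
  forall p0 : M, exists (L : 'M[R]_4) (b : 'rV[R]_4), L \in unitmx /\
  forall p : M, connected_component [set: M] p0 p ->
  exists (kappa : chart R 3 M) (I : set R) (N : set 'rV[R]_2)
         (f : 'rV[R]_2 -> R) (gamma1 gamma2 : R -> R),
    [/\ admissible A kappa /\ cdom kappa p,
        [/\ open I, is_interval I, open N &
            forall t u v, cimg kappa (vec 3 [:: t; u; v]) <->
                          I t /\ N (vec 2 [:: u; v])],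
        improper_affine_sphere N (graph f) (vec 3 [:: 0; 0; 1]) /\
        affine_curve I gamma1 gamma2,
        (forall t u v, I t -> N (vec 2 [:: u; v]) ->
           F (cinv kappa (vec 3 [:: t; u; v])) *m L + b =
           vec 4 [:: u; v; f (vec 2 [:: u; v]) + gamma2 t; gamma1 t]) &
        (pointwise_symmetry A h S nabla hnabla (@is_SO2 R 3) ->
         exists2 E, elliptic_paraboloid E & graph f @` N `<=` E)].
Proof.
move=> p0; have [_ _ atlas comp] := M_manifold.
have [c0 Ac0 c0p0] := atlas p0.
have [_ [_ [_ _ _ _ [L [uL dL adL]]]]] := local_leafwise M_blaschke M_levi_civita
  M_symmetric M_functions a_eq eta_eq Ac0 (cto_img c0p0).
exists L, 0; split=> // p pp0.
have [c Ac cp] := atlas p; pose q := cto c p.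
have cq : cimg c q by exact: cto_img.
have adq : adapted_chart F xi e1 mu1 L c q.
  apply: (adapted_component M_manifold M_blaschke M_levi_civita M_symmetric
    M_functions a_eq eta_eq uL _ pp0 Ac cp).
  by exists c0.
have [W [theta [[Wq WU] lw sh KSO2 _]]] := local_leafwise M_blaschke M_levi_civita
  M_symmetric M_functions a_eq eta_eq Ac cq.
have [r r0 BW] : exists2 r : R, 0 < r & ball q r `<=` W.
  have /nbhs_ballP[r r0 BW] := open_nbhs_nbhs (conj (lw_open lw) Wq).
  by exists r.
have oB : open (ball q r) by exact: ball_open.
have Bq : ball q r q by exact: ballxx.
have lwB := leafwise_sub oB BW lw.
(* Adaptedness, already transported from [p0] to [p] through the component, now spreads from [q]
   over the whole ball. *)
have adB s (Bs : ball q r s) := adapted_ball lw uL BW Bq Bs adq.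
have BU := subset_trans BW WU.
have bl := M_blaschke c Ac; have oU := @cimg_open _ _ _ c.
have [V [Ginv [d [[oV Vq] VB d0 [VG GV] sGi]]]] := product_chart BU bl lwB uL adB Bq.
pose G := prodmap (F \o cinv c) L; pose z0 := G q.
have sG : smooth_on V G := smooth_sub VB (prodmap_smooth L lwB).
have oD : open (ball z0 d) by exact: ball_open.
have [kappa [Ak domk imgk invk]] := restrict_chart (comp c ^~ Ac) oV
  (subset_trans VB BU) oD VG GV sG sGi.
have GinvB z : ball z0 d z -> ball q r (Ginv z) /\ G (Ginv z) = z.
  by move=> Bz; have [Vz Gz] := GV z Bz; split=> //; exact: VB.
have embedV t u v : vec 3 [:: t; u; v] = embed t (vec 2 [:: u; v] : 'rV[R]_2).
  by rewrite /embed !mxE.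
exists kappa, (ball (z0 0 0 : R) d), (ball (vec 2 [:: z0 0 1; z0 0 2] : 'rV[R]_2) d).
exists (leaf_profile (F \o cinv c) L Ginv z0), id.
exists (curve_profile (F \o cinv c) L Ginv z0); split.
- by split=> //; exact: domk.
- split; [exact: ball_open| |exact: ball_open|].
    move=> s t; rewrite /ball /= => sI tI y /andP[sy yt].
    move: sI tI; rewrite !ltr_distl => /andP[s1 s2] /andP[t1 t2].
    by apply/andP; split; lra.
  by move=> t u v; rewrite imgk embedV; exact: ball_embed.
- split; first exact: (leaf_improper oU BU bl lwB uL adB dL GinvB sGi d0).
  exact: (curve_profile_affine oU BU bl lwB uL adB GinvB sGi d0).
- move=> t u v It Nuv; rewrite addr0 invk embedV.
  apply: etrans (product_formula oU BU bl lwB uL adB GinvB sGi d0 It Nuv) _.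
  by rewrite !mxE.
- move=> SO2; apply: (leaf_elliptic_paraboloid oU BU bl lwB uL adB dL GinvB sGi d0
    (M_levi_civita c Ac) (smooth_sub BW sh)) => [s Bs|s v w Bs].
    exact: M_positive c s Ac (BU s Bs).
  exact: KSO2 SO2 s v w (BW s Bs).
Qed.
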